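(* Let $s\in(\frac12,1)$, suppose $K:\mathbb{R}\to\mathbb{R}$ satisfies Assumption (A) (recalled in the context) and is not constant, and assume that $e^{\mu|x|}K\notin L^1(\mathbb{R})$ for all $\mu>0$. Then any solution $u\in L_s(\mathbb{R})$ of $$(-\Delta)^su=Ke^u\ \text{ in }\mathbb{R}\quad\text{with}\quad\int_{\mathbb{R}}Ke^u\,dx<+\infty$$ satisfies $u(x)=O(|x|^{2s-1})$ as $|x|\to\infty$.
   Context: Assumption (A): $K=K(x)>0$ is a strictly positive function on $\mathbb{R}$ which is even and monotone-decreasing in $|x|$; moreover $K$ is $C^1$ with $\partial_x\sqrt{K}\in L^\infty(\mathbb{R})$. For $s\in(0,1)$ and $\varphi\in C_c^\infty(\mathbb{R})$, $(-\Delta)^s\varphi(x) = C_s\,\mathrm{PV}\int_{\mathbb{R}}\frac{\varphi(x)-\varphi(y)}{|x-y|^{1+2s}}\,dy$ with $C_s = \frac{4^s}{\sqrt{\pi}}\frac{\Gamma(\frac12+s)}{|\Gamma(-s)|}$. The space $L_s(\mathbb{R})$ consists of all real-valued $u\in L^1_{\mathrm{loc}}(\mathbb{R})$ with $\int_{\mathbb{R}}\frac{|u(x)|}{1+|x|^{1+2s}}\,dx<+\infty$. A function $u\in L_s(\mathbb{R})$ with $e^u\in L^1_{\mathrm{loc}}(\mathbb{R})$ is a solution of $(-\Delta)^su=Ke^u$ if $\int_{\mathbb{R}}u(-\Delta)^s\varphi\,dx=\int_{\mathbb{R}}Ke^u\varphi\,dx$ for all $\varphi\in C_c^\infty(\mathbb{R})$.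 *)

(* Defs.v *)
From HB Require Import structures.
From mathcomp Require Import all_boot all_order all_algebra.
From mathcomp Require Import all_classical all_reals all_analysis.
Set Implicit Arguments.
Unset Strict Implicit.
Unset Printing Implicit Defensive.
Import Order.TTheory GRing.Theory Num.Theory.
Import numFieldNormedType.Exports.
Local Open Scope classical_set_scope.
Local Open Scope ring_scope.

Definition euler_gamma (R : realType) (z : R) : R :=
  Rintegral (@lebesgue_measure R) `]0, +oo[ (fun t => t `^ (z - 1) * expR (- t)).

(* For z <= 0, Gamma is the continuation of Euler's integral by the functional
   equation Gamma (z + 1) = z * Gamma z, applied just often enough to make the
   argument positive. At the poles z = 0, -1, -2, ... this is a junk value. *)
Definition Gamma (R : realType) (z : R) : R :=
  if 0 < z then euler_gamma z
  else let n := (Num.truncn (- z)).+1 in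
       euler_gamma (z + n%:R) / \prod_(k < n) (z + k%:R).

Definition fracLap_const (R : realType) (s : R) : R :=
  4 `^ s / Num.sqrt pi * (Gamma (2^-1 + s) / `|Gamma (- s)|).

Definition fracLap (R : realType) (s : R) (phi : R -> R) (x : R) : R :=
  fracLap_const s *
  lim ((fun eps : R =>
          Rintegral (@lebesgue_measure R) [set y | eps < `|x - y|]
            (fun y => (phi x - phi y) / `|x - y| `^ (1 + 2 * s))) @ 0^'+).

Definition test_function (R : realType) (phi : R -> R) : Prop :=
  (forall (n : nat) (x : R), derivable (derive1n n phi) x 1) /\
  compact (closure [set x | phi x != 0]).

Definition Lspace_s (R : realType) (s : R) (u : R -> R) : Prop :=
  locally_integrable setT u /\
  (\int[@lebesgue_measure R]_x (`|u x| / (1 + `|x| `^ (1 + 2 * s)))%:E < +oo)%E.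

(* Functions are Borel measurable representatives (this is what
   locally_integrable requires), not almost-everywhere classes. *)
Definition Liouville_solution (R : realType) (s : R) (K u : R -> R) : Prop :=
  [/\ Lspace_s s u,
      locally_integrable setT (fun x => expR (u x)) &
      forall phi : R -> R, test_function phi ->
        Rintegral (@lebesgue_measure R) setT (fun x => u x * fracLap s phi x) =
        Rintegral (@lebesgue_measure R) setT
          (fun x => K x * expR (u x) * phi x)].

Record assumptionA (R : realType) (K : R -> R) : Prop := AssumptionA {
  assumptionA_gt0 : forall x, 0 < K x ;
  assumptionA_even : forall x, K (- x) = K x ;
  assumptionA_decr : forall x y, `|x| <= `|y| -> K y <= K x ;
  assumptionA_derivable : forall x : R, derivable K x 1 ;
  assumptionA_continuous : continuous (derive1 K) ;
  assumptionA_sqrt :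
    derive1 (fun x => Num.sqrt (K x)) \in Lfun (@lebesgue_measure R) +oo%E
}.

(* Main.v *)
Require Import Defs.
From HB Require Import structures.
From mathcomp Require Import all_boot all_order all_algebra.
From mathcomp Require Import all_classical all_reals all_analysis.
From mathcomp Require Import measurable_realfun lebesgue_integral_under ring lra.
Set Implicit Arguments.
Unset Strict Implicit.
Unset Printing Implicit Defensive.
Import Order.TTheory GRing.Theory Num.Theory.
Import numFieldNormedType.Exports.
Local Open Scope classical_set_scope.
Local Open Scope ring_scope.

(** Write al = 2s - 1 and f = K e^u. Up to a nonzero constant m, |x|^al is a
    fundamental solution of (-Delta)^s on the line. Hence the potential
    v(y) = m^-1 int (|x-y|^al - |x|^al) f(x) dx, which is O(|y|^al) because t^al is
    al-Holder, should satisfy the same equation as u. To compare them using only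
    compactly supported test functions, fix such a function rho and let
    phi = int |.-y|^al rho''(y) dy: then (-Delta)^s phi is a multiple of rho'', and
    the two derivatives on rho make phi decay fast enough for the equation, tested
    with phi times a cutoff at scale r, to pass to the limit r -> oo. This shows
    that (u - v)'' = 0 weakly, so u - v = a + b x almost everywhere. If b were
    nonzero, f would dominate e^(|b||x|/2) K on a half line, hence, K being even,
    e^(|b||x|/2) K would be integrable, which is excluded. So b = 0. *)

(** * Affine changes of variables and elementary integrals *)

Section affine_change.
Context {R : realType}.
Local Notation mu := (@lebesgue_measure R).
Implicit Types (D : set R) (f g : R -> R).

(** The solution u is controlled only through the weight (1+|x|)^-(1+2s), so the error made in
    truncating a test function is harmless only if its fractional Laplacian is small against exactly
    this weight. Functions with integrable decay, whose second derivative decays two powers faster,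
    have such a fractional Laplacian. This dictates the number of derivatives on rho: |.|^al
    convolved with rho' decays in general only like |x|^(al-1), which is not integrable, whereas
    rho'' gives |x|^(al-2), which is. The price is that u - v is determined up to an affine function
    instead of a constant. That |x|^al is a fundamental solution is obtained without Fourier
    analysis and without the exact constant. Its primitive [spow] is odd and homogeneous, so scaling
    alone shows that the second-difference integral of [spow] is a multiple of the sign function,
    whose derivative is twice the delta measure. The multiple is nonzero because the second
    differences at 1 have a strict sign, and m != 0 is all that the comparison of u with v needs. *)

Lemma measurable_affine (a c : R) : measurable_fun setT (fun x : R => a + c * x).
Proof. by apply: measurable_funD => //; apply: measurable_funM. Qed.

(** The right-hand side is a measure, a rescaled pushforward, that agrees with Lebesgue measure on
    half-open intervals; uniqueness does the rest. For c < 0 the preimage is closed at the other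
    end, which does not affect its length. *)
Lemma lebesgue_measure_affine (a c : R) (A : set R) : c != 0 -> measurable A ->
  mu A = (`|c|%:E * mu ((fun x => a + c * x)%R @^-1` A))%E.
Proof.
move=> c0 mA.
pose m := mscale (NngNum (normr_ge0 c))
  (pushforward mu ((fun x => a + c * x)%R : R -> measurableTypeR R)).
rewrite (_ : (_ * _)%E = m (measurable_affine a c) A)//.
apply: lebesgue_measure_unique => //= _ [[p q]] _ <-.
rewrite /m /mscale/= -[pushforward _ _ _]/(mu (_ @^-1` _)).
have [cp|cn|] := ltgtP c 0; last by move/eqP: c0.
- have -> : (fun x => a + c * x) @^-1` `]p, q]%classic =
     `[(q - a) / c, (p - a) / c[%classic.
    apply/seteqP; split => x /=; rewrite !in_itv/= ler_ndivrMr// ltr_ndivlMr//;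
      move=> /andP[? ?]; apply/andP; split; lra.
  rewrite !lebesgue_measure_itv/= !lte_fin ltr_nM2r ?invr_lt0//.
  rewrite ltrBlDr subrK; case: ifPn => pq; last by rewrite mule0.
  rewrite -!EFinD -EFinM; congr EFin; rewrite ltr0_norm//; field.
  by rewrite lt_eqF.
- have -> : (fun x => a + c * x) @^-1` `]p, q]%classic =
     `](p - a) / c, (q - a) / c]%classic.
    apply/seteqP; split => x /=; rewrite !in_itv/= ler_pdivlMr// ltr_pdivrMr//;
      move=> /andP[? ?]; apply/andP; split; lra.
  rewrite !lebesgue_measure_itv/= !lte_fin ltr_pM2r ?invr_gt0//.
  rewrite ltrBlDr subrK; case: ifPn => pq; last by rewrite mule0.
  rewrite -!EFinD -EFinM; congr EFin; rewrite gtr0_norm//; field.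
  by rewrite gt_eqF.
Qed.

Lemma measurable_preimage_affine (a c : R) D : measurable D ->
  measurable ((fun x : R => a + c * x) @^-1` D).
Proof. by move=> mD; rewrite -[X in measurable X]setTI; exact: measurable_affine. Qed.

Lemma ge0_integral_affine (a c : R) (h : R -> \bar R) D : c != 0 ->
  measurable D -> measurable_fun D h -> (forall x, D x -> 0 <= h x)%E ->
  (\int[mu]_(x in D) h x =
   `|c|%:E * \int[mu]_(x in (fun x => a + c * x)%R @^-1` D) h (a + c * x)%R)%E.
Proof.
move=> c0 mD mh h0.
pose ph := ((fun x => a + c * x)%R : R -> measurableTypeR R).
pose m := mscale (NngNum (normr_ge0 c)) (pushforward mu ph).
rewrite (@eq_measure_integral _ _ _ _ (m (measurable_affine a c)) mu); last first.
  by move=> A mA AD; exact: (lebesgue_measure_affine a c0 mA).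
rewrite ge0_integral_mscale//=.
congr (_ * _)%E.
rewrite ge0_integral_pushforward//.
- exact: measurable_affine.
- by move=> x; rewrite inE; exact: h0.
Qed.

Lemma integrable_affine (a c : R) f D : c != 0 -> measurable D ->
  mu.-integrable D (EFin \o f) ->
  mu.-integrable ((fun x => a + c * x)%R @^-1` D) (fun x => (f (a + c * x))%:E).
Proof.
move=> c0 mD /integrableP[mf foo]; apply/integrableP; split.
  apply/measurable_EFinP.
  apply: (@measurable_comp _ _ _ _ _ _ D f _ (fun x => a + c * x)) => //.
  - by move=> _ [x /= Dx <-].
  - exact/measurable_EFinP.
  - by apply: measurable_funTS; exact: measurable_affine.
move: foo; rewrite (@ge0_integral_affine a c (fun x => `|(f x)%:E|%E))//; last first.
  exact: measurableT_comp.
by rewrite -lte_pdivlMl ?normr_gt0// gt0_muley// lte_fin invr_gt0 normr_gt0.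
Qed.

Lemma Rintegral_affine (a c : R) f D : c != 0 -> measurable D ->
  mu.-integrable D (EFin \o f) ->
  \int[mu]_(x in D) f x =
  `|c| * \int[mu]_(x in (fun x => a + c * x)%R @^-1` D) f (a + c * x).
Proof.
move=> c0 mD intf.
have [mf _] := integrableP _ _ _ intf.
rewrite /Rintegral integralE (@ge0_integral_affine a c)//; last first.
  exact: measurable_funepos.
rewrite [X in (_ - X)%E](@ge0_integral_affine a c)//; last first.
  exact: measurable_funeneg.
have intf' := integrable_affine a c0 mD intf.
have mA := measurable_preimage_affine a c mD.
pose h x := (f (a + c * x))%:E.
have Ep x : ((EFin \o f)^\+)%E (a + c * x) = (h^\+)%E x.
  by rewrite !funeposE.
have En x : ((EFin \o f)^\-)%E (a + c * x) = (h^\-)%E x.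
  by rewrite !funenegE.
set A := _ @^-1` D in mA intf' *.
transitivity (fine (`|c|%:E * \int[mu]_(x in A) (h^\+ x) -
                    `|c|%:E * \int[mu]_(x in A) (h^\- x))%E).
  by congr (fine (_ * _ - _ * _)%E); apply: eq_integral => x _;
    [exact: Ep|exact: En].
have /(_ mA) p := integrable_pos_fin_num _ intf'.
have /(_ mA) n := integrable_neg_fin_num _ intf'.
rewrite -muleBr//; last by rewrite fin_num_adde_defl// fin_numN.
by rewrite [in RHS]integralE fineM// fin_numB p.
Qed.
End affine_change.

Section integral_bounds.
Context {R : realType}.
Local Notation mu := (@lebesgue_measure R).
Implicit Types (D : set R) (f g : R -> R).

Lemma integrable_le D f g : measurable D -> measurable_fun D f ->
  mu.-integrable D (EFin \o g) -> (forall x, D x -> `|f x| <= g x) ->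
  mu.-integrable D (EFin \o f).
Proof.
move=> mD mf ig fg; apply: le_integrable ig => //.
  exact/measurable_EFinP.
by move=> x Dx /=; rewrite lee_fin (le_trans (fg _ Dx))// ler_norm.
Qed.

Lemma normr_Rintegral_le D f g : measurable D -> measurable_fun D f ->
  mu.-integrable D (EFin \o g) -> (forall x, D x -> `|f x| <= g x) ->
  `|\int[mu]_(x in D) f x| <= \int[mu]_(x in D) g x.
Proof.
move=> mD mf ig fg.
have fi := integrable_le mD mf ig fg.
apply: (le_trans (le_normr_Rintegral _ fi)) => //.
apply: le_Rintegral => //.
exact: integrable_norm.
Qed.

Lemma cvg_powRN_y (q : R) : 0 < q -> x `^ (- q) @[x --> +oo] --> 0.
Proof.
move=> q0; apply/cvgrPdist_le => e e0.
near=> x.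
rewrite sub0r normrN ger0_norm ?powR_ge0//.
have -> : e = (e `^ (- q^-1)) `^ (- q).
  by rewrite -powRrM mulrNN mulVf ?gt_eqF// powRr1// ltW.
set M := e `^ (- q^-1); have M0 : 0 < M by exact: powR_gt0.
have Mx : M <= x by near: x; apply: nbhs_pinfty_ge; exact: num_real.
rewrite !powRN lef_pV2 ?posrE ?powR_gt0 ?(lt_le_trans M0 Mx)//.
by apply: ge0_ler_powR; rewrite ?nnegrE ?(ltW q0) ?(ltW M0) ?(le_trans (ltW M0) Mx).
Unshelve. all: by end_near. Qed.

Lemma continuous_powR (p x : R) : 0 < x -> {for x, continuous (fun z : R => z `^ p)}.
Proof.
move=> x0; apply: differentiable_continuous; apply/derivable1_diffP.
exact: (@ex_derive _ _ _ _ _ _ _ (is_derive1_powR p x0)).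
Qed.

Lemma integral_powR_tail (p a : R) : 1 < p -> 0 < a ->
  (\int[mu]_(z in `]a, +oo[) (z `^ (- p))%:E = (a `^ (1 - p) / (p - 1))%:E)%E.
Proof.
move=> p1 a0.
have p10 : p - 1 != 0 by rewrite subr_eq0 gt_eqF.
have dF (x : R) : 0 < x ->
    is_derive x 1 (fun z : R => - (z `^ (1 - p) / (p - 1))) (x `^ (- p)).
  move=> x0; have := is_derive1_powR (1 - p) x0 => ?.
  apply: is_derive_eq; rewrite /GRing.scale/=.
  rewrite (_ : 1 - p - 1 = - p); last by ring.
  by field.
rewrite integral_itv_obnd_cbnd; last first.
  apply/measurable_EFinP/measurable_funTS; exact: measurable_powR.
rewrite (@ge0_continuous_FTC2y _ _ (fun z => - (z `^ (1 - p) / (p - 1))) a 0)//.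
- by rewrite sub0e EFinN oppeK.
- by move=> x _; exact: powR_ge0.
- apply: continuous_in_subspaceT => x; rewrite inE/= in_itv/= andbT => ax.
  exact/continuous_powR/(lt_le_trans a0).
- rewrite -oppr0; apply: cvgN; rewrite -(mul0r (p - 1)^-1).
  apply: cvgMl; rewrite -opprB; apply: cvg_powRN_y; rewrite subr_gt0//.
- by move=> x ax; have [] := dF x (lt_trans a0 ax).
- apply: cvgN; apply: cvgMl; apply: cvg_at_right_filter.
  exact: continuous_powR.
- move=> x; rewrite in_itv/= andbT => ax.
  by rewrite derive1E; have [_ ->] := dF x (lt_trans a0 ax).
Qed.
Lemma integrable_powR_tail (p a : R) : 1 < p -> 0 < a ->
  mu.-integrable `]a, +oo[ (EFin \o (fun z => z `^ (- p))).
Proof.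
move=> p1 a0; apply/integrableP; split.
  apply/measurable_EFinP/measurable_funTS; exact: measurable_powR.
under eq_integral do rewrite /= ger0_norm ?powR_ge0//.
by rewrite integral_powR_tail// ltry.
Qed.

Lemma Rintegral_powR_tail (p a : R) : 1 < p -> 0 < a ->
  \int[mu]_(z in `]a, +oo[) (z `^ (- p)) = a `^ (1 - p) / (p - 1).
Proof. by move=> p1 a0; rewrite /Rintegral integral_powR_tail. Qed.

Lemma le_integral_powR0 (p b : R) : p < 1 -> 0 < b ->
  (\int[mu]_(z in `]0%R, b]) (z `^ (- p))%:E <= (b `^ (1 - p) / (1 - p))%:E)%E.
Proof.
move=> p1 b0.
have p10 : 1 - p != 0 by rewrite subr_eq0 gt_eqF.
have dF (x : R) : 0 < x ->
    is_derive x 1 (fun z : R => (z `^ (1 - p) / (1 - p))) (x `^ (- p)).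
  move=> x0; have := is_derive1_powR (1 - p) x0 => ?.
  apply: is_derive_eq; rewrite /GRing.scale/=.
  rewrite (_ : 1 - p - 1 = - p); last by ring.
  by field.
(* The integrand may blow up at 0, so the interval is exhausted by compact ones, on which the
   fundamental theorem of calculus applies. The index n+2 keeps the left end strictly below b. *)
pose F n : set R := `[b / n.+2%:R, b]%classic.
have bn n : 0 < b / n.+2%:R < b.
  by rewrite divr_gt0//= ltr_pdivrMr// ltr_pMr// ltr1n.
have -> : `]0, b]%classic = \bigcup_n F n.
  apply/seteqP; split=> [x|x [n _]]; rewrite /F/= !in_itv/=; last first.
    by move=> /andP[h ->]; have /andP[h' _] := bn n; rewrite (lt_le_trans h').
  move=> /andP[x0 xb]; exists (Num.truncn (b / x)) => //=; rewrite in_itv/= xb andbT.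
  rewrite ler_pdivrMr// mulrC -ler_pdivrMr//.
  by rewrite (le_trans (ltW (truncnS_gt _)))// ler_nat.
have c : (\int[mu]_(z in F n) (z `^ (- p))%:E @[n --> \oo] -->
    \int[mu]_(z in \bigcup_n F n) (z `^ (- p))%:E)%E.
  apply: ge0_nondecreasing_set_cvg_integral.
  - move=> m n mn; apply/subsetPset => x; rewrite /F/= !in_itv/= => /andP[h ->].
    rewrite andbT (le_trans _ h)// ler_pM2l// lef_pV2 ?posrE// ler_nat.
    by rewrite !ltnS.
  - by move=> n; exact: measurable_itv.
  - move=> n; apply/measurable_EFinP/measurable_funTS; exact: measurable_powR.
  - by move=> n x _; rewrite lee_fin powR_ge0.
rewrite -(cvg_lim _ c)//.
apply: lime_le.
  by apply/cvg_ex; eexists; exact: c.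
near=> n.
have /andP[n0 nb] := bn n.
have pos (x : R) : x \in `[b / n.+2%:R, b] -> 0 < x.
  by rewrite in_itv/= => /andP[+ _]; exact: lt_le_trans.
rewrite /F (@continuous_FTC2 _ _ (fun z : R => (z `^ (1 - p) / (1 - p))))//.
- rewrite -EFinB lee_fin lerBlDr lerDl divr_ge0 ?powR_ge0// subr_ge0 ltW//.
- apply: continuous_in_subspaceT => x; rewrite inE => /pos.
  exact: continuous_powR.
- split.
  + move=> x /subset_itv_oo_cc /pos x0; by have [] := dF x x0.
  + apply: cvgMl; apply: cvg_at_right_filter; exact: continuous_powR.
  + apply: cvgMl; apply: cvg_at_left_filter; exact: continuous_powR.
- move=> x /subset_itv_oo_cc /pos x0.
  by rewrite derive1E; have [_ ->] := dF x x0.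
Unshelve. all: by end_near. Qed.

Lemma integrable_powR0 (p b : R) : p < 1 -> 0 < b ->
  mu.-integrable `]0, b] (EFin \o (fun z => z `^ (- p))).
Proof.
move=> p1 b0; apply/integrableP; split.
  apply/measurable_EFinP/measurable_funTS; exact: measurable_powR.
under eq_integral do rewrite /= ger0_norm ?powR_ge0//.
by rewrite (le_lt_trans (le_integral_powR0 _ _))// ltry.
Qed.

Lemma le_Rintegral_powR0 (p b : R) : p < 1 -> 0 < b ->
  \int[mu]_(z in `]0, b]) (z `^ (- p)) <= b `^ (1 - p) / (1 - p).
Proof.
move=> p1 b0; rewrite -lee_fin fineK; first exact: le_integral_powR0.
apply: integrable_fin_num => //.
exact: integrable_powR0.
Qed.

Lemma even_integrable f : measurable_fun setT f -> (forall x, 0 <= f x) ->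
  (forall x, f (- x) = f x) -> mu.-integrable `]0, +oo[ (EFin \o f) ->
  mu.-integrable setT (EFin \o f).
Proof.
move=> mf f0 fe /integrableP[_ i].
apply/integrableP; split; first exact/measurable_EFinP.
have mf' D : measurable_fun D (fun x => `|f x|%:E).
  by apply/measurable_EFinP/measurableT_comp => //; exact: measurable_funTS.
rewrite -(setUv `]0, +oo[%classic) setCitvr ge0_integral_setU//=.
- rewrite lte_add_pinfty//.
  rewrite (@ge0_integral_affine _ 0 (-1) (fun x => `|f x|%:E))//=.
  rewrite normrN normr1 mul1e.
  have -> : (fun x => 0 + -1 * x)%R @^-1` `]-oo, 0%R] = `[0%R, +oo[%classic :> set R.
    apply/seteqP; split => x /=; rewrite !in_itv/= ?andbT mulN1r add0r oppr_le0//.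
  under eq_integral do rewrite mulN1r add0r fe.
  by rewrite -integral_itv_obnd_cbnd//.
- exact: mf'.
- by rewrite -setCitvr; apply/disj_setPS; rewrite setICr.
Qed.

Lemma integrable_bracket (p : R) : 1 < p ->
  mu.-integrable setT (EFin \o (fun x : R => (1 + `|x|) `^ (- p))).
Proof.
move=> p1; apply: even_integrable => //.
- apply: (@measurableT_comp _ _ _ _ _ _ (fun z : R => z `^ (- p))).
    exact: measurable_powR.
  by apply: measurable_funD => //; exact: measurableT_comp.
- by move=> x; rewrite normrN.
- have := @integrable_affine _ 1 1 (fun z => z `^ (- p)) `]1, +oo[%classic
   (oner_neq0 _) (measurable_itv _) (integrable_powR_tail p1 ltr01).
  have -> : (fun x => 1 + 1 * x)%R @^-1` `]1, +oo[ = `]0, +oo[%classic :> set R.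
    by apply/seteqP; split => x /=; rewrite !in_itv/= !andbT mul1r ltrDl.
  apply: eq_integrable => // x; rewrite inE/= in_itv/= andbT => x0.
  by rewrite mul1r gtr0_norm.
Qed.
End integral_bounds.

(** * Smooth functions and test functions *)

Lemma le_powR_base (R : realType) (r x y : R) : 0 <= r -> 0 <= x -> x <= y ->
  x `^ r <= y `^ r.
Proof.
by move=> r0 x0 xy; apply: ge0_ler_powR; rewrite ?nnegrE// (le_trans x0).
Qed.

Section smooth_functions.
Context {R : realType}.
Implicit Types (f g : R -> R).

Definition smooth f := forall n x, derivable (derive1n n f) x 1.

(** Derivatives are peeled off from the inside, while [derive1n] adds them on the outside; sums and
    products then go by induction on the order, with f and g generalised. *)
Fixpoint derivable_upto n f : Prop :=
  (forall x, derivable f x 1) /\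
  match n with 0%N => True | m.+1 => derivable_upto m (derive1 f) end.

Lemma derivable_upto_le n f : derivable_upto n.+1 f -> derivable_upto n f.
Proof.
elim: n f => [|n IH] f [d d']; first by split.
by split; [exact: d|exact: IH d'].
Qed.

Lemma derive1nSr n f : derive1n n.+1 f = derive1n n (derive1 f).
Proof. by rewrite /derive1n iterSr. Qed.

Lemma smooth_uptoP f : smooth f <-> forall n, derivable_upto n f.
Proof.
split.
  move=> sf n; elim: n f sf => [|n IH] f sf; split => //; try exact: (sf 0%N).
  by apply: IH => n' x; have := sf n'.+1 x; rewrite derive1nSr.
move=> df n x; elim: n f df => [|n IH] f df; first by have [] := df 0%N.
by rewrite derive1nSr; apply: IH => m; have [] := df m.+1.
Qed.

Lemma smooth_derive1 f : smooth f -> smooth (derive1 f).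
Proof. by move=> sf n x; have := sf n.+1 x; rewrite derive1nSr. Qed.

Lemma smooth_derive1n k f : smooth f -> smooth (derive1n k f).
Proof.
move=> sf; elim: k => [//|k]; rewrite derive1nS; exact: smooth_derive1.
Qed.

Lemma smooth_derivable f x : smooth f -> derivable f x 1.
Proof. by move/(_ 0%N x). Qed.

Lemma smooth_is_derive f (x : R) : smooth f -> is_derive x 1 f (derive1 f x).
Proof.
move=> sf; split; first exact: smooth_derivable.
by rewrite derive1E.
Qed.

Lemma derivable_continuous f (x : R) : derivable f x 1 -> {for x, continuous f}.
Proof. by move/derivable1_diffP => /differentiable_continuous. Qed.

Lemma smooth_continuous f : smooth f -> continuous f.
Proof. by move=> sf x; apply/derivable_continuous/smooth_derivable. Qed.

(** Spares the computation of iterated derivatives: it is enough to exhibit a family that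
    differentiation preserves, such as rescaled affine compositions, the functions [exp_inv p], or
    convolutions with test functions. *)
Lemma smooth_coind (P : (R -> R) -> Prop) :
  (forall f, P f -> (forall x, derivable f x 1) /\ P (derive1 f)) ->
  forall f, P f -> smooth f.
Proof.
move=> H f Pf n; elim: n f Pf => [|n IH] f Pf; first by have [] := H f Pf.
by rewrite derive1nSr; apply: IH; have [] := H f Pf.
Qed.

Lemma derivable_uptoD n f g : derivable_upto n f -> derivable_upto n g ->
  derivable_upto n (fun x => f x + g x).
Proof.
elim: n f g => [|n IH] f g [df df'] [dg dg'].
  by split=> [x|]; [exact: (@derivableD _ _ _ f g)|].
split=> [x|]; first exact: (@derivableD _ _ _ f g).
rewrite (_ : derive1 _ = fun x => derive1 f x + derive1 g x); first exact: IH.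
by apply/funext => x; rewrite !derive1E (@deriveD _ _ _ f g).
Qed.

Lemma derivable_uptoM n f g : derivable_upto n f -> derivable_upto n g ->
  derivable_upto n (fun x => f x * g x).
Proof.
elim: n f g => [|n IH] f g df dg.
  by split=> [x|]; [apply: (@derivableM _ _ f g); [case: df|case: dg]|].
split=> [x|]; first by apply: (@derivableM _ _ f g); [case: df|case: dg].
have := derivable_upto_le df; have := derivable_upto_le dg.
case: df => df df'; case: dg => dg dg' dgl dfl.
rewrite (_ : derive1 _ = fun x => f x * derive1 g x + g x * derive1 f x).
  by apply: derivable_uptoD; exact: IH.
by apply/funext => x; rewrite !derive1E (@deriveM _ _ f g).
Qed.

Lemma smoothD f g : smooth f -> smooth g -> smooth (fun x => f x + g x).
Proof.
move=> /smooth_uptoP sf /smooth_uptoP sg; apply/smooth_uptoP => n.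
exact: derivable_uptoD.
Qed.

Lemma smoothM f g : smooth f -> smooth g -> smooth (fun x => f x * g x).
Proof.
move=> /smooth_uptoP sf /smooth_uptoP sg; apply/smooth_uptoP => n.
exact: derivable_uptoM.
Qed.

Lemma derive1_cst (c : R) : derive1 (fun=> c : R) = fun=> 0.
Proof. by apply/funext => x; rewrite derive1E derive_cst. Qed.

Lemma smooth_cst (c : R) : smooth (fun=> c).
Proof.
apply: (@smooth_coind (fun f => exists c, f = fun=> c)); last by exists c.
move=> _ [d ->]; split=> [x|]; first exact: derivable_cst.
by exists 0; rewrite derive1_cst.
Qed.

Lemma is_derive_affine_comp (a c x df : R) f :
  is_derive (a + c * x) 1 f df ->
  is_derive x 1 (fun x => f (a + c * x)) (c * df).
Proof.
move=> fd.
have -> : (fun x => f (a + c * x)) = f \o (fun x => a + c * x) by [].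
rewrite mulrC; apply: is_derive1_comp.
have : is_derive x 1 (cst a + c *: (@id R)) (0 + c *: 1) by apply: is_deriveD.
by rewrite add0r /GRing.scale/= mulr1.
Qed.

Lemma smooth_affine_comp (a c : R) f : smooth f -> smooth (fun x => f (a + c * x)).
Proof.
move=> sf.
apply: (@smooth_coind (fun h => exists e g, smooth g /\ h = (fun x => e * g (a + c * x)))); last first.
  by exists 1, f; split => //; apply/funext => x; rewrite mul1r.
move=> _ [e [g [sg ->]]]; have dg (x : R) : is_derive x 1 (fun x => g (a + c * x)) (c * derive1 g (a + c * x)).
  exact/is_derive_affine_comp/smooth_is_derive.
split=> [x|]; first by apply: (@derivableM _ _ (cst e)) => //; have [] := dg x.
exists (e * c), (derive1 g); split; first exact: smooth_derive1.
apply/funext => x; rewrite derive1E.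
by rewrite -mulrA; have [_] := is_deriveZ e (dg x).
Qed.

Lemma smoothZ (c : R) f : smooth f -> smooth (fun x => c * f x).
Proof. by move=> sf; apply: smoothM; [exact: smooth_cst|exact: sf]. Qed.

Lemma test_functionP f : test_function f <->
  smooth f /\ exists2 B : R, 0 < B & forall x, B <= `|x| -> f x = 0.
Proof.
split=> [[sf cf]|[sf [B B0 fB]]].
  split => //.
  have [M [Mr MB]] := compact_bounded cf.
  (* The closure is bounded by every number above M, in particular by |M| + 1; the value |M| + 2
     leaves a strict gap. *)
  exists (`|M| + 2); first by rewrite ltr_wpDl.
  move=> x xM; apply: contrapT => /eqP fx0.
  have := MB (`|M| + 1) _ x (@subset_closure _ [set x | f x != 0] _ fx0).
  rewrite ltr_pwDr//; last by rewrite ler_norm.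
  by move=> /(_ isT); apply/negP; rewrite -ltNge (lt_le_trans _ xM)// ltrD2l ltr1n.
split => //; apply: (@subclosed_compact _ _ `[- B, B]%classic).
- exact: closed_closure.
- exact: segment_compact.
- rewrite [X in _ `<=` X](closure_id _).1; last exact: itv_closed.
  apply: closure_subset => x /= fx; rewrite in_itv/= -ler_norml leNgt.
  by apply: contra fx => /ltW/fB ->.
Qed.

End smooth_functions.

Section test_functions.
Context {R : realType}.
Implicit Types (f g : R -> R).

Lemma test_smooth f : test_function f -> smooth f.
Proof. by case. Qed.

(** The strict inequality provides a neighbourhood of x on which f vanishes. It is the reason why
    radii of supports are enlarged when derivatives are taken. *)
Lemma derive1_locally0 f (B : R) : (forall x, B <= `|x| -> f x = 0) ->
  forall x, B < `|x| -> derive1 f x = 0.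
Proof.
move=> fB x Bx; rewrite derive1E (@near_eq_derive _ _ _ f (cst 0)) ?derive_cst//.
near=> y; rewrite fB//; apply/ltW; near: y.
have : {for x, continuous (fun y : R => `|y|)} by exact: norm_continuous.
by move/cvgr_gt; apply.
Unshelve. all: by end_near. Qed.

Lemma test_derive1 f : test_function f -> test_function (derive1 f).
Proof.
move=> /test_functionP[sf [B B0 fB]]; apply/test_functionP; split.
  exact: smooth_derive1.
exists (B + 1); first by rewrite ltr_wpDl// ltW.
by move=> x xB; apply: (derive1_locally0 fB); rewrite (lt_le_trans _ xB)// ltrDl.
Qed.

Lemma test_derive1n n f : test_function f -> test_function (derive1n n f).
Proof.
by move=> tf; elim: n => [//|n]; rewrite derive1nS; exact: test_derive1.
Qed.

Lemma test_bounded f : test_function f -> exists2 M : R, 0 < M & forall x, `|f x| <= M.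
Proof.
move=> /test_functionP[sf [B B0 fB]].
have BB : - B <= B by rewrite lerNl (le_trans _ (ltW B0))// oppr_le0 ltW.
have cf : {within `[- B, B], continuous (fun x => `|f x|)}.
  apply: continuous_subspaceT => x; apply: continuous_comp.
    exact: smooth_continuous.
  exact: norm_continuous.
have [c cB fc] := EVT_max BB cf.
exists (`|f c| + 1); first by rewrite ltr_wpDl.
move=> x; have [xB|Bx] := lerP `|x| B.
  by rewrite (le_trans (fc x _)) ?lerDl// in_itv/= -ler_norml.
by rewrite fB ?normr0 ?addr_ge0// ltW.
Qed.

Lemma test_affine_comp (a c : R) f : c != 0 -> test_function f ->
  test_function (fun x => f (a + c * x)).
Proof.
move=> c0 /test_functionP[sf [B B0 fB]]; apply/test_functionP; split.
  exact: smooth_affine_comp.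
exists ((B + `|a|) / `|c|); first by rewrite divr_gt0 ?normr_gt0// ltr_wpDr.
move=> x; rewrite ler_pdivrMr ?normr_gt0// mulrC -normrM => h.
apply: fB; rewrite -lerBrDr in h; apply: (le_trans h).
by rewrite lerBlDr (le_trans _ (ler_normB (a + c * x) a))// addrAC subrr add0r.
Qed.

End test_functions.

(** * A smooth bump function *)

Section bump.
Context {R : realType}.

(* The functions p(1/x) e^(-1/x) are stable under differentiation, hence smooth. *)
Definition exp_inv (p : {poly R}) (x : R) : R :=
  if 0 < x then p.[x^-1] * expR (- x^-1) else 0.

Lemma exprn_le_expR (t : R) n : 0 <= t -> t ^+ n <= n`!%:R * expR t.
Proof.
move=> t0; case: n => [|n]; first by rewrite expr0 mul1r -expR0 ler_expR.
rewrite mulrC -ler_pdivrMr ?ltr0n ?fact_gt0//.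
by rewrite (le_trans _ (expR_ge1Dxn n t0))// lerDr.
Qed.

Lemma horner_le_expR (p : {poly R}) : exists2 C : R, 0 <= C &
  forall t, 0 <= t -> `|p.[t]| <= C * expR t.
Proof.
exists (\sum_(i < size p) `|p`_i| * i`!%:R); first by apply: sumr_ge0 => i _; rewrite mulr_ge0.
move=> t t0; rewrite horner_coef (le_trans (ler_norm_sum _ _ _))// mulr_suml.
apply: ler_sum => i _; rewrite normrM -mulrA ler_wpM2l//.
by rewrite normrX ger0_norm// exprn_le_expR.
Qed.

(** Bounding p * X instead of p by the exponential gains a factor x. Applied once more to p * X, the
    lemma yields O(x^2) at the origin, hence a zero derivative there. *)
Lemma exp_inv_bound (p : {poly R}) : exists2 C : R, 0 <= C &
  forall x, `|exp_inv p x| <= C * `|x|.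
Proof.
have [C C0 pC] := horner_le_expR (p * 'X).
exists C => // x; rewrite /exp_inv; case: ifPn => x0; last first.
  by rewrite normr0 mulr_ge0.
have := pC x^-1; rewrite invr_ge0 (ltW x0) => /(_ isT).
rewrite hornerM hornerX expRN !normrM (gtr0_norm x0) !normfV (gtr0_norm x0).
rewrite (gtr0_norm (expR_gt0 _)) ler_pdivrMr// mulrAC -ler_pdivrMr ?expR_gt0//.
Qed.

(** Serves at the origin for [exp_inv] and [spow], where the differentiation rules do not apply but
    the remainder is explicitly superlinear. *)
Lemma is_derive_of_bound (f : R -> R) (a l C g : R) : 0 < g ->
  (forall h, `|f (h + a) - f a - l * h| <= C * `|h| `^ (1 + g)) ->
  is_derive a 1 f l.
Proof.
move=> g0 H.
have C0 : 0 <= C.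
  by have := le_trans (normr_ge0 _) (H 1); rewrite normr1 powR1 mulr1.
have cv : h^-1 *: (f (h *: 1 + a) - f a) @[h --> 0^'] --> l.
  apply/cvgrPdist_le => e e0.
  pose d := (e / (C + 1)) `^ g^-1.
  have C10 : 0 < C + 1 by rewrite ltr_wpDl.
  have d0 : 0 < d by rewrite powR_gt0// divr_gt0.
  near=> h.
  have h0 : h != 0 by near: h; exact: nbhs_dnbhs_neq.
  have nh0 : 0 < `|h| by rewrite normr_gt0.
  have hd : `|h| <= d by near: h; apply: dnbhs0_le.
  rewrite [h *: 1]mulr1 -[X in `|X - _|](mulfK h0) mulrC.
  rewrite /GRing.scale/= -mulrBr normrM normfV mulrC ler_pdivrMr// distrC.
  have := H h; rewrite mulrC => /le_trans; apply.
  rewrite powRD; last by rewrite (gt_eqF nh0) implybT.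
  rewrite powRr1// mulrCA mulrC ler_pM2r//.
  have : `|h| `^ g <= e / (C + 1).
    have -> : e / (C + 1) = d `^ g.
      by rewrite /d -powRrM mulVf ?gt_eqF// powRr1// divr_ge0 ?ltW.
    by apply: le_powR_base => //; exact: ltW.
  rewrite ler_pdivlMr// mulrC => /(le_trans _); apply.
  by rewrite ler_wpM2r ?powR_ge0// lerDl.
apply: DeriveDef; last exact: cvg_lim cv.
by apply/cvg_ex; exists l.
Unshelve. all: by end_near. Qed.

(** For x > 0 the chain rule gives x^-2 (p - p')(1/x) e^(-1/x), again of the same form with
    polynomial X^2 (p - p'). *)
Lemma is_derive_exp_inv (p : {poly R}) (x : R) :
  is_derive x 1 (exp_inv p) (exp_inv ('X^2 * (p - p^`())) x).
Proof.
have [x0|x0|->] := ltgtP x 0.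
- rewrite [X in is_derive _ _ _ X]/exp_inv ltNge (ltW x0)/=.
  apply: (near_eq_is_derive (f := cst 0)) => //.
    near=> y; rewrite /exp_inv ltNge (_ : y <= 0)//=.
    by apply/ltW; near: y; exact: lt_nbhsl.
- rewrite [X in is_derive _ _ _ X]/exp_inv x0.
  have di : is_derive x 1 (fun y : R => y^-1) (- x ^- 2 *: 1).
    by apply: is_deriveV => //; rewrite gt_eqF.
  have d1 : is_derive x 1 (horner p \o (fun y : R => y^-1))
    (p^`().[x^-1] * (- x ^- 2 *: 1)) by exact: is_derive1_comp.
  have dN : is_derive x 1 (fun y : R => - y^-1) (- (- x ^- 2 *: 1)).
    exact: is_deriveN.
  have d2 : is_derive x 1 (expR \o (fun y : R => - y^-1))
    (expR (- x^-1) * (- (- x ^- 2 *: 1))) by exact: is_derive1_comp.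
  have d := is_deriveM d1 d2.
  apply: (near_eq_is_derive (f := (horner p \o (fun y : R => y^-1)) *
     (expR \o (fun y : R => - y^-1)))).
    near=> y; rewrite /exp_inv (_ : 0 < y)//.
    by near: y; exact: lt_nbhsr.
  move: d; congr is_derive; rewrite !hornerE /GRing.scale/=.
  by rewrite exprVn; ring.
- rewrite [X in is_derive _ _ _ X]/exp_inv ltxx.
  have [C C0 pC] := exp_inv_bound (p * 'X).
  apply: (@is_derive_of_bound _ _ _ C 1) => // h.
  rewrite mul0r subr0 addr0 [exp_inv p 0]/exp_inv ltxx subr0.
  rewrite (_ : 1 + 1 = 2%:R)// powR_mulrn// expr2 mulrA.
  have := pC h; rewrite /exp_inv; case: ifPn => h0; last first.
    by rewrite normr0 => _; rewrite !mulr_ge0.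
  rewrite hornerM hornerX mulrAC normrM normfV (gtr0_norm h0).
  by rewrite ler_pdivrMr.
Unshelve. all: by end_near. Qed.

Lemma smooth_exp_inv (p : {poly R}) : smooth (exp_inv p).
Proof.
apply: (@smooth_coind _ (fun f => exists p, f = exp_inv p)); last by exists p.
move=> _ [q ->]; split=> [x|].
  by have [] := is_derive_exp_inv q x.
exists ('X^2 * (q - q^`())); apply/funext => x; rewrite derive1E.
by have [_ ->] := is_derive_exp_inv q x.
Qed.

(** On (-1, 1) this is the classical e^(-2/(1-x^2)), not normalised. The affine arguments are in the
    form expected by [smooth_affine_comp]. *)
Definition bump (x : R) : R := exp_inv 1 (1 + x) * exp_inv 1 (1 + (- 1) * x).

Lemma exp_inv1_ge0 x : 0 <= exp_inv 1 x.
Proof. by rewrite /exp_inv; case: ifP => // _; rewrite hornerC mul1r expR_ge0. Qed.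

Lemma bump_ge0 x : 0 <= bump x.
Proof. by rewrite mulr_ge0// exp_inv1_ge0. Qed.

Lemma bump_out x : 1 <= `|x| -> bump x = 0.
Proof.
move=> h; rewrite /bump /exp_inv.
have [x0|x0] := leP 0 x.
  rewrite (ger0_norm x0) in h.
  by rewrite [X in _ * (if X then _ else _)]ltNge (_ : 1 + -1 * x <= 0) ?mulr0//; lra.
rewrite (ltr0_norm x0) in h.
by rewrite ltNge (_ : 1 + x <= 0) ?mul0r//; lra.
Qed.

Lemma bump_ge x : `|x| <= 2^-1 -> expR (- 4) <= bump x.
Proof.
rewrite ler_norml => /andP[h1 h2].
have H y : 2^-1 <= y -> expR (- 2) <= exp_inv 1 y.
  move=> y2; have y0 : 0 < y by lra.
  rewrite /exp_inv y0 hornerC mul1r ler_expR lerN2 -(invrK 2).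
  by rewrite lef_pV2 ?posrE ?invr_gt0.
rewrite (_ : - 4 = - 2 + - 2); last by lra.
by rewrite expRD ler_pM ?expR_ge0// H//; lra.
Qed.

Lemma test_bump : test_function bump.
Proof.
apply/test_functionP; split.
  apply: smoothM.
    rewrite (_ : (fun _ => _) = fun x => exp_inv 1 (1 + 1 * x)).
      by apply: smooth_affine_comp; exact: smooth_exp_inv.
    by apply/funext => x; rewrite mul1r.
  by apply: smooth_affine_comp; exact: smooth_exp_inv.
by exists 1 => // x; exact: bump_out.
Qed.
End bump.

(** * Fubini and integration by parts *)

Section fubini_dominated.
Context {R : realType}.
Local Notation mu := (@lebesgue_measure R).
Local Notation T := (measurableTypeR R).
Variables (F : R -> R -> R) (f g : R -> R).
Hypothesis mF : measurable_fun (setT : set (T * T)) (fun p : T * T => F p.1 p.2).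
Hypothesis intf : mu.-integrable setT (EFin \o f).
Hypothesis intg : mu.-integrable setT (EFin \o g).
Hypothesis Ffg : forall x y, `|F x y| <= f x * g y.

(** The product bound makes every slice integrable, not merely almost every one. The inner integrals
    are therefore finite everywhere, and Fubini's theorem can be stated for real-valued
    integrals. *)
Lemma integrable_fubini_l x : mu.-integrable setT (EFin \o F x).
Proof.
apply: (@integrable_le _ setT _ (fun y => f x * g y)) => //.
  apply: (measurableT_comp mF (g := fun y : T => (x, y))).
  exact: pair1_measurable.
by rewrite /comp; under eq_fun do rewrite EFinM; exact: integrableZl.
Qed.

Lemma integrable_fubini_r y : mu.-integrable setT (EFin \o F^~ y).
Proof.
apply: (@integrable_le _ setT _ (fun x => f x * g y)) => //.
  apply: (measurableT_comp mF (g := fun x : T => (x, y))).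
  exact: pair2_measurable.
by rewrite /comp; under eq_fun do rewrite mulrC EFinM; exact: integrableZl.
Qed.

Let h (p : T * T) : \bar R := (F p.1 p.2)%:E.

Let mh : measurable_fun setT h.
Proof. exact/measurable_EFinP. Qed.

Let inth : (mu \x mu)%E.-integrable setT h.
Proof.
have H := (@integrable12ltyP _ _ T T R mu mu h mh).2.
apply: H.
have f0g0 : forall x, (\int[mu]_y `|h (x, y)| <= `|f x|%:E * \int[mu]_y `|(g y)%:E|)%E.
  move=> x; rewrite -ge0_integralZl//; last first.
    by apply/measurableT_comp => //; case/integrableP : intg.
  apply: ge0_le_integral => //.
  - by apply: measurableT_comp => //; have /integrableP[] := integrable_fubini_l x.
  - apply: emeasurable_funM => //.
    by apply/measurableT_comp => //; case/integrableP : intg.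
  - move=> y _; rewrite /h/= -EFinM lee_fin -normrM (le_trans (Ffg x y))//.
    exact: ler_norm.
apply: (@le_lt_trans _ _ (\int[mu]_x (`|f x|%:E * \int[mu]_y `|(g y)%:E|))%E).
  apply: ge0_le_integral => //.
  - move=> x _; exact: integral_ge0.
  - apply: (@measurable_fun_fubini_tonelli_F _ _ _ _ _ _ (abse \o h)) => //.
    + exact: measurableT_comp.
    + by move=> x; rewrite /= lee_fin.
  - apply: emeasurable_funM => //.
    by apply/measurable_EFinP/measurableT_comp => //; apply/measurable_EFinP; case/integrableP : intf.
case/integrableP : intg => _ gy; case/integrableP : intf => mf fy.
rewrite ge0_integralZr//.
- rewrite lte_mul_pinfty//; [exact: integral_ge0|by rewrite ge0_fin_numE//; exact: integral_ge0].
- by apply/measurable_EFinP/measurableT_comp => //; exact/measurable_EFinP.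
- exact: integral_ge0.
Qed.

Let innerl x : (\int[mu]_y h (x, y))%E = (\int[mu]_y F x y)%:E.
Proof.
rewrite /Rintegral fineK//.
by apply: integrable_fin_num => //; exact: integrable_fubini_l.
Qed.

Let innerr y : (\int[mu]_x h (x, y))%E = (\int[mu]_x F x y)%:E.
Proof.
rewrite /Rintegral fineK//.
by apply: integrable_fin_num => //; exact: integrable_fubini_r.
Qed.

Lemma Rintegral_fubini :
  \int[mu]_x (\int[mu]_y F x y) = \int[mu]_y (\int[mu]_x F x y).
Proof.
rewrite {1}/Rintegral; under eq_integral do rewrite -innerl.
rewrite [RHS]/Rintegral; under [in RHS]eq_integral do rewrite -innerr.
by congr fine; apply: Fubini.
Qed.

Lemma integrable_fubini : mu.-integrable setT (EFin \o (fun x => \int[mu]_y F x y)).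
Proof.
have := integrable_fubini_F inth.
by apply: eq_integrable => // x _ /=; rewrite /fubini_F innerl.
Qed.

End fubini_dominated.

Section support_and_parts.
Context {R : realType}.
Local Notation mu := (@lebesgue_measure R).
Implicit Types (f g rho : R -> R).

Lemma in_itv_normP (B y : R) : (y \in `[- B, B]) = (`|y| <= B).
Proof. by rewrite in_itv/= ler_norml. Qed.

Lemma Rintegral_supp f (D : set R) : (forall x, ~ D x -> f x = 0) ->
  \int[mu]_x f x = \int[mu]_(x in D) f x.
Proof.
move=> fD; rewrite [RHS]Rintegral_mkcond; congr Rintegral.
apply/funext => x; rewrite /patch; case: ifPn => // xD.
by rewrite fD//; move/negP : xD; apply: contra_not; rewrite inE.
Qed.

Lemma integrable_supp f (D : set R) : measurable D ->
  mu.-integrable D (EFin \o f) -> (forall x, ~ D x -> f x = 0) ->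
  mu.-integrable setT (EFin \o f).
Proof.
move=> mD intf fD.
have := (@integrable_mkcond _ _ _ mu D (EFin \o f) mD).1 intf.
apply: eq_integrable => // x _; rewrite /patch; case: ifPn => //= xD.
by rewrite fD//; move/negP : xD; apply: contra_not; rewrite inE.
Qed.

Lemma continuous_itv_integrable f (a b : R) :
  (forall x, a <= x <= b -> {for x, continuous f}) ->
  mu.-integrable `[a, b] (EFin \o f).
Proof.
move=> cf; apply: continuous_compact_integrable; first exact: segment_compact.
by apply: continuous_in_subspaceT => x; rewrite inE/= in_itv/=; exact: cf.
Qed.

Lemma continuous_measurable f : continuous f -> measurable_fun setT f.
Proof. by move=> cf; apply: continuous_measurable_fun. Qed.

Lemma Rintegral_derive (f df : R -> R) (a b : R) : a <= b ->
  (forall x, a <= x <= b -> is_derive x 1 f (df x)) ->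
  (forall x, a <= x <= b -> {for x, continuous df}) ->
  \int[mu]_(x in `[a, b]) df x = f b - f a.
Proof.
rewrite le_eqVlt => /predU1P[->|ab] fd cdf.
  by rewrite set_itv1 Rintegral_set1 subrr.
have cf x : a <= x <= b -> {for x, continuous f}.
  by move=> /fd [d _]; exact: derivable_continuous.
rewrite /Rintegral (@continuous_FTC2 _ _ f)//.
- by apply: continuous_in_subspaceT => x; rewrite inE/= in_itv/=; exact: cdf.
- split.
  + by move=> x /subset_itv_oo_cc; rewrite in_itv/= => /fd [].
  + by apply: cvg_at_right_filter; apply: cf; rewrite lexx ltW.
  + by apply: cvg_at_left_filter; apply: cf; rewrite lexx ltW.
- by move=> x /subset_itv_oo_cc; rewrite in_itv/= derive1E => /fd [_ ->].
Qed.

Lemma Rintegral_parts_test (B : R) f (df : R -> R) rho : 0 < B -> smooth rho ->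
  (forall y : R, B <= `|y| -> rho y = 0) ->
  (forall y : R, `|y| <= B -> is_derive y 1 f (df y)) ->
  (forall y : R, `|y| <= B -> {for y, continuous df}) ->
  \int[mu]_y (f y * derive1 rho y) = - \int[mu]_y (df y * rho y).
Proof.
move=> B0 srho rhoB fd cdf.
have out y : ~ `[- B, B]%classic y -> B < `|y|.
  by move=> /= /negP; rewrite in_itv_normP -ltNge.
rewrite (@Rintegral_supp _ `[- B, B]); last first.
  by move=> y /out By; rewrite (derive1_locally0 rhoB)// mulr0.
rewrite (@Rintegral_supp (fun y => df y * rho y) `[- B, B]); last first.
  by move=> y /out By; rewrite rhoB ?mulr0// ltW.
have cf (y : R) : `|y| <= B -> {for y, continuous f}.
  by move=> /fd [d _]; exact: derivable_continuous.
have BB : - B <= B by rewrite lerNl (le_trans _ (ltW B0))// oppr_le0 ltW.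
have H (y : R) : - B <= y <= B -> is_derive y 1 (fun y => f y * rho y)
    (f y * derive1 rho y + rho y * df y).
  rewrite -ler_norml => yB; have := smooth_is_derive y srho => d.
  exact: (is_deriveM (fd y yB) d).
have cH (y : R) : - B <= y <= B -> {for y, continuous (fun y => f y * derive1 rho y)}.
  rewrite -ler_norml => yB; apply: continuousM; first exact: cf.
  exact/smooth_continuous/smooth_derive1.
have cH' (y : R) : - B <= y <= B -> {for y, continuous (fun y => rho y * df y)}.
  rewrite -ler_norml => yB; apply: continuousM; last exact: cdf.
  exact/smooth_continuous.
have := Rintegral_derive BB H _.
rewrite rhoB ?(ger0_norm (ltW B0))// rhoB ?normrN ?(ger0_norm (ltW B0))//.
rewrite !mulr0 subrr => E; move: (E (fun y yB => continuousD (cH y yB) (cH' y yB))).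
rewrite RintegralD//; last 2 first.
- exact: continuous_itv_integrable.
- exact: continuous_itv_integrable.
move/eqP; rewrite addr_eq0 => /eqP ->; congr (- _).
by apply: eq_Rintegral => y _; rewrite mulrC.
Qed.

Lemma Rintegral_gt0 f (D : set R) (a b c : R) : measurable D ->
  mu.-integrable D (EFin \o f) -> (forall x, D x -> 0 <= f x) ->
  a < b -> `[a, b]%classic `<=` D -> 0 < c -> (forall x, a <= x <= b -> c <= f x) ->
  0 < \int[mu]_(x in D) f x.
Proof.
move=> mD intf f0 ab abD c0 cf.
apply: (@lt_le_trans _ _ (\int[mu]_(x in `[a, b]) c)).
  rewrite Rintegral_cst//= lebesgue_measure_itv/= lte_fin ab -EFinD/=.
  by rewrite mulr_gt0// subr_gt0.
have i : mu.-integrable `[a, b] (EFin \o f) by exact: integrableS intf.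
apply: (@le_trans _ _ (\int[mu]_(x in `[a, b]) f x)).
  apply: le_Rintegral => //.
  by apply: continuous_itv_integrable => x _; exact: cvg_cst.
rewrite /Rintegral fine_le//; [exact: integrable_fin_num|exact: integrable_fin_num|].
apply: ge0_subset_integral => //; first by case/integrableP : intf.
Qed.
End support_and_parts.

(** * Signed powers *)

Section integrable_real.
Context {R : realType} (D : set R).
Hypothesis mD : measurable D.
Local Notation mu := (@lebesgue_measure R).
Implicit Types f g : R -> R.

Lemma integrable_cmul (c : R) f : mu.-integrable D (EFin \o f) ->
  mu.-integrable D (EFin \o (fun x => c * f x)).
Proof. by move=> intf; exact: (@integrableZl _ _ _ mu D mD c (EFin \o f) intf). Qed.

Lemma integrable_add f g : mu.-integrable D (EFin \o f) ->
  mu.-integrable D (EFin \o g) ->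
  mu.-integrable D (EFin \o (fun x => f x + g x)).
Proof. by move=> intf intg; exact: (@integrableD _ _ _ mu D mD _ _ intf intg). Qed.

Lemma integrable_sub f g : mu.-integrable D (EFin \o f) ->
  mu.-integrable D (EFin \o g) ->
  mu.-integrable D (EFin \o (fun x => f x - g x)).
Proof. by move=> intf intg; exact: (@integrableB _ _ _ mu D mD _ _ intf intg). Qed.

Lemma integrable_eq f g : (forall x, D x -> f x = g x) ->
  mu.-integrable D (EFin \o f) -> mu.-integrable D (EFin \o g).
Proof.
by move=> fg; apply: (@eq_integrable _ _ _ mu D mD) => x; rewrite inE => Dx; rewrite /= fg.
Qed.

Lemma integrable_measurable f : mu.-integrable D (EFin \o f) -> measurable_fun D f.
Proof. by case/integrableP => /measurable_EFinP. Qed.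

End integrable_real.

Lemma integrable_setU_disj (R : realType) (A B : set R) (f : R -> R) :
  measurable A -> measurable B -> [disjoint A & B] -> measurable_fun setT f ->
  (@lebesgue_measure R).-integrable A (EFin \o f) ->
  (@lebesgue_measure R).-integrable B (EFin \o f) ->
  (@lebesgue_measure R).-integrable (A `|` B) (EFin \o f).
Proof.
move=> mA mB AB mf /integrableP[_ iA] /integrableP[_ iB].
have mfD D : measurable_fun D (EFin \o f).
  by apply/measurable_EFinP; exact: measurable_funTS.
apply/integrableP; split; first exact: mfD.
rewrite ge0_integral_setU//; first by rewrite lte_add_pinfty.
by apply: measurableT_comp => //; exact: mfD.
Qed.

Section signed_power.
Context {R : realType} (al : R).
Hypotheses (al0 : 0 < al) (al1 : al < 1).
Local Notation mu := (@lebesgue_measure R).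

(** The shares a/(a+b) and b/(a+b) lie in [0, 1], so each is at most its own al-th power, and they
    add up to 1. *)
Lemma powR_subadd (a b : R) : 0 <= a -> 0 <= b -> (a + b) `^ al <= a `^ al + b `^ al.
Proof.
move=> a0 b0; have [->|ab0] := eqVneq (a + b) 0.
  by rewrite powR0 ?gt_eqF// addr_ge0 ?powR_ge0.
have ab : 0 < a + b by rewrite lt_neqAle eq_sym ab0 addr_ge0.
have H c : 0 <= c <= a + b -> (a + b) `^ al * (c / (a + b)) <= c `^ al.
  move=> /andP[]; rewrite le_eqVlt => /predU1P[<-|c0] cab.
    by rewrite mul0r mulr0 powR_ge0.
  rewrite [in leRHS](_ : c = (a + b) * (c / (a + b))); last first.
    by rewrite mulrC divfK.
  have cd : 0 < c / (a + b) by exact: divr_gt0.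
  rewrite powRM ?(ltW ab) ?(ltW cd)// ler_wpM2l ?powR_ge0//.
  by apply: ger1_powR; rewrite ?(ltW al1)// cd ler_pdivrMr// mul1r.
rewrite [leLHS](_ : _ = (a + b) `^ al * (a / (a + b)) + (a + b) `^ al * (b / (a + b))).
  by apply: lerD; apply: H; rewrite ?a0 ?b0/= ?lerDl ?lerDr.
by rewrite -mulrDr -mulrDl divff// mulr1.
Qed.

Lemma powR_norm_holder (x y : R) : `| `|x| `^ al - `|y| `^ al| <= `|x - y| `^ al.
Proof.
wlog : x y / `|y| <= `|x|.
  move=> H; have [/H//|/ltW/H] := leP `|y| `|x|.
  by rewrite distrC (distrC y x).
move=> yx; rewrite ger0_norm; last first.
  by rewrite subr_ge0 le_powR_base// ltW.
rewrite lerBlDr (le_trans _ (powR_subadd _ _))//.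
apply: le_powR_base => //; first exact: ltW.
by rewrite -{1}(subrK y x) ler_normD.
Qed.

Lemma continuous_norm_powR : continuous (fun x : R => `|x| `^ al).
Proof.
move=> x; apply/cvgrPdist_le => e e0.
have d0 : 0 < e `^ al^-1 by rewrite powR_gt0.
near=> y.
apply: (le_trans (powR_norm_holder _ _)).
have -> : e = (e `^ al^-1) `^ al.
  by rewrite -powRrM mulVf ?gt_eqF// powRr1// ltW.
apply: le_powR_base; [exact: ltW|exact: normr_ge0|].
near: y.
by exists (e `^ al^-1) => // z /= /ltW.
Unshelve. all: by end_near. Qed.

(* The odd primitive of |w|^al. Convolving with it instead of |w|^al costs one
   derivative of the test function, but makes the kernel C^1, so that second
   differences of the kernel beat the singularity of z^-(2+al). *)
Definition spow (w : R) : R := Num.sg w * `|w| `^ (1 + al) / (1 + al).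

Let al10 : 1 + al != 0. Proof. by rewrite gt_eqF// addr_gt0. Qed.

Lemma spowN w : spow (- w) = - spow w.
Proof. by rewrite /spow sgrN normrN !mulNr. Qed.

Lemma spow0 : spow 0 = 0.
Proof. by rewrite /spow sgr0 !mul0r. Qed.

Lemma spow_ge0 w : 0 <= w -> spow w = w `^ (1 + al) / (1 + al).
Proof.
rewrite le_eqVlt => /predU1P[<-|w0]; first by rewrite spow0 powR0// mul0r.
by rewrite /spow gtr0_sg// mul1r gtr0_norm.
Qed.

Lemma spowM c w : 0 < c -> spow (c * w) = c `^ (1 + al) * spow w.
Proof.
move=> c0; by rewrite /spow sgrM (gtr0_sg c0) mul1r normrM (gtr0_norm c0) powRM ?(ltW c0)//; ring.
Qed.

Lemma is_derive_spow (w : R) : is_derive w 1 spow (`|w| `^ al).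
Proof.
have pos (x : R) : 0 < x -> is_derive x 1 spow (`|x| `^ al).
  move=> x0; apply: (near_eq_is_derive (f := fun y : R => y `^ (1 + al) / (1 + al))).
    near=> y; rewrite spow_ge0//.
    by apply/ltW; near: y; exact: lt_nbhsr.
  have := is_derive1_powR (1 + al) x0 => ?.
  apply: is_derive_eq; rewrite /GRing.scale/= gtr0_norm//.
  rewrite (_ : 1 + al - 1 = al); last by ring.
  by field.
have [w0|w0|->] := ltgtP w 0; last 2 first.
- exact: pos.
- apply: (@is_derive_of_bound _ _ _ _ (1 + al)^-1 al) => // h.
  rewrite addr0 spow0 normr0 powR0 ?gt_eqF// mul0r !subr0.
  rewrite /spow !normrM (ger0_norm (powR_ge0 _ _)) mulrC normfV.
  rewrite (gtr0_norm (addr_gt0 _ _))// ler_wpM2l//; first by rewrite invr_ge0 addr_ge0// ltW.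
  by rewrite ler_piMl ?powR_ge0// normr_sg; case: eqP.
- have d : is_derive (- w) 1 spow (`|- w| `^ al) by apply: pos; rewrite oppr_gt0.
  have := @is_derive_affine_comp _ 0 (-1) w (`|- w| `^ al) spow.
  rewrite add0r mulN1r => /(_ d) /is_deriveN.
  rewrite mulN1r opprK normrN.
  apply: near_eq_is_derive; near=> y.
  by rewrite !fctE add0r mulN1r spowN opprK.
Unshelve. all: by end_near. Qed.

Lemma continuous_spow : continuous spow.
Proof. by move=> x; have [d _] := is_derive_spow x; exact: derivable_continuous. Qed.

Definition spow2 (t : R) : R := 2 * spow 1 - spow (1 + t) - spow (1 - t).

Lemma is_derive_spow2 (t : R) :
  is_derive t 1 spow2 (`|1 - t| `^ al - `|1 + t| `^ al).
Proof.
have d1 : is_derive t 1 (fun t : R => spow (1 + 1 * t)) (1 * `|1 + 1 * t| `^ al).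
  by apply: is_derive_affine_comp; exact: is_derive_spow.
have d2 : is_derive t 1 (fun t : R => spow (1 + -1 * t)) (-1 * `|1 + -1 * t| `^ al).
  by apply: is_derive_affine_comp; exact: is_derive_spow.
have := is_deriveB (is_deriveB (is_derive_cst (2 * spow 1) t 1) d1) d2.
rewrite !mulN1r !mul1r opprK sub0r [X in is_derive _ _ _ X -> _]addrC.
apply: near_eq_is_derive; near=> y.
by rewrite !fctE mul1r mulN1r.
Unshelve. all: by end_near. Qed.

Lemma spow2_MVT (a t : R) : 0 <= a -> a < t ->
  exists2 c, a < c < t & spow2 t - spow2 a = (`|1 - c| `^ al - `|1 + c| `^ al) * (t - a).
Proof.
move=> a0 t0.
have [|c ct E] := @MVT _ spow2 (fun t => `|1 - t| `^ al - `|1 + t| `^ al) _ _ t0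
  (fun x _ => is_derive_spow2 x).
  apply: continuous_subspaceT => x.
  by have [d _] := is_derive_spow2 x; exact: derivable_continuous.
by exists c.
Qed.

Lemma spow2_0 : spow2 0 = 0.
Proof. by rewrite /spow2 addr0 subr0; ring. Qed.

(** For c >= 1 the Holder bound compares c - 1 with c + 1, which differ by 2, and 2^al <= 2. For c <
    1 both powers lie between 1 - c and 1 + c. The minimum makes [spow2] quadratic at 0 and linear
    at infinity, which is what integrability against t^-(2+al) requires at the two ends. *)
Lemma spow2_slope_bound (c : R) : 0 < c ->
  `| `|1 - c| `^ al - `|1 + c| `^ al| <= 2 * Num.min 1 c.
Proof.
move=> c0.
have b2 : (2:R) `^ al <= 2 by apply: ler1_powR; [rewrite ler1n|exact: ltW].
have [c1|c1] := leP 1 c.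
  rewrite mulr1 (le_trans _ b2)// -(normr_id (1 - c)) -(normr_id (1 + c)).
  apply: (le_trans (powR_norm_holder _ _)).
  have -> : `|1 - c| = c - 1 by rewrite ler0_norm ?opprB// subr_le0.
  have -> : `|1 + c| = 1 + c by rewrite gtr0_norm// addr_gt0.
  by rewrite (_ : c - 1 - (1 + c) = - 2) ?normrN ?normr_nat//; ring.
have p1 : 0 < 1 + c by lra.
have m1 : 0 < 1 - c by lra.
rewrite (gtr0_norm p1) (gtr0_norm m1) ler0_norm; last first.
  rewrite subr_le0; apply: le_powR_base.
  - exact: ltW.
  - lra.
  - lra.
have : (1 + c) `^ al <= 1 + c by apply: ler1_powR; [lra|exact: ltW].
have : 1 - c <= (1 - c) `^ al by apply: ger1_powR; [lra|exact: ltW].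
by lra.
Qed.

Lemma spow2_bound (t : R) : 0 < t -> `|spow2 t| <= 2 * Num.min 1 t * t.
Proof.
move=> t0; have [c /andP[c0 ct]] := spow2_MVT (lexx 0) t0.
rewrite spow2_0 !subr0 => ->; rewrite normrM (gtr0_norm t0) ler_wpM2r ?(ltW t0)//.
apply: (le_trans (spow2_slope_bound c0)); rewrite ler_wpM2l//.
by rewrite le_min !ge_min lexx/= (ltW ct) orbT.
Qed.

Lemma spow2_decreasing (a t : R) : 0 <= a -> a < t -> spow2 t < spow2 a.
Proof.
move=> a0 at0; have [c /andP[c0 ct]] := spow2_MVT a0 at0.
rewrite -subr_lt0 => ->; rewrite nmulr_rlt0 ?subr_gt0// subr_lt0.
have cp := le_lt_trans a0 c0.
apply: gt0_ltr_powR => //; rewrite ?nnegrE// (gtr0_norm (_ : 0 < 1 + c)) ?addr_gt0//.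
by rewrite ltr_norml; apply/andP; split; lra.
Qed.

(* The substitution z = |w| t turns the second difference of [spow] at w into
   the one at 1. *)
Lemma spow_second_diff (w t : R) : w != 0 -> 0 < t ->
  2 * spow w - spow (w + `|w| * t) - spow (w - `|w| * t) =
  Num.sg w * `|w| `^ (1 + al) * spow2 t.
Proof.
move=> w0 t0; have nw : 0 < `|w| by rewrite normr_gt0.
have H x : spow (`|w| * x) = `|w| `^ (1 + al) * spow x by exact: spowM.
rewrite /spow2; have [w0'|w0'|] := ltgtP w 0; last by move/eqP : w0.
- rewrite [in LHS](_ : w = - (`|w| * 1)); last by rewrite ltr0_norm// mulr1 opprK.
  rewrite (_ : - (`|w| * 1) + _ = - (`|w| * (1 - t))); last by rewrite !normrN !normrM !normr_id !normr1; ring.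
  rewrite (_ : - (`|w| * 1) - _ = - (`|w| * (1 + t))); last by rewrite !normrN !normrM !normr_id !normr1; ring.
  by rewrite !spowN !H ltr0_sg//; ring.
- rewrite [in LHS](_ : w = (`|w| * 1)); last by rewrite gtr0_norm// mulr1.
  rewrite (_ : (`|w| * 1) + _ = (`|w| * (1 + t))); last by rewrite !normrM !normr_id !normr1; ring.
  rewrite (_ : (`|w| * 1) - _ = (`|w| * (1 - t))); last by rewrite !normrM !normr_id !normr1; ring.
  by rewrite !H gtr0_sg//; ring.
Qed.

Definition spow_kernel (t : R) : R := spow2 t * t `^ (- (2 + al)).

Lemma measurable_spow_kernel : measurable_fun setT spow_kernel.
Proof.
apply: measurable_funM; last exact: measurable_powR.
apply: continuous_measurable => x.
by have [d _] := is_derive_spow2 x; exact: derivable_continuous.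
Qed.

Lemma spow_kernel_bound0 t : 0 < t -> `|spow_kernel t| <= 2 * t `^ (- al).
Proof.
move=> t0; rewrite normrM (ger0_norm (powR_ge0 _ _)).
rewrite (_ : - al = 2%:R + - (2 + al)); last by ring.
rewrite powRD; last by rewrite (gt_eqF t0) implybT.
rewrite powR_mulrn ?(ltW t0)// mulrA ler_wpM2r ?powR_ge0//.
rewrite (le_trans (spow2_bound t0))// expr2 mulrA ler_wpM2r ?(ltW t0)// ler_wpM2l//.
by rewrite ge_min lexx orbT.
Qed.

Lemma spow_kernel_boundy t : 0 < t -> `|spow_kernel t| <= 2 * t `^ (- (1 + al)).
Proof.
move=> t0; rewrite normrM (ger0_norm (powR_ge0 _ _)).
rewrite (_ : - (1 + al) = 1%:R + - (2 + al)); last by ring.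
rewrite powRD; last by rewrite (gt_eqF t0) implybT.
rewrite powR_mulrn ?(ltW t0)// mulrA ler_wpM2r ?powR_ge0//.
rewrite (le_trans (spow2_bound t0))// expr1 ler_wpM2r ?(ltW t0)//.
by rewrite ler_piMr// ge_min lexx.
Qed.

Lemma itv0y_split (b : R) : 0 <= b ->
  (`]0, +oo[%classic : set R) = `]0, b] `|` `]b, +oo[.
Proof.
move=> b0; apply/seteqP; split=> x /=; rewrite !in_itv/= !andbT.
  by move=> ->/=; case: (leP x b); [left|right].
by move=> [/andP[]//|]; exact: le_lt_trans.
Qed.

Lemma itv0y_disj (b : R) : [disjoint `]0, b]%classic & (`]b, +oo[%classic : set R)].
Proof.
apply/disj_setPS => x [] /=; rewrite !in_itv/= andbT => /andP[_ xb].
by rewrite ltNge xb.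
Qed.

Lemma integrable_spow_kernel : mu.-integrable `]0, +oo[ (EFin \o spow_kernel).
Proof.
rewrite (@itv0y_split 1)//; apply: integrable_setU_disj => //.
- exact: itv0y_disj.
- exact: measurable_spow_kernel.
- apply: (@integrable_le _ _ _ (fun t => 2 * t `^ (- al))) => //.
  + exact: measurable_funTS measurable_spow_kernel.
  + by apply: integrable_cmul => //; exact: integrable_powR0.
  + by move=> x /=; rewrite in_itv/= => /andP[x0 _]; exact: spow_kernel_bound0.
- apply: (@integrable_le _ _ _ (fun t => 2 * t `^ (- (1 + al)))) => //.
  + exact: measurable_funTS measurable_spow_kernel.
  + by apply: integrable_cmul => //; apply: integrable_powR_tail => //; rewrite ltrDl.
  + move=> x /=; rewrite in_itv/= andbT => x1; apply: spow_kernel_boundy.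
    exact: lt_trans x1.
Qed.

(** By scaling and oddness the second-difference integral of [spow] at any w != 0 is
    [Num.sg w * spow_const]: up to a factor, (-Delta)^s turns [spow] into the sign function. *)
Definition spow_const : R := \int[mu]_(t in `]0, +oo[) spow_kernel t.

(** Since |1 - c| < 1 + c for c > 0, [spow2] decreases strictly from 0, so the kernel is negative
    throughout. The bound on [1, 2] makes the strict sign survive integration. *)
Lemma spow_const_lt0 : spow_const < 0.
Proof.
rewrite -oppr_gt0.
have -> : - spow_const = \int[mu]_(t in `]0, +oo[) (- 1 * spow_kernel t).
  by rewrite RintegralZl ?mulN1r//; exact: integrable_spow_kernel.
have s1 t : 0 < t -> spow2 t < 0.
  by move=> t0; rewrite -spow2_0; exact: spow2_decreasing.
apply: (@Rintegral_gt0 _ _ _ 1 2 (- spow2 1 * 2 `^ (- (2 + al)))) => //.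
- by apply: integrable_cmul => //; exact: integrable_spow_kernel.
- move=> x /=; rewrite in_itv/= andbT => x0.
  by rewrite mulN1r oppr_ge0 mulr_le0_ge0 ?powR_ge0// ltW// s1.
- by lra.
- by move=> x /=; rewrite !in_itv/= andbT => /andP[+ _]; apply: lt_le_trans.
- by rewrite mulr_gt0 ?powR_gt0// oppr_gt0 s1.
- move=> x /andP[x1 x2]; have x0 := lt_le_trans ltr01 x1.
  rewrite /spow_kernel mulN1r -mulNr; apply: ler_pM; rewrite ?powR_ge0//.
  + by rewrite oppr_ge0 ltW// s1.
  + rewrite lerN2; move: x1; rewrite le_eqVlt => /predU1P[<-//|x1].
    by apply/ltW; exact: spow2_decreasing.
  + rewrite !powRN lef_pV2 ?posrE ?powR_gt0//; apply: le_powR_base => //; last exact: ltW.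
    by rewrite addr_ge0// ltW.
Qed.

Lemma spow_kernel_tail (e : R) : 0 < e ->
  `|\int[mu]_(t in `]e, +oo[) spow_kernel t - spow_const| <=
  2 / (1 - al) * e `^ (1 - al).
Proof.
move=> e0; rewrite /spow_const (@itv0y_split e) ?(ltW e0)// Rintegral_setU//; last 2 first.
- by rewrite -itv0y_split ?(ltW e0)//; exact: integrable_spow_kernel.
- exact: itv0y_disj.
rewrite addrC opprD addrNK normrN.
apply: (@le_trans _ _ (\int[mu]_(t in `]0, e]) (2 * t `^ (- al)))).
  apply: normr_Rintegral_le => //.
  + exact: measurable_funTS measurable_spow_kernel.
  + by apply: integrable_cmul => //; exact: integrable_powR0.
  + by move=> x /=; rewrite in_itv/= => /andP[x0 _]; exact: spow_kernel_bound0.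
rewrite RintegralZl//; last exact: integrable_powR0.
rewrite -mulrA ler_wpM2l// (le_trans (le_Rintegral_powR0 _ _))//.
by rewrite mulrC.
Qed.

Definition spow_trunc (d w : R) : R := \int[mu]_(z in `]d, +oo[)
  ((2 * spow w - spow (w + z) - spow (w - z)) * z `^ (- (2 + al))).

(** Under z = |w| t the second difference has degree 1 + al, the weight degree -(2 + al) and dz
    degree 1. The total is 0, so the size of w enters only through the truncation d / |w|. *)
Lemma spow_truncE (d w : R) : 0 < d -> w != 0 ->
  spow_trunc d w = Num.sg w * \int[mu]_(t in `](d / `|w|), +oo[) spow_kernel t.
Proof.
move=> d0 w0; have nw : 0 < `|w| by rewrite normr_gt0.
have dw : 0 < d / `|w| by exact: divr_gt0.
have ik : mu.-integrable `](d / `|w|), +oo[ (EFin \o spow_kernel).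
  apply: integrableS integrable_spow_kernel => //.
  by move=> x /=; rewrite !in_itv/= !andbT; exact: lt_trans.
rewrite -RintegralZl//.
have pre : (fun z => 0 + `|w|^-1 * z) @^-1` `](d / `|w|), +oo[ = `]d, +oo[%classic.
  apply/seteqP; split => x /=; rewrite !in_itv/= !andbT add0r (mulrC _ x) ltr_pM2r ?invr_gt0//.
rewrite (@Rintegral_affine _ 0 `|w|^-1); last 3 first.
- by rewrite invr_neq0// gt_eqF.
- by [].
- exact: integrable_cmul.
rewrite pre -RintegralZl//; last first.
  rewrite -pre; apply: integrable_cmul; first exact: measurable_preimage_affine.
  apply: (integrable_affine 0 _ _ ik) => //; rewrite invr_neq0// gt_eqF//.
apply: eq_Rintegral => z; rewrite inE/= in_itv/= andbT => dz.
have z0 := lt_trans d0 dz.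
have zw : 0 < z / `|w| by exact: divr_gt0.
rewrite add0r (mulrC `|w|^-1) {1 2 3}(_ : z = `|w| * (z / `|w|)); last first.
  by rewrite mulrCA divff ?gt_eqF// mulr1.
rewrite spow_second_diff// /spow_kernel.
rewrite (powRM (- (2 + al)) (ltW z0)) ?invr_ge0 ?(ltW nw)//.
rewrite mulrCA divff ?gt_eqF// mulr1 normfV normr_id.
have -> : `|w|^-1 `^ (- (2 + al)) = `|w| `^ (2 + al).
  by rewrite -powR_inv1 ?ltW// -powRrM mulrNN mul1r.
have -> : `|w| `^ (2 + al) = `|w| * `|w| `^ (1 + al).
  rewrite (_ : 2 + al = 1 + (1 + al)); last by ring.
  by rewrite powRD ?powRr1 ?(ltW nw)// (gt_eqF nw) implybT.
by field; rewrite gt_eqF.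
Qed.

(** The convergence is not uniform near w = 0, but the error carries the locally integrable power
    |w|^-(1-al), which is what allows d to tend to 0 inside a convolution. *)
Lemma spow_trunc_cvg (d w : R) : 0 < d -> w != 0 ->
  `|spow_trunc d w - Num.sg w * spow_const| <=
  2 / (1 - al) * d `^ (1 - al) * `|w| `^ (- (1 - al)).
Proof.
move=> d0 w0; have nw : 0 < `|w| by rewrite normr_gt0.
rewrite spow_truncE// -mulrBr normrM normr_sg w0 mul1r.
rewrite (le_trans (spow_kernel_tail _)) ?divr_gt0//.
rewrite powRM ?(ltW d0) ?invr_ge0// mulrA.
have -> // : `|w|^-1 `^ (1 - al) = `|w| `^ (- (1 - al)).
by rewrite -powR_inv1// -powRrM mulN1r.
Qed.
End signed_power.

(** * Convolutions *)

Section convolution.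
Context {R : realType}.
Local Notation mu := (@lebesgue_measure R).
Implicit Types (g psi : R -> R).

Lemma continuous_locally_integrable g : continuous g -> locally_integrable setT g.
Proof.
move=> cg; split; [exact: continuous_measurable|exact: openT|].
move=> K _ cK.
have := @continuous_compact_integrable _ g K cK (continuous_subspaceT cg).
by case/integrableP.
Qed.

Lemma locally_integrable_itv g (a b : R) : locally_integrable setT g ->
  mu.-integrable `[a, b] (EFin \o g).
Proof.
move=> [mg _ gK]; apply/integrableP; split.
  by apply/measurable_EFinP; exact: measurable_funTS.
by have := gK _ (@subsetT _ _) (@segment_compact _ a b).
Qed.

Lemma locally_integrable_trunc g (L : R) : locally_integrable setT g ->
  mu.-integrable setT (EFin \o (fun y => if `|y| <= L then `|g y| else 0)).
Proof.
move=> lg; apply: (@integrable_supp _ _ `[- L, L]%classic) => //.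
- apply: (@integrable_eq _ _ _ (fun y => `|g y|)) => //.
    by move=> y /=; rewrite in_itv_normP => ->.
  exact/integrable_norm/locally_integrable_itv.
- by move=> y /= /negP; rewrite in_itv_normP => /negbTE ->.
Qed.

Lemma test_measurable psi : test_function psi -> measurable_fun setT psi.
Proof. by move=> [s _]; apply: continuous_measurable; exact: smooth_continuous. Qed.

Lemma measurable_shift_comp psi (x : R) : measurable_fun setT psi ->
  measurable_fun setT (fun y : R => psi (x - y)).
Proof.
move=> mp; apply: (measurableT_comp mp (g := fun y : R => x - y)).
exact: measurable_funB.
Qed.

(** [G] dominates the integrand uniformly over |x| <= r, as differentiation under the integral
    requires. *)
Lemma conv_dominated g psi (B M r : R) : locally_integrable setT g ->
  measurable_fun setT psi ->
  (forall x, B <= `|x| -> psi x = 0) -> (forall x, `|psi x| <= M) ->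
  let G y := M * (if `|y| <= r + B then `|g y| else 0) in
  mu.-integrable setT (EFin \o G) /\
  (forall x y, `|x| <= r -> `|g y * psi (x - y)| <= G y).
Proof.
move=> lg mp pB pM G; split.
  by apply: integrable_cmul => //; exact: locally_integrable_trunc.
move=> x y xr; rewrite /G; case: ifPn => yB.
  by rewrite normrM mulrC ler_wpM2r.
rewrite pB ?mulr0 ?normr0//.
rewrite -ltNge in yB.
have : `|y| <= `|x - y| + `|x| by rewrite distrC -{1}(subrK x y) ler_normD.
by lra.
Qed.

Definition conv g psi (x : R) := \int[mu]_y (g y * psi (x - y)).

Lemma integrable_conv g psi (x : R) : locally_integrable setT g -> test_function psi ->
  mu.-integrable setT (EFin \o (fun y => g y * psi (x - y))).
Proof.
move=> lg tp; have [M M0 pM] := test_bounded tp.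
have [_ [B B0 pB]] := (test_functionP psi).1 tp.
have [iG Gb] := conv_dominated `|x| lg (test_measurable tp) pB pM.
apply: integrable_le iG _ => //; last by move=> y _; exact: Gb.
apply: measurable_funM; first by case: lg.
by apply: measurable_shift_comp; exact: test_measurable.
Qed.

Lemma is_derive_conv g psi (a : R) : locally_integrable setT g -> test_function psi ->
  is_derive a 1 (conv g psi) (conv g (derive1 psi) a).
Proof.
move=> lg tp; have tdp := test_derive1 tp.
have [M M0 pM] := test_bounded tdp.
have [_ [B B0 pB]] := (test_functionP _).1 tdp.
have [iG Gb] := conv_dominated (`|a| + 1) lg (test_measurable tdp) pB pM.
set G := (fun y => _) in iG Gb.
have dp (x y : R) : is_derive x 1 (fun x => g y * psi (x - y)) (g y * derive1 psi (x - y)).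
  have h : is_derive x 1 (fun x => psi (- y + 1 * x)) (1 * derive1 psi (x - y)).
    apply: is_derive_affine_comp; rewrite mul1r addrC.
    apply: smooth_is_derive; exact: test_smooth.
  rewrite mul1r in h.
  have := is_deriveZ (g y) h; apply: near_eq_is_derive.
  by near=> z; rewrite /GRing.scale/= mul1r addrC.
have Ia : a \in `]a - 1, a + 1[ by rewrite in_itv/=; apply/andP; split; lra.
have n x : x \in `]a - 1, a + 1[ -> `|x| <= `|a| + 1.
  rewrite in_itv/= => /andP[x1 x2].
  rewrite -{1}(subrK a x) (le_trans (ler_normD _ _))// addrC lerD2l.
  by rewrite ler_norml; apply/andP; split; lra.
have E x y : partial1of2 (fun x y => g y * psi (x - y)) x y = g y * derive1 psi (x - y).
  by rewrite partial1of2E; have [_] := dp x y.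
have d := @derivable_under_integral _ _ _ mu
  (fun x y => g y * psi (x - y)) setT measurableT a _ _ Ia
  (fun x _ => integrable_conv x lg tp) (fun x y _ _ => @ex_derive _ _ _ _ _ _ _ (dp x y))
  G.
have d' := @differentiation_under_integral _ _ _ mu
  (fun x y => g y * psi (x - y)) setT measurableT a _ _ Ia
  (fun x _ => integrable_conv x lg tp) (fun x y _ _ => @ex_derive _ _ _ _ _ _ _ (dp x y))
  G.
have G0 y : 0 <= G y by rewrite /G mulr_ge0 ?(ltW M0)//; case: ifP.
have Gub x y : x \in `]a - 1, a + 1[ -> setT y ->
  `|partial1of2 (fun x y => g y * psi (x - y)) x y| <= G y.
  by move=> /n xa _; rewrite E; exact: Gb.
split; first exact: d.
rewrite -derive1E d'//.
by apply: eq_Rintegral => y _; exact: E.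
Unshelve. all: by end_near. Qed.

Lemma smooth_conv g psi : locally_integrable setT g -> test_function psi ->
  smooth (conv g psi).
Proof.
move=> lg tp; apply: (@smooth_coind _ (fun f => exists2 p, test_function p & f = conv g p)); last by exists psi.
move=> _ [p tp' ->]; split=> [x|]; first by have [] := is_derive_conv x lg tp'.
exists (derive1 p); first exact: test_derive1.
by apply/funext => x; rewrite derive1E; have [_ ->] := is_derive_conv x lg tp'.
Qed.

Lemma derive1n_conv n g psi : locally_integrable setT g -> test_function psi ->
  derive1n n (conv g psi) = conv g (derive1n n psi).
Proof.
move=> lg tp; elim: n => [//|n IH]; rewrite !derive1nS IH.
apply/funext => x; rewrite derive1E.
by have [_ ->] := is_derive_conv x lg (test_derive1n n tp).
Qed.

Lemma convC g psi (x : R) : locally_integrable setT g -> test_function psi ->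
  conv g psi x = \int[mu]_y (g (x - y) * psi y).
Proof.
move=> lg tp; have := integrable_conv x lg tp => i.
rewrite /conv (@Rintegral_affine _ x (-1))//.
rewrite normrN1 mul1r preimage_setT.
by apply: eq_Rintegral => y _; rewrite mulN1r subKr.
Qed.

Lemma integrable_convC g psi (x : R) : locally_integrable setT g -> test_function psi ->
  mu.-integrable setT (EFin \o (fun y => g (x - y) * psi y)).
Proof.
move=> lg tp; have := integrable_conv x lg tp => i.
have N1 : (-1 : R) != 0 by rewrite oppr_eq0 oner_neq0.
have := integrable_affine x N1 measurableT i.
rewrite preimage_setT.
by apply: integrable_eq => // y _ /=; rewrite mulN1r subKr.
Qed.

End convolution.

(** * Decay of convolutions with differentiated test functions *)

Section convolution_decay.
Context {R : realType}.
Local Notation mu := (@lebesgue_measure R).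

Lemma test_support (rho : R -> R) : test_function rho ->
  exists2 B : R, 0 < B & forall n y, B <= `|y| -> derive1n n rho y = 0.
Proof.
move=> tp; have [_ [B B0 pB]] := (test_functionP rho).1 tp.
exists (B + 1); first by rewrite addr_gt0.
have H n y : B < `|y| -> derive1n n rho y = 0.
  elim: n y => [|n IH] y yB; first by apply: pB; exact: ltW.
  (* A radius strictly between B and |y| leaves room for a neighbourhood of y, so a single B serves
     all orders; the final enlargement by 1 turns the strict inequality into a weak one. *)
  have [M BM My] : exists2 M, B < M & M < `|y|.
    by exists ((B + `|y|) / 2); [rewrite midf_lt|rewrite midf_lt].
  rewrite derive1nS; apply: (@derive1_locally0 _ _ M) => // z Mz.
  exact/IH/(lt_le_trans BM).
by move=> n y By; apply: H; apply: lt_le_trans By; rewrite ltrDl.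
Qed.

Lemma powR_comparable (b t X : R) : 0 < X -> 2^-1 * X <= t -> t <= 2 * X ->
  t `^ b <= 2 `^ `|b| * X `^ b.
Proof.
move=> X0 tX1 tX2; have t0 : 0 < t by apply: lt_le_trans tX1; rewrite mulr_gt0.
have [b0|b0] := leP 0 b.
  by rewrite ger0_norm// -powRM ?(ltW X0)//; apply: le_powR_base => //; exact: ltW.
rewrite ltr0_norm//.
have e Y : Y `^ b = (Y `^ (- b))^-1 by rewrite -powRN opprK.
rewrite (e t) (e X) ler_pdivlMr ?powR_gt0// mulrC ler_pdivrMr ?powR_gt0//.
rewrite -powRM ?(ltW t0)//; apply: le_powR_base; [by rewrite oppr_ge0 ltW|exact: ltW|].
lra.
Qed.

(* Away from the support of rho the kernel is smooth, and n integrations by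
   parts move the derivatives onto it. *)
Lemma conv_power_decay (rho : R -> R) (B : R) (n : nat) (b sg : R) :
  smooth rho -> 0 < B -> (forall n y, B <= `|y| -> derive1n n rho y = 0) ->
  sg ^+ 2 = 1 ->
  exists2 C : R, 0 <= C & forall x, 2 * B <= sg * x ->
  `|\int[mu]_y ((sg * (x - y)) `^ b * derive1n n rho y)| <= C * (sg * x) `^ (b - n%:R).
Proof.
move=> srho B0 rhoB sg2.
(* The sign [sg] selects the half line on which x lies, so both tails are treated by the same
   computation. *)
have sg1 : `|sg| = 1.
  by apply/eqP; rewrite -sqrp_eq1// -normrX sg2 normr1.
have pos (x y : R) : 2 * B <= sg * x -> `|y| <= B ->
    2^-1 * (sg * x) <= sg * (x - y) /\ sg * (x - y) <= 2 * (sg * x).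
  move=> xB yB; have : `|sg * y| <= B by rewrite normrM sg1 mul1r.
  by rewrite mulrBr ler_norml => /andP[? ?]; split; lra.
have pos0 (x y : R) : 2 * B <= sg * x -> `|y| <= B -> 0 < sg * (x - y).
  by move=> xB yB; have [? _] := pos x y xB yB; lra.
have dpow (b' x y : R) : 2 * B <= sg * x -> `|y| <= B ->
    is_derive y 1 (fun y : R => (sg * (x - y)) `^ b') (- sg * (b' * (sg * (x - y)) `^ (b' - 1))).
  move=> xB yB.
  have e z : sg * x + - sg * z = sg * (x - z) by rewrite mulrBr mulNr.
  have := @is_derive_affine_comp _ (sg * x) (- sg) y (b' * (sg * (x - y)) `^ (b' - 1))
    (fun z => z `^ b').
  rewrite e => /(_ (is_derive1_powR _ (pos0 _ _ xB yB))).
  by apply: near_eq_is_derive; near=> z; rewrite e.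
have cpow (b' x y : R) : 2 * B <= sg * x -> `|y| <= B ->
    {for y, continuous (fun y : R => (sg * (x - y)) `^ b')}.
  by move=> xB yB; have [d _] := dpow b' x y xB yB; exact: derivable_continuous.
elim: n b => [|n IH] b.
  have [M M0 rM] : exists2 M : R, 0 < M & forall x, `|rho x| <= M.
    apply: test_bounded; apply/test_functionP; split => //.
    by exists B => // y; exact: (rhoB 0%N).
  exists (2 `^ `|b| * M * (2 * B)); first by rewrite !mulr_ge0 ?powR_ge0// ltW.
  move=> x xB; rewrite subr0.
  rewrite (@Rintegral_supp _ _ `[- B, B]); last first.
    move=> y /= /negP; rewrite in_itv_normP -ltNge => /ltW yB.
    by have /= -> := rhoB 0%N y yB; rewrite mulr0.
  have cint : mu.-integrable `[- B, B] (EFin \o (fun y => (sg * (x - y)) `^ b * rho y)).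
    apply: continuous_itv_integrable => y; rewrite -ler_norml => yB.
    by apply: continuousM; [exact: cpow|exact: smooth_continuous].
  apply: (@le_trans _ _ (\int[mu]_(y in `[- B, B]) (2 `^ `|b| * M * (sg * x) `^ b))).
    apply: normr_Rintegral_le => //.
    - exact: integrable_measurable cint.
    - by apply: continuous_itv_integrable => y _; exact: cvg_cst.
    - move=> y /=; rewrite in_itv_normP => yB; have [p1 p2] := pos x y xB yB.
      rewrite normrM (ger0_norm (powR_ge0 _ _)) [leRHS]mulrAC.
      apply: ler_pM; rewrite ?powR_ge0//.
      by apply: powR_comparable => //; lra.
  rewrite Rintegral_cst//= lebesgue_measure_itv/= lte_fin.
  rewrite (_ : - B < B); last by lra.
  by rewrite /= opprK mulrAC (_ : B + B = 2 * B)//; lra.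
have [C C0 HC] := IH (b - 1).
exists (`|b| * C); first by rewrite mulr_ge0.
move=> x xB; rewrite derive1nS.
have cd (y : R) : `|y| <= B ->
    {for y, continuous (fun y : R => - sg * (b * (sg * (x - y)) `^ (b - 1)))}.
  move=> yB; apply: continuousM; first exact: cvg_cst.
  by apply: continuousM; [exact: cvg_cst|exact: cpow].
have E := @Rintegral_parts_test R B (fun y => (sg * (x - y)) `^ b)
  (fun y => - sg * (b * (sg * (x - y)) `^ (b - 1))) _ B0 (smooth_derive1n srho) (rhoB n)
  (fun y yB => dpow b x y xB yB) cd.
rewrite E.
rewrite normrN.
have -> : \int[mu]_y (- sg * (b * (sg * (x - y)) `^ (b - 1)) * derive1n n rho y) =
   - sg * b * \int[mu]_y ((sg * (x - y)) `^ (b - 1) * derive1n n rho y).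
  rewrite -RintegralZl//; last first.
    apply: (@integrable_supp _ _ `[- B, B]%classic) => //.
      apply: continuous_itv_integrable => y; rewrite -ler_norml => yB.
      apply: continuousM; [exact: cpow|].
      exact/smooth_continuous/smooth_derive1n.
    move=> y /= /negP; rewrite in_itv_normP -ltNge => /ltW yB.
    by rewrite rhoB// mulr0.
  by apply: eq_Rintegral => y _; rewrite !mulrA.
rewrite !normrM normrN sg1 mul1r -mulrA ler_wpM2l//.
rewrite (le_trans (HC x xB))// -natr1 (_ : b - 1 - n%:R = b - (n%:R + 1))//; ring.
Unshelve. all: by end_near. Qed.

End convolution_decay.

Lemma Rintegral_congr (R : realType) (D : set R) (f g : R -> R) : f =1 g ->
  \int[@lebesgue_measure R]_(x in D) f x = \int[@lebesgue_measure R]_(x in D) g x.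
Proof. by move=> /funext ->. Qed.

(** * Decay and differentiation of the fundamental solution *)

Section fundamental_solution.
Context {R : realType} (al : R).
Hypotheses (al0 : 0 < al) (al1 : al < 1).
Local Notation mu := (@lebesgue_measure R).

Lemma spow_locally_integrable : locally_integrable setT (spow al).
Proof. by apply: continuous_locally_integrable => x; exact: continuous_spow. Qed.

Lemma continuous_decay (F : R -> R) (p L C : R) : continuous F -> 0 <= p -> 0 < L ->
  0 <= C -> (forall x, L <= `|x| -> `|F x| <= C * `|x| `^ (- p)) ->
  exists2 C' : R, 0 <= C' & forall x, `|F x| <= C' * (1 + `|x|) `^ (- p).
Proof.
move=> cF p0 L0 C0 FC.
have cf : {within `[- L, L], continuous (fun x => `|F x|)}.
  apply: continuous_subspaceT => x; apply: continuous_comp; first exact: cF.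
  exact: norm_continuous.
have LL : - L <= L by lra.
have [c cB fc] := EVT_max LL cf.
(* For |x| >= L one has 1 + |x| <= (1 + 1/L) |x|; for |x| < L the maximum |F c| is compared with the
   smallest value (1 + L)^-p of the weight. *)
exists (`|F c| * (1 + L) `^ p + C * (1 + L^-1) `^ p).
  by rewrite addr_ge0// mulr_ge0// powR_ge0.
move=> x; have x1 : 0 < 1 + `|x| by rewrite ltr_wpDr.
have [Lx|xL] := leP L `|x|.
  apply: (le_trans (FC x Lx)); apply: (@le_trans _ _ (C * (1 + L^-1) `^ p * (1 + `|x|) `^ (- p))).
    rewrite -mulrA ler_wpM2l// !powRN ler_pdivlMr ?powR_gt0// mulrC ler_pdivrMr; last first.
      by rewrite powR_gt0// (lt_le_trans L0).
    rewrite -powRM ?addr_ge0 ?invr_ge0 ?(ltW L0)//; apply: le_powR_base => //.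
    rewrite mulrDl mul1r addrC lerD2l//.
    by rewrite mulrC ler_pdivlMr// mul1r.
  by rewrite ler_wpM2r ?powR_ge0// lerDr mulr_ge0 ?powR_ge0.
apply: (@le_trans _ _ (`|F c| * (1 + L) `^ p * (1 + `|x|) `^ (- p))).
  apply: (@le_trans _ _ `|F c|); first by apply: fc; rewrite in_itv_normP ltW.
  rewrite powRN ler_pdivlMr ?powR_gt0// ler_wpM2l//; apply: le_powR_base => //.
  by rewrite lerD2l ltW.
by rewrite ler_wpM2r ?powR_ge0// lerDl mulr_ge0 ?powR_ge0.
Qed.

Lemma conv_spow_decay (rho : R -> R) (n : nat) : test_function rho -> (2 <= n)%N ->
  exists2 C : R, 0 <= C &
    forall x, `|conv (spow al) (derive1n n rho) x| <= C * (1 + `|x|) `^ (1 + al - n%:R).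
Proof.
move=> tp n2; have [B B0 rhoB] := test_support tp.
have srho := test_smooth tp.
have tn := test_derive1n n tp.
have [C1 C10 H1] := conv_power_decay n (1 + al) srho B0 rhoB (expr1n _ 2).
have [C2 C20 H2] := conv_power_decay n (1 + al) srho B0 rhoB (etrans (sqrrN 1) (expr1n _ 2)).
rewrite -(opprB n%:R); apply: (@continuous_decay _ _ (2 * B) ((1 + al)^-1 * (C1 + C2))).
- apply/smooth_continuous/smooth_conv => //; exact: spow_locally_integrable.
- rewrite subr_ge0; apply: (@le_trans _ _ 2%:R); last by rewrite ler_nat.
  by have := ltW al1; lra.
- by rewrite mulr_gt0.
- by rewrite mulr_ge0 ?addr_ge0 ?invr_ge0// addr_ge0// ltW.
move=> x Bx; rewrite (convC _ spow_locally_integrable tn) opprB.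
have a10 : 0 < 1 + al by rewrite addr_gt0.
have Einv : `|(1 + al)^-1| = (1 + al)^-1 by rewrite gtr0_norm// invr_gt0.
(* For |y| < B and |x| >= 2B the difference x - y has the sign of x, so [spow] is a constant times a
   genuine power on the support of rho. *)
have H (sg C : R) : sg = 1 \/ sg = -1 -> sg * x = `|x| ->
    (forall x, 2 * B <= sg * x ->
      `|\int[mu]_y ((sg * (x - y)) `^ (1 + al) * derive1n n rho y)| <=
      C * (sg * x) `^ (1 + al - n%:R)) ->
    `|\int[mu]_y (spow al (x - y) * derive1n n rho y)| <=
    (1 + al)^-1 * C * `|x| `^ (1 + al - n%:R).
  move=> sg1 sgx HC.
  have nsg : `|sg| = 1 by case: sg1 => ->; rewrite ?normrN normr1.
  have sgsp z : 0 < sg * z -> spow al z = sg / (1 + al) * (sg * z) `^ (1 + al).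
    case: sg1 => ->; rewrite ?mul1r ?mulN1r => z0.
      by rewrite spow_ge0 ?ltW// mulrC.
    by rewrite -[in LHS](opprK z) spowN spow_ge0 ?(ltW z0)//; ring.
  have E y : spow al (x - y) * derive1n n rho y =
      sg / (1 + al) * ((sg * (x - y)) `^ (1 + al) * derive1n n rho y).
    have [yB|yB] := leP B `|y|; first by rewrite rhoB// !mulr0.
    rewrite sgsp ?mulrA// mulrBr sgx.
    have : sg * y <= `|y| by rewrite -[leRHS]mul1r -nsg -normrM ler_norm.
    by lra.
  rewrite (Rintegral_congr _ E).
  have [a1s|] := eqVneq sg 0; first by move: nsg; rewrite a1s normr0 => /eqP; rewrite eq_sym oner_eq0.
  move=> sg0.
  rewrite RintegralZl//; last first.
    have := integrable_cmul measurableT ((sg / (1 + al))^-1)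
       (integrable_convC x spow_locally_integrable tn).
    apply: integrable_eq => // y _; rewrite E mulrA mulVf ?mul1r//.
    by rewrite mulf_neq0// invr_neq0// gt_eqF.
  rewrite !normrM nsg mul1r Einv -mulrA -sgx ler_wpM2l ?invr_ge0 ?(ltW a10)//.
  by apply: HC; rewrite sgx.
have N := powR_ge0 `|x| (1 + al - n%:R).
have [x0|x0] := leP 0 x.
  apply: (le_trans (H 1 C1 (or_introl erefl) _ H1)).
    by rewrite mul1r ger0_norm.
  by rewrite ler_wpM2r// ler_wpM2l ?invr_ge0 ?(ltW a10)// lerDl.
apply: (le_trans (H (-1) C2 (or_intror erefl) _ H2)).
  by rewrite mulN1r ltr0_norm.
by rewrite ler_wpM2r// ler_wpM2l ?invr_ge0 ?(ltW a10)// lerDr.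
Qed.

(** Undoes the passage from |w|^al to its primitive: [spow] against rho''' is |w|^al against
    rho''. *)
Lemma conv_spowE (rho : R -> R) (x : R) : test_function rho ->
  conv (spow al) (derive1 rho) x = \int[mu]_y (`|x - y| `^ al * rho y).
Proof.
move=> tp; have [B B0 rhoB] := test_support tp.
rewrite (convC _ spow_locally_integrable (test_derive1 tp)).
have d (y : R) : `|y| <= B ->
    is_derive y 1 (fun y : R => spow al (x - y)) (-1 * `|x - y| `^ al).
  move=> _; have e (z : R) : x + -1 * z = x - z by rewrite mulN1r.
  have := @is_derive_affine_comp _ x (-1) y (`|x - y| `^ al) (spow al).
  rewrite e => /(_ (is_derive_spow al0 _)).
  by apply: near_eq_is_derive; near=> z; rewrite e.
have c (y : R) : `|y| <= B -> {for y, continuous (fun y : R => -1 * `|x - y| `^ al)}.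
  move=> _; apply: continuousM; first exact: cvg_cst.
  apply: (@continuous_comp _ _ _ (fun y : R => x - y) (fun z : R => `|z| `^ al)).
    by apply: continuousB; [exact: cvg_cst|exact: cvg_id].
  exact: continuous_norm_powR.
have := @Rintegral_parts_test R B (fun y => spow al (x - y))
  (fun y => -1 * `|x - y| `^ al) rho B0 (test_smooth tp) (rhoB 0%N) d c.
move=> ->.
have i : mu.-integrable setT (EFin \o (fun y => `|x - y| `^ al * rho y)).
  apply: (@integrable_convC _ (fun z => `|z| `^ al)) => //.
  by apply: continuous_locally_integrable; exact: continuous_norm_powR.
have E y : -1 * `|x - y| `^ al * rho y = -1 * (`|x - y| `^ al * rho y).
  by rewrite mulrA.
by rewrite (Rintegral_congr _ E) RintegralZl// mulN1r opprK.
Unshelve. all: by end_near. Qed.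

End fundamental_solution.

(** * Principal values *)

Section principal_value.
Context {R : realType} (al : R).
Hypotheses (al0 : 0 < al) (al1 : al < 1).
Local Notation mu := (@lebesgue_measure R).
Local Notation T := (measurableTypeR R).

(** The truncated principal value folded about x: the points x + z and x - z are paired, so that
    first-order terms cancel. *)
Definition pv_trunc (p d : R) (th : R -> R) (x : R) : R :=
  \int[mu]_(z in `]d, +oo[) ((2 * th x - th (x + z) - th (x - z)) * z `^ (- p)).

(** The bound splits into a function of w and a function of z, the shape that the dominated form of
    Fubini asks for. *)
Lemma spow_second_diff_bound (w z : R) : 0 < z ->
  `|2 * spow al w - spow al (w + z) - spow al (w - z)| <= 2 * `|w| `^ al * z.
Proof.
move=> z0; have [->|w0] := eqVneq w 0.
  rewrite add0r sub0r spowN spow0 mulr0 sub0r opprK addNr normr0.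
  by rewrite !mulr_ge0 ?powR_ge0// ltW.
have nw : 0 < `|w| by rewrite normr_gt0.
have zE : z = `|w| * (z / `|w|) by rewrite mulrCA divff ?gt_eqF// mulr1.
have zw : 0 < z / `|w| by exact: divr_gt0.
rewrite {1 2}zE spow_second_diff// !normrM normr_sg w0 mul1r.
rewrite (ger0_norm (powR_ge0 _ _)).
apply: (@le_trans _ _ (`|w| `^ (1 + al) * (2 * (z / `|w|)))).
  rewrite ler_wpM2l ?powR_ge0// (le_trans (spow2_bound al0 al1 zw))//.
  by rewrite ler_wpM2r ?(ltW zw)// ler_piMr// ge_min lexx.
rewrite powRD ?powRr1 ?(ltW nw)//; last by rewrite (gt_eqF nw) implybT.
by rewrite le_eqVlt; apply/orP; left; apply/eqP; field; rewrite gt_eqF.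
Qed.

Lemma locally_integrable_norm_powR (p : R) : p < 1 ->
  locally_integrable setT (fun y : R => `|y| `^ (- p)).
Proof.
move=> p1; have m : measurable_fun setT (fun y : R => `|y| `^ (- p)).
  apply: (@measurableT_comp _ _ _ _ _ _ (fun z : R => z `^ (- p))).
    exact: measurable_powR.
  by apply: continuous_measurable; exact: norm_continuous.
split; [exact: m|exact: openT|].
move=> K _ cK.
have [M [Mr MB]] := compact_bounded cK.
pose L := `|M| + 1.
have L0 : 0 < L by rewrite ltr_wpDl.
have KL x : K x -> `|x| <= L.
  by apply: MB; rewrite /L ltr_pwDr// ler_norm.
pose h (y : R) := if `|y| <= L then `|y| `^ (- p) else 0.
have hE : h = ((fun y : R => `|y| `^ (- p)) \_ `[- L, L]%classic).
  by apply/funext => y; rewrite /h /patch mem_setE in_itv_normP.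
have mh : measurable_fun setT h.
  rewrite hE; apply/(measurable_restrictT _ _).1 => //.
  exact: measurable_funTS.
have ih : mu.-integrable setT (EFin \o h).
  apply: even_integrable => //.
  - by move=> y; rewrite /h; case: ifP => _ //; exact: powR_ge0.
  - by move=> y; rewrite /h normrN.
  - rewrite (@itv0y_split _ L) ?(ltW L0)//; apply: integrable_setU_disj => //.
    + exact: itv0y_disj.
    + apply: (@integrable_eq _ _ _ (fun z => z `^ (- p))) => //; last exact: integrable_powR0.
      by move=> z /=; rewrite in_itv/= => /andP[z0 zL]; rewrite /h gtr0_norm// zL.
    + apply: (@integrable_eq _ _ _ (fun z => 0)) => //; last exact: integrable0.
      move=> z /=; rewrite in_itv/= andbT => zL.
      by rewrite /h gtr0_norm ?(lt_trans L0)// leNgt zL.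
case/integrableP : ih => _; apply: le_lt_trans.
have mK : measurable K by exact: compact_measurable.
apply: (@le_trans _ _ (\int[mu]_(x in K) `|h x|%:E)%E).
  apply: ge0_le_integral => //.
  - by apply/measurable_EFinP/measurableT_comp => //; exact: measurable_funTS.
  - by apply/measurable_EFinP/measurableT_comp => //; exact: measurable_funTS.
  - by move=> x Kx; rewrite /h KL.
apply: ge0_subset_integral => //.
by apply/measurable_EFinP/measurableT_comp.
Qed.

Section truncated.
Variables (psi : R -> R) (x d : R).
Hypotheses (tp : test_function psi) (d0 : 0 < d).

Let F (y z : R) : R := (2 * spow al (x - y) - spow al (x - y + z) - spow al (x - y - z)) *
   psi y * (if d < z then z `^ (- (2 + al)) else 0).

Let mspow : measurable_fun setT (spow al).
Proof. by apply: continuous_measurable => w; exact: continuous_spow. Qed.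

Let mcut (p : R) : measurable_fun setT (fun z : R => if d < z then z `^ (- p) else 0).
Proof.
rewrite (_ : (fun z => _) = (fun z : R => z `^ (- p)) \_ `]d, +oo[%classic).
  apply/(measurable_restrictT _ _).1 => //; apply: measurable_funTS.
  exact: measurable_powR.
by apply/funext => z; rewrite /patch mem_setE in_itv/= andbT.
Qed.

Let icut (p : R) : 1 < p ->
  mu.-integrable setT (EFin \o (fun z : R => if d < z then z `^ (- p) else 0)).
Proof.
move=> p1; apply: (@integrable_supp _ _ `]d, +oo[%classic) => //.
  apply: (@integrable_eq _ _ _ (fun z => z `^ (- p))) => //; last exact: integrable_powR_tail.
  by move=> z /=; rewrite in_itv/= andbT => ->.
by move=> z /=; rewrite in_itv/= andbT => /negP/negbTE ->.
Qed.

Let mF : measurable_fun (setT : set (T * T)) (fun p : T * T => F p.1 p.2).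
Proof.
have m1 : measurable_fun (setT : set (T * T)) (fun p : T * T => x - p.1 : R).
  by apply: measurable_funB => //; exact: measurable_fst.
have m2 : measurable_fun (setT : set (T * T)) (fun p : T * T => p.2 : R).
  exact: measurable_snd.
apply: measurable_funM; first apply: measurable_funM.
- apply: measurable_funB; first apply: measurable_funB.
  + by apply: measurable_funM => //; exact: (measurableT_comp mspow).
  + by apply: (measurableT_comp mspow); exact: measurable_funD.
  + by apply: (measurableT_comp mspow); exact: measurable_funB.
- by apply: (measurableT_comp (test_measurable tp)); exact: measurable_fst.
- exact: (measurableT_comp (mcut (2 + al))).
Qed.

Let f y := 2 * `|x - y| `^ al * `|psi y|.
Let g z : R := if d < z then z `^ (- (1 + al)) else 0.

Let intf : mu.-integrable setT (EFin \o f).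
Proof.
have lp : locally_integrable setT (fun z : R => `|z| `^ al).
  by apply: continuous_locally_integrable; exact: continuous_norm_powR.
have := integrable_norm (integrable_convC x lp tp).
move=> /(integrable_cmul measurableT 2).
apply: integrable_eq => // y _; rewrite /f /= normrM (ger0_norm (powR_ge0 _ _)).
by rewrite mulrA.
Qed.

Let intg : mu.-integrable setT (EFin \o g).
Proof. by apply: icut; rewrite ltrDl. Qed.

Let Ffg y z : `|F y z| <= f y * g z.
Proof.
rewrite /F /f /g; case: ifPn => dz; last by rewrite !mulr0 normr0.
have z0 := lt_trans d0 dz.
rewrite !normrM (ger0_norm (powR_ge0 _ _)).
have -> : z `^ (- (1 + al)) = z * z `^ (- (2 + al)).
  rewrite (_ : - (1 + al) = 1 + - (2 + al)); last by ring.
  by rewrite powRD ?powRr1 ?(ltW z0)// (gt_eqF z0) implybT.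
rewrite [leRHS](_ : _ = (2 * `|x - y| `^ al * z) * `|psi y| * z `^ (- (2 + al))); last by ring.
by rewrite ler_wpM2r ?powR_ge0// ler_wpM2r// spow_second_diff_bound.
Qed.

Let innerz y : \int[mu]_z F y z = spow_trunc al d (x - y) * psi y.
Proof.
rewrite (@Rintegral_supp _ _ `]d, +oo[%classic); last first.
  by move=> z /=; rewrite in_itv/= andbT /F => /negP/negbTE ->; rewrite mulr0.
rewrite /spow_trunc -RintegralZr//; last first.
  have i : mu.-integrable `]d, +oo[ (EFin \o g).
    by apply: (@integrableS _ _ _ _ setT) => //.
  apply: (@integrable_le _ _ _ (fun z => 2 * `|x - y| `^ al * g z)) => //.
  - apply: measurable_funTS; apply: measurable_funM; last exact: measurable_powR.
    apply: measurable_funB; first apply: measurable_funB.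
    + exact: measurable_cst.
    + by apply: (measurableT_comp mspow); exact: measurable_funD.
    + by apply: (measurableT_comp mspow); exact: measurable_funB.
  - exact: integrable_cmul.
  - move=> z /=; rewrite in_itv/= andbT => dz; rewrite /g dz.
    have z0 := lt_trans d0 dz.
    rewrite !normrM (ger0_norm (powR_ge0 _ _)).
    have -> : z `^ (- (1 + al)) = z * z `^ (- (2 + al)).
      rewrite (_ : - (1 + al) = 1 + - (2 + al)); last by ring.
      by rewrite powRD ?powRr1 ?(ltW z0)// (gt_eqF z0) implybT.
    by rewrite mulrA ler_wpM2r ?powR_ge0// spow_second_diff_bound.
by apply: eq_Rintegral => z; rewrite inE/= in_itv/= andbT /F => ->; rewrite mulrAC.
Qed.

Let innery z : \int[mu]_y F y z = (2 * conv (spow al) psi x - conv (spow al) psi (x + z) -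
   conv (spow al) psi (x - z)) * (if d < z then z `^ (- (2 + al)) else 0).
Proof.
have ls := spow_locally_integrable al0.
rewrite !(convC _ ls tp) -RintegralZl//; last exact: integrable_convC.
rewrite -RintegralB//; [|by apply: integrable_cmul => //; exact: integrable_convC|exact: integrable_convC].
rewrite -RintegralB//; [|by apply: integrable_sub => //; [apply: integrable_cmul => //|]; exact: integrable_convC|exact: integrable_convC].
rewrite -RintegralZr//; last first.
  by apply: integrable_sub => //; [apply: integrable_sub => //; [apply: integrable_cmul => //|]|]; exact: integrable_convC.
apply: Rintegral_congr => y; rewrite /F -(addrAC x z) (addrAC x (- z)).
ring.
Qed.

(** With d > 0 fixed nothing is singular: the integrand is dominated by a function of y times
    z^-(1+al), integrable beyond d. Fubini then lets the truncated operator act on the kernel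
    [spow]. *)
Lemma pv_trunc_conv : pv_trunc (2 + al) d (conv (spow al) psi) x =
  \int[mu]_y (spow_trunc al d (x - y) * psi y).
Proof.
rewrite -(Rintegral_congr _ innerz) (Rintegral_fubini mF intf intg Ffg).
rewrite (Rintegral_congr _ innery) /pv_trunc.
rewrite [RHS](@Rintegral_supp _ _ `]d, +oo[%classic); last first.
  by move=> z /=; rewrite in_itv/= andbT => /negP/negbTE ->; rewrite mulr0.
by apply: eq_Rintegral => z; rewrite inE/= in_itv/= andbT => ->.
Qed.

Lemma integrable_spow_trunc :
  mu.-integrable setT (EFin \o (fun y => spow_trunc al d (x - y) * psi y)).
Proof.
have := integrable_fubini mF intf intg Ffg.
by apply: integrable_eq => // y _; rewrite innerz.
Qed.

End truncated.
End principal_value.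

Lemma cvg0_powR_bound (R : realType) (F : R -> R) (l k g : R) : 0 < g ->
  (forall d, 0 < d -> `|F d - l| <= k * d `^ g) -> F d @[d --> 0^'+] --> l.
Proof.
move=> g0 H.
have lim0 : k * d `^ g @[d --> 0^'+] --> 0.
  by rewrite -[X in _ --> X](mulr0 k); apply: cvgM; [exact: cvg_cst|exact: powR_cvg0].
apply/cvgrPdist_le => e e0.
near=> d.
rewrite distrC (le_trans (H d _))//.
apply: (le_trans (ler_norm _)); rewrite -[X in `|X|]subr0 distrC.
by near: d; move/cvgrPdist_le : lim0; apply.
Unshelve. all: by end_near. Qed.

Lemma Rintegral_congr_in (R : realType) (D : set R) (f g : R -> R) :
  (forall x, D x -> f x = g x) ->
  \int[@lebesgue_measure R]_(x in D) f x = \int[@lebesgue_measure R]_(x in D) g x.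
Proof. by move=> fg; apply: eq_Rintegral => x; rewrite inE; exact: fg. Qed.

Section pv_limit.
Context {R : realType} (al : R).
Hypotheses (al0 : 0 < al) (al1 : al < 1).
Local Notation mu := (@lebesgue_measure R).

(** The derivative of the sign function is twice the delta measure: cutting the integral at x, each
    half contributes eta x. *)
Lemma Rintegral_sg_derive1 (eta : R -> R) (x : R) : test_function eta ->
  mu.-integrable setT (EFin \o (fun y => Num.sg (x - y) * derive1 eta y)) /\
  \int[mu]_y (Num.sg (x - y) * derive1 eta y) = 2 * eta x.
Proof.
move=> te; have [B B0 eB] := test_support te.
pose L := B + `|x|.
have L0 : 0 < L by rewrite ltr_wpDr.
have nx : - L < x < L.
  have := ler_norm x; have := ler_norm (- x); rewrite normrN => ? ?.
  by apply/andP; split; rewrite /L; lra.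
have [xL1 xL2] := andP nx.
have se := smooth_derive1 (test_smooth te).
have ce := smooth_continuous se.
have out y : ~ `[- L, L]%classic y -> Num.sg (x - y) * derive1 eta y = 0.
  move=> /= /negP; rewrite in_itv_normP -ltNge => Ly.
  rewrite [derive1 eta y](eB 1%N) ?mulr0// (le_trans _ (ltW Ly))// /L lerDl//.
have split : `[- L, L]%classic = `[- L, x[ `|` `[x, L] :> set R.
  apply/seteqP; split => y /=; rewrite !in_itv/=.
    by move=> /andP[-> ->]; rewrite andbT; case: (ltP y x); [left|right].
  by case=> /andP[? ?]; apply/andP; split; lra.
have ic a b : mu.-integrable `[a, b] (EFin \o derive1 eta).
  by apply: continuous_itv_integrable => y _; exact: ce.
have i1 : mu.-integrable `[- L, x[ (EFin \o derive1 eta).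
  by apply: integrableS (ic (- L) x) => // y /=; rewrite !in_itv/= => /andP[-> /ltW ->].
have i2 : mu.-integrable `]x, L] (EFin \o derive1 eta).
  by apply: integrableS (ic x L) => // y /=; rewrite !in_itv/= => /andP[/ltW -> ->].
have ms : measurable_fun setT (fun y : R => Num.sg (x - y)).
  apply: (measurable_shift_comp (psi := Num.sg)).
  rewrite (_ : Num.sg = \1_(`]0, +oo[%classic : set R) \- \1_(`]-oo, 0[%classic : set R)).
    by apply: measurable_funB; exact: measurable_indic.
  apply/funext => z; rewrite /= !indicE !mem_setE !in_itv/= andbT.
  by case: sgrP => /=; rewrite ?subr0 ?sub0r.
have isg : mu.-integrable `[- L, L] (EFin \o (fun y => Num.sg (x - y) * derive1 eta y)).
  apply: (@integrable_le _ _ _ (fun y => `|derive1 eta y|)) => //.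
  - apply: measurable_funTS; apply: measurable_funM; first exact: ms.
    exact: continuous_measurable.
  - exact: integrable_norm.
  - by move=> y _; rewrite normrM normr_sg; case: eqP => _ /=; rewrite ?mul0r ?mul1r.
split; first exact: (integrable_supp _ isg out).
rewrite (Rintegral_supp out) split Rintegral_setU//; last 2 first.
- by rewrite -split.
- apply/disj_setPS => y [] /=; rewrite !in_itv/= => /andP[_ yx] /andP[xy _].
  by rewrite ltNge xy in yx.
have e1 : \int[mu]_(y in `[- L, x[) (Num.sg (x - y) * derive1 eta y) = eta x - eta (- L).
  rewrite (@Rintegral_congr_in _ _ _ (derive1 eta)); last first.
    by move=> y; rewrite /= in_itv/= => /andP[_ yx]; rewrite gtr0_sg ?mul1r// subr_gt0.
  rewrite Rintegral_itv_bndo_bndc//; apply: Rintegral_derive; first exact: ltW.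
    by move=> y _; exact/smooth_is_derive/test_smooth.
  by move=> y _; exact: ce.
have e2 : \int[mu]_(y in `[x, L]) (Num.sg (x - y) * derive1 eta y) = - (eta L - eta x).
  rewrite -Rintegral_itv_obnd_cbnd; last first.
    by apply: integrableS isg => // y /=; rewrite !in_itv/= => /andP[? ->]; rewrite andbT; lra.
  rewrite (@Rintegral_congr_in _ _ _ (fun y => -1 * derive1 eta y)); last first.
    by move=> y; rewrite /= in_itv/= => /andP[xy _]; rewrite ltr0_sg// subr_lt0.
  rewrite RintegralZl// mulN1r Rintegral_itv_obnd_cbnd//; congr (- _).
  apply: Rintegral_derive; first exact: ltW.
    by move=> y _; exact/smooth_is_derive/test_smooth.
  by move=> y _; exact: ce.
have B1 : B <= `|L| by rewrite gtr0_norm// lerDl.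
have B2 : B <= `|- L| by rewrite normrN.
have /= E1 := eB 0%N _ B1; have /= E2 := eB 0%N _ B2.
by rewrite e1 e2 E1 E2; ring.
Qed.

(** Truncating changes the kernel by at most a constant times d^(1-al) |x-y|^-(1-al), which is
    integrable against eta'. In the limit the sign function is paired with eta', whence the factor
    2. *)
Lemma pv_trunc_conv_cvg (eta : R -> R) (x : R) : test_function eta ->
  pv_trunc (2 + al) d (conv (spow al) (derive1 eta)) x @[d --> 0^'+] -->
  2 * spow_const al * eta x.
Proof.
move=> te; have tde := test_derive1 te.
have [isg Esg] := Rintegral_sg_derive1 x te.
have p1 : 1 - al < 1 by rewrite gtrDl oppr_lt0.
have lp := locally_integrable_norm_powR p1.
have c0 : 0 <= 2 / (1 - al) by rewrite divr_ge0// subr_ge0 ltW.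
have iK := integrable_norm (integrable_convC x lp tde).
pose k := \int[mu]_y (2 / (1 - al) * `| `|x - y| `^ (- (1 - al)) * derive1 eta y|).
have H d : 0 < d -> `|pv_trunc (2 + al) d (conv (spow al) (derive1 eta)) x -
    2 * spow_const al * eta x| <= k * d `^ (1 - al).
  move=> d0; rewrite pv_trunc_conv//.
  have it := integrable_spow_trunc al0 al1 x tde d0.
  have -> : 2 * spow_const al * eta x =
      \int[mu]_y (spow_const al * (Num.sg (x - y) * derive1 eta y)).
    by rewrite RintegralZl// Esg; ring.
  rewrite -RintegralB//; last exact: integrable_cmul.
  rewrite /k -RintegralZr//; last exact: integrable_cmul.
  apply: normr_Rintegral_le => //.
  - by apply: (@integrable_measurable _ setT); apply: integrable_sub => //; exact: integrable_cmul.
  - have := integrable_cmul measurableT (d `^ (1 - al)) (integrable_cmul measurableT (2 / (1 - al)) iK).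
    by apply: integrable_eq => // y _; rewrite mulrC.
  move=> y _.
  have -> : spow_trunc al d (x - y) * derive1 eta y -
      spow_const al * (Num.sg (x - y) * derive1 eta y) =
    (spow_trunc al d (x - y) - spow_const al * Num.sg (x - y)) * derive1 eta y by ring.
  rewrite normrM.
  (* [spow_trunc_cvg] excludes w = 0. There the truncated integral vanishes by oddness of [spow],
     and so does the sign. *)
  have [xy|xy] := eqVneq (x - y) 0.
    rewrite xy sgr0 mulr0 subr0.
    have -> : spow_trunc al d 0 = 0.
      rewrite /spow_trunc; under eq_Rintegral do
        rewrite add0r sub0r spowN spow0 mulr0 sub0r opprK addNr mul0r.
      by rewrite Rintegral_cst//= mul0r.
    by rewrite normr0 mul0r mulr_ge0 ?powR_ge0// mulr_ge0.
  rewrite [X in _ <= _ * X * _]normrM (ger0_norm (powR_ge0 _ _)).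
  rewrite [leRHS](_ : _ = 2 / (1 - al) * d `^ (1 - al) * `|x - y| `^ (- (1 - al)) *
     `|derive1 eta y|); last by ring.
  rewrite ler_wpM2r// (le_trans _ (spow_trunc_cvg al0 al1 d0 xy))//.
  by rewrite mulrC.
apply: (@cvg0_powR_bound _ _ _ k (1 - al)) => //.
by rewrite subr_gt0.
Qed.

End pv_limit.

(** * Weighted bounds for second-difference integrals *)

Section pv_weighted_bound.
Context {R : realType} (al be : R).
Hypotheses (al0 : 0 < al) (al1 : al < 1) (be1 : 1 < be).
Local Notation mu := (@lebesgue_measure R).

Lemma smooth_MVT (f : R -> R) (a b : R) : smooth f -> a < b ->
  exists2 c, a < c < b & f b - f a = derive1 f c * (b - a).
Proof.
move=> sf ab.
have [|c ct E] := @MVT _ f (derive1 f) _ _ ab (fun x _ => smooth_is_derive x sf).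
  by apply: continuous_subspaceT; exact: smooth_continuous.
by exists c.
Qed.

Lemma second_diff_bound (th : R -> R) (x z M : R) : smooth th -> 0 < z ->
  (forall y, `|y - x| <= z -> `|derive1n 2 th y| <= M) ->
  `|2 * th x - th (x + z) - th (x - z)| <= 2 * M * z ^+ 2.
Proof.
move=> sth z0 HM.
(* [q] is the second difference as a function of its step. Its derivative is a first difference of
   th', to which the mean value theorem applies a second time. *)
pose q (t : R) := 2 * th x + (-1) * th (x + 1 * t) + (-1) * th (x + (-1) * t).
have sq : smooth q.
  have s1 (c : R) : smooth (fun t => th (x + c * t)) by exact: smooth_affine_comp.
  apply: smoothD; first apply: smoothD.
  - exact: smooth_cst.
  - by apply: smoothZ; exact: s1.
  - by apply: smoothZ; exact: s1.
have qz : 2 * th x - th (x + z) - th (x - z) = q z.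
  by rewrite /q mul1r !mulN1r.
have q0 : q 0 = 0 by rewrite /q !mulr0 addr0; ring.
have [c /andP[c0 cz] Ec] := smooth_MVT sq z0.
have dq : derive1 q c = - (derive1 th (x + c) - derive1 th (x - c)).
  have d1 (e : R) : is_derive c 1 (fun t => th (x + e * t)) (e * derive1 th (x + e * c)).
    by apply: is_derive_affine_comp; exact: smooth_is_derive.
  have := is_deriveD (is_deriveD (is_derive_cst (2 * th x) c 1) (is_deriveZ (-1) (d1 1)))
     (is_deriveZ (-1) (d1 (-1))).
  move=> [_ D]; rewrite derive1E -[LHS]/('D_1 (cst (2 * th x) + -1 *: (fun t => th (x + 1 * t)) +
     -1 *: (fun t => th (x + -1 * t))) c) D /GRing.scale/= !mulN1r !mul1r opprK add0r.
  by ring.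
have xx : x - c < x + c by lra.
have [e /andP[e1 e2] Ee] := smooth_MVT (smooth_derive1 sth) xx.
rewrite qz -[q z]subr0 -{1}q0 Ec subr0 dq Ee normrM normrN normrM.
have -> : x + c - (x - c) = 2 * c by ring.
rewrite (gtr0_norm z0) (gtr0_norm (_ : 0 < 2 * c)) ?mulr_gt0//.
rewrite expr2 -[derive1 _ e]/(derive1n 2 th e).
have M1 : `|derive1n 2 th e| <= M.
  by apply: HM; rewrite ler_norml; apply/andP; split; lra.
have M0 : 0 <= M by apply: le_trans M1.
rewrite mulrA ler_wpM2r ?(ltW z0)//.
rewrite (mulrC 2 M) -mulrA; apply: ler_pM => //; first by rewrite mulr_ge0// ltW.
by rewrite ler_pM2l// ltW.
Qed.

(** Once folded, the integral of a bounded smooth function with bounded second derivative converges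
    absolutely, so no limit has to be taken. *)
Definition pv_integral (p : R) (th : R -> R) (x : R) : R :=
  \int[mu]_(z in `]0, +oo[) ((2 * th x - th (x + z) - th (x - z)) * z `^ (- p)).

Let gt12 : 1 < 2 + al.
Proof. by have := al0; lra. Qed.

Let I := \int[mu]_y (1 + `|y|) `^ (- be).

Lemma integrable_bracket_shift (x c : R) : c != 0 ->
  mu.-integrable setT (EFin \o (fun z => (1 + `|x + c * z|) `^ (- be))).
Proof.
move=> c0; have := integrable_affine x c0 measurableT (integrable_bracket be1).
by rewrite preimage_setT.
Qed.

Lemma Rintegral_bracket_shift (x c : R) : `|c| = 1 ->
  \int[mu]_z (1 + `|x + c * z|) `^ (- be) = I.
Proof.
move=> c1; have c0 : c != 0 by rewrite -normr_eq0 c1 oner_neq0.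
rewrite /I (@Rintegral_affine _ x c (fun y => (1 + `|y|) `^ (- be)))//; last exact: integrable_bracket.
by rewrite c1 mul1r preimage_setT.
Qed.

Section fixed.
Variables (th : R -> R) (A : R).
Hypotheses (sth : smooth th) (A0 : 0 <= A).
Hypothesis thA : forall x, `|th x| <= A * (1 + `|x|) `^ (- be).
Hypothesis th2A : forall x, `|derive1n 2 th x| <= A * (1 + `|x|) `^ (- (be + 2)).

Let h x z := (2 * th x - th (x + z) - th (x - z)) * z `^ (- (2 + al)).

Let mh x : measurable_fun setT (h x).
Proof.
have mth : measurable_fun setT th.
  by apply: continuous_measurable; exact: smooth_continuous.
apply: measurable_funM; last exact: measurable_powR.
apply: measurable_funB; first apply: measurable_funB.
- exact: measurable_cst.
- by apply: (measurableT_comp mth); exact: measurable_funD.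
- by apply: (measurableT_comp mth); exact: measurable_funB.
Qed.

Let h_bound (x z M : R) : 0 < z ->
  (forall y, `|y - x| <= z -> `|derive1n 2 th y| <= M) -> `|h x z| <= 2 * M * z `^ (- al).
Proof.
move=> z0 HM; rewrite normrM (ger0_norm (powR_ge0 _ _)).
rewrite (_ : - al = 2%:R + - (2 + al)); last by ring.
rewrite powRD; last by rewrite (gt_eqF z0) implybT.
rewrite powR_mulrn ?(ltW z0)// mulrA ler_wpM2r ?powR_ge0//.
exact: second_diff_bound.
Qed.

Let b_ge1 (y : R) : 1 <= 1 + `|y|. Proof. by rewrite lerDl. Qed.

Let h_bound0 (x z : R) : 0 < z -> `|h x z| <= 2 * A * z `^ (- al).
Proof.
move=> z0; apply: h_bound => // y _; rewrite (le_trans (th2A y))//.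
rewrite ler_piMr// -[leRHS](powRr0 (1 + `|y|)) ler_powR// oppr_le0.
by rewrite addr_ge0// (le_trans _ (ltW be1)).
Qed.

(** The splitting radius. If |y - x| <= r x then 1 + |y| >= r x, so for small z the decay of th''
    applies at the scale of x; for larger z the kernel itself is at most (r x)^-(2+al). *)
Let r (x : R) : R := (1 + `|x|) / 2.

Let r0 x : 0 < r x. Proof. by rewrite divr_gt0// (lt_le_trans ltr01). Qed.

(** In the far region the term th x keeps the kernel to integrate, while th (x + z) and th (x - z)
    bring their own integrability and the kernel is frozen at its largest value. *)
Let Hy (x z : R) := 2 * A * (1 + `|x|) `^ (- be) * z `^ (- (2 + al)) +
  (r x `^ (- (2 + al)) * A * (1 + `|x + 1 * z|) `^ (- be) +
   r x `^ (- (2 + al)) * A * (1 + `|x + -1 * z|) `^ (- be)).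

Let h_boundr (x z : R) : 0 < z -> z <= r x ->
  `|h x z| <= 2 * (A * r x `^ (- (be + 2))) * z `^ (- al).
Proof.
move=> z0 zr; apply: h_bound => // y yz; rewrite (le_trans (th2A y))// ler_wpM2l//.
rewrite !powRN lef_pV2 ?posrE ?powR_gt0 ?r0 ?(lt_le_trans ltr01 (b_ge1 y))//.
apply: le_powR_base; [by rewrite addr_ge0// (le_trans _ (ltW be1))|exact: ltW|].
have : `|x| <= `|y - x| + `|y| by rewrite distrC -{1}(subrK y x) ler_normD.
by rewrite /r in zr *; lra.
Qed.

Let h_boundy (x z : R) : r x < z -> `|h x z| <= Hy x z.
Proof.
move=> rz; have z0 := lt_trans (r0 x) rz.
have zr : z `^ (- (2 + al)) <= r x `^ (- (2 + al)).
  rewrite !powRN lef_pV2 ?posrE ?powR_gt0//; apply: le_powR_base; [by rewrite addr_ge0// ltW|exact: ltW|exact: ltW].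
rewrite /h /Hy normrM (ger0_norm (powR_ge0 _ _)) mul1r mulN1r.
apply: (@le_trans _ _ ((2 * `|th x| + (`|th (x + z)| + `|th (x - z)|)) * z `^ (- (2 + al)))).
  rewrite ler_wpM2r ?powR_ge0// (le_trans (ler_normB _ _))// addrA lerD2r.
  by rewrite (le_trans (ler_normB _ _))// lerD2r normrM ger0_norm.
rewrite mulrDl; apply: lerD.
  by rewrite ler_wpM2r ?powR_ge0// -mulrA ler_pM2l.
rewrite mulrC -!mulrA -mulrDr; apply: ler_pM; rewrite ?powR_ge0 ?addr_ge0//.
by rewrite -mulrDr mulrDr lerD.
Qed.

Let integrable_Hy x : mu.-integrable `]r x, +oo[ (EFin \o Hy x).
Proof.
have c1 : (1 : R) != 0 by exact: oner_neq0.
have cN1 : (-1 : R) != 0 by rewrite oppr_eq0 oner_neq0.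
have i1 c : c != 0 -> mu.-integrable `]r x, +oo[ (EFin \o (fun z => (1 + `|x + c * z|) `^ (- be))).
  by move=> c0; apply: integrableS (integrable_bracket_shift x c0).
apply: integrable_add => //; last apply: integrable_add => //.
- by apply: integrable_cmul => //; apply: integrable_powR_tail => //; exact: gt12.
- by apply: integrable_cmul => //; exact: i1.
- by apply: integrable_cmul => //; exact: i1.
Qed.

Let Icut (c x : R) : `|c| = 1 ->
  \int[mu]_(z in `]r x, +oo[) (1 + `|x + c * z|) `^ (- be) <= I.
Proof.
move=> c1; have c0 : c != 0 by rewrite -normr_eq0 c1 oner_neq0.
have i := integrable_bracket_shift x c0.
rewrite -(Rintegral_bracket_shift x c1) /Rintegral fine_le//.
- apply: integrable_fin_num => //; exact: integrableS i.
- exact: integrable_fin_num.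
- by apply: ge0_subset_integral => //; case/integrableP : i.
Qed.

(** The first summand comes from z <= r x, the other two from z > r x; the factor 2^(2+al) converts
    r x into 1 + |x|. *)
Let pvK := 2 `^ (2 + al) * (2 * 2 `^ (be - 1) / (1 - al) + (1 + al)^-1 + 2 * I).

Let integrable_h0 x : mu.-integrable `]0, r x] (EFin \o h x).
Proof.
apply: (@integrable_le _ _ _ (fun z => 2 * (A * r x `^ (- (be + 2))) * z `^ (- al))) => //.
- exact: measurable_funTS (mh x).
- by apply: integrable_cmul => //; exact: integrable_powR0.
- by move=> z /=; rewrite in_itv/= => /andP[]; exact: h_boundr.
Qed.

Let integrable_hy x : mu.-integrable `]r x, +oo[ (EFin \o h x).
Proof.
apply: (@integrable_le _ _ _ (Hy x)) => //.
- exact: measurable_funTS (mh x).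
- by move=> z /=; rewrite in_itv/= andbT; exact: h_boundy.
Qed.

Lemma integrable_pv_integrand x : mu.-integrable `]0, +oo[ (EFin \o h x).
Proof.
rewrite (@itv0y_split _ (r x)) ?(ltW (r0 x))//.
by apply: integrable_setU_disj => //; exact: itv0y_disj.
Qed.

Let norm_h0 x : `|\int[mu]_(z in `]0, r x]) h x z| <=
  A * (2 * 2 `^ (be - 1) / (1 - al)) * r x `^ (- (2 + al)).
Proof.
apply: (@le_trans _ _ (\int[mu]_(z in `]0, r x])
    (2 * (A * r x `^ (- (be + 2))) * z `^ (- al)))).
  apply: normr_Rintegral_le => //.
  - exact: measurable_funTS (mh x).
  - by apply: integrable_cmul => //; exact: integrable_powR0.
  - by move=> z /=; rewrite in_itv/= => /andP[]; exact: h_boundr.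
rewrite RintegralZl//; last exact: integrable_powR0.
apply: (@le_trans _ _ (2 * (A * r x `^ (- (be + 2))) * (r x `^ (1 - al) / (1 - al)))).
  by rewrite ler_wpM2l ?mulr_ge0 ?powR_ge0// le_Rintegral_powR0.
have -> : 2 * (A * r x `^ (- (be + 2))) * (r x `^ (1 - al) / (1 - al)) =
   A * (2 * (r x `^ (- (be + 2)) * r x `^ (1 - al)) / (1 - al)) by ring.
rewrite -powRD; last by rewrite (gt_eqF (r0 x)) implybT.
(* One factor (r x)^-(2+al) is the desired decay. The remaining (r x)^(1-be) is at most 2^(be-1),
   because r x >= 1/2 and be > 1. *)
have -> : - (be + 2) + (1 - al) = (1 - be) + - (2 + al) by ring.
have -> : r x `^ (1 - be + - (2 + al)) = r x `^ (1 - be) * r x `^ (- (2 + al)).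
  by rewrite -powRD// (gt_eqF (r0 x)) implybT.
rewrite -!mulrA ler_wpM2l// ler_pM2l//.
rewrite [leRHS](_ : _ = 2 `^ (be - 1) * (r x `^ (- (2 + al)) / (1 - al))); last by ring.
rewrite ler_wpM2r//; first by rewrite divr_ge0 ?powR_ge0// subr_ge0 ltW.
rewrite -opprB powRN -[leRHS]invrK lef_pV2 ?posrE ?powR_gt0 ?invr_gt0 ?powR_gt0 ?r0//.
have -> : (2 `^ (be - 1))^-1 = 2^-1 `^ (be - 1).
  by rewrite -[in RHS]powR_inv1// -powRrM mulN1r powRN.
apply: le_powR_base; [by rewrite subr_ge0 ltW| by []|].
by rewrite /r ler_pdivlMr// mulVf.
Qed.

Let norm_hy x : `|\int[mu]_(z in `]r x, +oo[) h x z| <=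
  A * ((1 + al)^-1 + 2 * I) * r x `^ (- (2 + al)).
Proof.
apply: (@le_trans _ _ (\int[mu]_(z in `]r x, +oo[) Hy x z)).
  apply: normr_Rintegral_le => //.
  - exact: measurable_funTS (mh x).
  - by move=> z /=; rewrite in_itv/= andbT; exact: h_boundy.
have i1 (c : R) : c != 0 -> mu.-integrable `]r x, +oo[ (EFin \o (fun z => (1 + `|x + c * z|) `^ (- be))).
  by move=> c0; apply: integrableS (integrable_bracket_shift x c0).
have i2 := integrable_powR_tail gt12 (r0 x).
have N1 : `|(-1 : R)| = 1 by rewrite normrN1.
have cN1 : (-1 : R) != 0 by rewrite oppr_eq0 oner_neq0.
have c1 : (1 : R) != 0 by exact: oner_neq0.
rewrite /Hy RintegralD//; last 2 first.
- exact: integrable_cmul.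
- by apply: integrable_add => //; apply: integrable_cmul => //; exact: i1.
rewrite RintegralD//; last 2 first.
- by apply: integrable_cmul => //; exact: i1.
- by apply: integrable_cmul => //; exact: i1.
rewrite !RintegralZl//; [|exact: i1|exact: i1].
rewrite Rintegral_powR_tail ?gt12 ?r0//.
have := Icut x (normr1 R); have := Icut x N1.
set J1 := \int[mu]_(_ in _) _; set J2 := \int[mu]_(_ in _) _ => J1I J2I.
clearbody J1 J2.
set X := r x `^ (- (2 + al)).
have X0 : 0 <= X by exact: powR_ge0.
have E1 : 2 * A * (1 + `|x|) `^ (- be) * (r x `^ (1 - (2 + al)) / (2 + al - 1)) <=
   A * (1 + al)^-1 * X.
  have -> : 1 + `|x| = 2 * r x by rewrite /r mulrCA divff ?mulr1// pnatr_eq0.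
  rewrite (_ : r x `^ (1 - (2 + al)) = r x * X); last first.
    by rewrite /X powRD ?powRr1 ?(ltW (r0 x))// (gt_eqF (r0 x)) implybT.
  rewrite (_ : 2 + al - 1 = 1 + al); last by ring.
  rewrite [leLHS](_ : _ = (2 * r x * (2 * r x) `^ (- be)) * (A * (1 + al)^-1 * X)); last by ring.
  rewrite ler_piMl//.
    by rewrite !mulr_ge0// invr_ge0 addr_ge0// ltW.
  have p : 0 < 2 * r x by rewrite mulr_gt0 ?r0.
  rewrite -{1}(powRr1 (ltW p)) -powRD; last by rewrite (gt_eqF p) implybT.
  rewrite -[leRHS](powRr0 (2 * r x)) ler_powR//.
    by rewrite /r mulrCA divff ?mulr1 ?b_ge1// pnatr_eq0.
  by rewrite subr_le0 ltW.
rewrite [leRHS](_ : _ = A * (1 + al)^-1 * X + (X * A * I + X * A * I)); last by ring.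
have XA := mulr_ge0 X0 A0.
apply: lerD; first exact: E1.
exact: (lerD (ler_wpM2l XA J2I) (ler_wpM2l XA J1I)).
Qed.

Lemma pv_integral_bound x :
  `|pv_integral (2 + al) th x| <= pvK * A * (1 + `|x|) `^ (- (2 + al)).
Proof.
rewrite /pv_integral (@itv0y_split _ (r x)) ?(ltW (r0 x))// Rintegral_setU//; last 2 first.
- rewrite -itv0y_split ?(ltW (r0 x))//; exact: integrable_pv_integrand.
- exact: itv0y_disj.
rewrite (le_trans (ler_normD _ _))// (le_trans (lerD (norm_h0 x) (norm_hy x)))//.
have -> : r x `^ (- (2 + al)) = 2 `^ (2 + al) * (1 + `|x|) `^ (- (2 + al)).
  rewrite /r powRM ?invr_ge0 ?(le_trans ler01 (b_ge1 x))// mulrC; congr (_ * _).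
  by rewrite -powR_inv1// -powRrM mulrNN mul1r.
by rewrite le_eqVlt /pvK; apply/orP; left; apply/eqP; ring.
Qed.

Lemma pv_trunc_cvg x : pv_trunc (2 + al) d th x @[d --> 0^'+] --> pv_integral (2 + al) th x.
Proof.
apply: (@cvg0_powR_bound _ _ _ (2 * A / (1 - al)) (1 - al)); first by rewrite subr_gt0.
move=> d d0; rewrite /pv_integral /pv_trunc (@itv0y_split _ d) ?(ltW d0)// Rintegral_setU//; last 2 first.
- rewrite -itv0y_split ?(ltW d0)//; exact: integrable_pv_integrand.
- exact: itv0y_disj.
rewrite addrC opprD addrNK normrN.
apply: (@le_trans _ _ (\int[mu]_(z in `]0, d]) (2 * A * z `^ (- al)))).
  apply: normr_Rintegral_le => //.
  - exact: measurable_funTS (mh x).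
  - by apply: integrable_cmul => //; exact: integrable_powR0.
  - by move=> z /=; rewrite in_itv/= => /andP[z0 _]; exact: h_bound0.
rewrite RintegralZl//; last exact: integrable_powR0.
rewrite [leRHS](_ : _ = 2 * A * (d `^ (1 - al) / (1 - al))); last by ring.
by rewrite ler_wpM2l ?mulr_ge0// le_Rintegral_powR0.
Qed.

End fixed.

(** The constant depends neither on th nor on A, so smallness of A is inherited by the integral. For
    every be > 1 the resulting decay is (1+|x|)^-(2+al), the weight of L_s when 2s = 1 + al. *)
Lemma pv_bound_const : exists2 K : R, 0 <= K &
  forall th A, smooth th -> 0 <= A ->
  (forall x, `|th x| <= A * (1 + `|x|) `^ (- be)) ->
  (forall x, `|derive1n 2 th x| <= A * (1 + `|x|) `^ (- (be + 2))) ->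
  forall x, `|pv_integral (2 + al) th x| <= K * A * (1 + `|x|) `^ (- (2 + al)) /\
    pv_trunc (2 + al) d th x @[d --> 0^'+] --> pv_integral (2 + al) th x.
Proof.
eexists; last first.
  move=> th A sth A0 thA th2A x; split; first exact: pv_integral_bound.
  exact: pv_trunc_cvg thA th2A _.
have I0 : 0 <= I by apply: Rintegral_ge0 => y _; exact: powR_ge0.
by rewrite mulr_ge0 ?powR_ge0// !addr_ge0 ?mulr_ge0 ?invr_ge0 ?powR_ge0 ?subr_ge0 ?addr_ge0// ltW.
Qed.

End pv_weighted_bound.

(** * The fractional Laplacian as a folded integral *)

Section fracLap_pv.
Context {R : realType}.
Local Notation mu := (@lebesgue_measure R).
Implicit Types (th : R -> R).

Lemma pv_half_integrable (p d M c x : R) th : 1 < p -> 0 < d ->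
  measurable_fun setT th -> (forall y, `|th y| <= M) ->
  mu.-integrable `]d, +oo[ (EFin \o (fun z => (th x - th (x + c * z)) * z `^ (- p))).
Proof.
move=> p1 d0 mth thM.
apply: (@integrable_le _ _ _ (fun z => 2 * M * z `^ (- p))) => //.
- apply: measurable_funTS; apply: measurable_funM; last exact: measurable_powR.
  apply: measurable_funB; first exact: measurable_cst.
  by apply: (measurableT_comp mth); exact: measurable_affine.
- by apply: integrable_cmul => //; exact: integrable_powR_tail.
- move=> z _; rewrite normrM (ger0_norm (powR_ge0 _ _)) ler_wpM2r ?powR_ge0//.
  by rewrite (le_trans (ler_normB _ _))// mulrDl mul1r lerD.
Qed.

(** The hypothesis on c means c = 1 or c = -1, and D is the half line c (y - x) > d; the
    substitution is y = x + c z. *)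
Lemma pv_half (p d M c x : R) th : 1 < p -> 0 < d -> c ^+ 2 = 1 ->
  measurable_fun setT th -> (forall y, `|th y| <= M) ->
  let D := (fun y => - (c * x) + c * y) @^-1` `]d, +oo[%classic in
  mu.-integrable D (EFin \o (fun y => (th x - th y) / `|x - y| `^ p)) /\
  \int[mu]_(y in D) ((th x - th y) / `|x - y| `^ p) =
  \int[mu]_(z in `]d, +oo[) ((th x - th (x + c * z)) * z `^ (- p)).
Proof.
move=> p1 d0 c2 mth thM D.
have ih := pv_half_integrable c x p1 d0 mth thM.
have c0 : c != 0 by apply/eqP => c0; move: c2; rewrite c0 expr0n/= => /eqP; rewrite eq_sym oner_eq0.
have nc : `|c| = 1.
  by apply/eqP; rewrite -sqrp_eq1// -normrX c2 normr1.
have := integrable_affine (- (c * x)) c0 (measurable_itv _) ih.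
rewrite -/D => iD.
have E y : D y -> (th x - th (x + c * (- (c * x) + c * y))) * (- (c * x) + c * y) `^ (- p) =
   (th x - th y) / `|x - y| `^ p.
  rewrite /D /= in_itv/= andbT => dy.
  have -> : x + c * (- (c * x) + c * y) = x + c ^+ 2 * (y - x) by ring.
  rewrite c2 mul1r (addrC x (y - x)) subrK powRN; congr (_ / _ `^ _).
  rewrite -[LHS]gtr0_norm ?(lt_trans d0)//.
  by rewrite (_ : - (c * x) + c * y = c * (y - x)) ?normrM ?nc ?mul1r 1?distrC//; ring.
have mD : measurable D by exact: measurable_preimage_affine.
split; first exact: integrable_eq iD.
rewrite (@Rintegral_affine _ (- (c * x)) c _ _ c0 _ ih)// nc mul1r -/D.
by apply: Rintegral_congr_in => y Dy; rewrite E.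
Qed.

Lemma pv_truncE (p d M x : R) th : 1 < p -> 0 < d ->
  measurable_fun setT th -> (forall y, `|th y| <= M) ->
  \int[mu]_(y in [set y | d < `|x - y|]) ((th x - th y) / `|x - y| `^ p) =
  pv_trunc p d th x.
Proof.
move=> p1 d0 mth thM.
have [i1 e1] := pv_half x p1 d0 (expr1n _ 2) mth thM.
have [i2 e2] := pv_half x p1 d0 (etrans (sqrrN 1) (expr1n _ 2)) mth thM.
set D1 := _ @^-1` _ in i1 e1; set D2 := _ @^-1` _ in i2 e2.
have m1 : measurable D1 by exact: measurable_preimage_affine.
have m2 : measurable D2 by exact: measurable_preimage_affine.
have -> : [set y | d < `|x - y|] = D1 `|` D2.
  apply/seteqP; split => y; rewrite /D1 /D2/= !in_itv/= !andbT !mul1r !mulN1r opprK distrC.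
    by rewrite lter_normr => /orP[h|h]; [left|right]; lra.
  by case=> h; rewrite lter_normr; apply/orP; [left|right]; lra.
have disj : [disjoint D1 & D2].
  apply/disj_setPS => y []; rewrite /D1 /D2/= !in_itv/= !andbT !mul1r !mulN1r opprK.
  by move=> h1 h2; lra.
have mf : measurable_fun setT (fun y => (th x - th y) / `|x - y| `^ p).
  apply: measurable_funM.
    by apply: measurable_funB => //; exact: measurable_cst.
  rewrite (_ : (fun y => _) = (fun y => `|x - y| `^ (- p))); last first.
    by apply/funext => y; rewrite powRN.
  apply: (measurableT_comp (f := fun z : R => z `^ (- p))).
    exact: measurable_powR.
  apply: measurableT_comp; last exact: measurable_funB.
  by apply: continuous_measurable; exact: norm_continuous.
rewrite Rintegral_setU//; last exact: integrable_setU_disj.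
rewrite e1 e2 -RintegralD//; last 2 first.
- exact: pv_half_integrable thM.
- exact: pv_half_integrable thM.
by apply: Rintegral_congr => z; rewrite mul1r mulN1r; ring.
Qed.

(** [fracLap] is defined by a [lim], which carries information only once convergence is known;
    boundedness of th is what allows each truncated integral to be split in two and folded. *)
Lemma fracLapE (s M x l : R) th : 2^-1 < s ->
  measurable_fun setT th -> (forall y, `|th y| <= M) ->
  pv_trunc (1 + 2 * s) d th x @[d --> 0^'+] --> l ->
  fracLap s th x = fracLap_const s * l.
Proof.
move=> s2 mth thM cl; rewrite /fracLap; congr (_ * _).
apply: cvg_lim => //; apply: cvg_trans cl; apply: near_eq_cvg; near=> d.
by rewrite (@pv_truncE _ _ M)//; lra.
Unshelve. all: by end_near. Qed.

Lemma pv_trunc_integrable (p d M x : R) th : 1 < p -> 0 < d ->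
  measurable_fun setT th -> (forall y, `|th y| <= M) ->
  mu.-integrable `]d, +oo[ (EFin \o (fun z => (2 * th x - th (x + z) - th (x - z)) * z `^ (- p))).
Proof.
move=> p1 d0 mth thM.
have i1 := pv_half_integrable 1 x p1 d0 mth thM.
have i2 := pv_half_integrable (-1) x p1 d0 mth thM.
apply: integrable_eq (integrable_add _ i1 i2) => // z _.
by rewrite mul1r mulN1r; ring.
Qed.

Lemma pv_truncB (p d M1 M2 x : R) th1 th2 : 1 < p -> 0 < d ->
  measurable_fun setT th1 -> (forall y, `|th1 y| <= M1) ->
  measurable_fun setT th2 -> (forall y, `|th2 y| <= M2) ->
  pv_trunc p d (fun y => th1 y - th2 y) x = pv_trunc p d th1 x - pv_trunc p d th2 x.
Proof.
move=> p1 d0 m1 b1 m2 b2; rewrite /pv_trunc -RintegralB//; last 2 first.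
- exact: pv_trunc_integrable b1.
- exact: pv_trunc_integrable b2.
by apply: Rintegral_congr => z; ring.
Qed.

(** Measurability in x is read off from Fubini. The weight (1+|x|)^-2 makes the two-variable
    integrand integrable and is divided out at the end. *)
Lemma measurable_pv_trunc (p d M : R) th : 1 < p -> 0 < d ->
  measurable_fun setT th -> (forall y, `|th y| <= M) ->
  measurable_fun setT (pv_trunc p d th).
Proof.
move=> p1 d0 mth thM.
pose T := measurableTypeR R.
have M0 : 0 <= M by apply: le_trans (thM 0).
pose w (x : R) := (1 + `|x|) `^ (- 2).
pose c (z : R) := if d < z then z `^ (- p) else 0.
have mc : measurable_fun setT c.
  rewrite (_ : c = (fun z : R => z `^ (- p)) \_ `]d, +oo[%classic).
    apply/(measurable_restrictT _ _).1 => //; apply: measurable_funTS.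
    exact: measurable_powR.
  by apply/funext => z; rewrite /patch mem_setE in_itv/= andbT.
have ic : mu.-integrable setT (EFin \o c).
  apply: (@integrable_supp _ _ `]d, +oo[%classic) => //.
    apply: (@integrable_eq _ _ _ (fun z => z `^ (- p))) => //; last exact: integrable_powR_tail.
    by move=> z /=; rewrite in_itv/= andbT /c => ->.
  by move=> z /=; rewrite in_itv/= andbT /c => /negP/negbTE ->.
have gt12 : (1 : R) < 2 by rewrite ltr1n.
have iw := integrable_bracket gt12.
have mw : measurable_fun setT w by exact: integrable_measurable iw.
pose F (x z : R) := w x * (2 * th x - th (x + z) - th (x - z)) * c z.
have mF : measurable_fun (setT : set (T * T)) (fun q : T * T => F q.1 q.2).
  have mf : measurable_fun (setT : set (T * T)) (fun q : T * T => q.1 : R).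
    exact: measurable_fst.
  have ms : measurable_fun (setT : set (T * T)) (fun q : T * T => q.2 : R).
    exact: measurable_snd.
  apply: measurable_funM; first apply: measurable_funM.
  - exact: (measurableT_comp mw).
  - apply: measurable_funB; first apply: measurable_funB.
    + by apply: measurable_funM => //; exact: (measurableT_comp mth).
    + by apply: (measurableT_comp mth); exact: measurable_funD.
    + by apply: (measurableT_comp mth); exact: measurable_funB.
  - exact: (measurableT_comp mc).
have Fb x z : `|F x z| <= (4 * M * w x) * c z.
  have c0 : 0 <= c z by rewrite /c; case: ifP => // _; exact: powR_ge0.
  rewrite /F !normrM (ger0_norm c0) ler_wpM2r//.
  rewrite (ger0_norm (powR_ge0 _ _)) mulrC ler_wpM2r ?powR_ge0//.
  have h1 := thM x; have h2 := thM (x + z); have h3 := thM (x - z).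
  rewrite (le_trans (ler_normB _ _))//.
  have := ler_normB (2 * th x) (th (x + z)); rewrite normrM ger0_norm//; lra.
have iw4 : mu.-integrable setT (EFin \o (fun x => 4 * M * w x)) by exact: integrable_cmul.
have := integrable_fubini mF iw4 ic Fb.
move=> /integrable_measurable mI.
have -> : pv_trunc p d th = fun x => (1 + `|x|) `^ 2 * \int[mu]_z F x z.
  apply/funext => x.
  rewrite (@Rintegral_supp _ _ `]d, +oo[%classic); last first.
    by move=> z /=; rewrite in_itv/= andbT /F /c => /negP/negbTE ->; rewrite mulr0.
  have -> : \int[mu]_(z in `]d, +oo[) F x z = w x * pv_trunc p d th x.
    rewrite /pv_trunc -RintegralZl//; last exact: pv_trunc_integrable thM.
    apply: Rintegral_congr_in => z /=; rewrite in_itv/= andbT /F /c => ->.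
    by rewrite mulrA.
  have x0 : 0 < 1 + `|x| by rewrite ltr_wpDr.
  by rewrite mulrA /w powRN divff ?mul1r// gt_eqF// powR_gt0.
apply: measurable_funM => //.
apply: (measurableT_comp (f := fun z : R => z `^ 2)); first exact: measurable_powR.
apply: measurable_funD; first exact: measurable_cst.
by apply: continuous_measurable; exact: norm_continuous.
Qed.

Lemma measurable_pv_integral (p M : R) th : 1 < p ->
  measurable_fun setT th -> (forall y, `|th y| <= M) ->
  (forall x, pv_trunc p d th x @[d --> 0^'+] --> pv_integral p th x) ->
  measurable_fun setT (pv_integral p th).
Proof.
move=> p1 mth thM cv.
apply: (@measurable_fun_cvg _ _ _ _ (fun n x => pv_trunc p (n.+1%:R^-1) th x)).
- move=> n; apply: measurable_pv_trunc thM => //.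
- move=> x _.
  have /cvg_at_rightP := cv x; apply; split => //.
  exact: cvg_harmonic.
Qed.

End fracLap_pv.

(** * Cutoffs and the weak identity *)

Section cutoff.
Context {R : realType}.

(** Normalised to equal 1 at the origin only, not on a ball. Hence [cocutoff] is small on bounded
    sets for large r but need not vanish there; [cocutoff_bounds] quantifies this. *)
Definition cutoff (r x : R) : R := (bump 0)^-1 * bump (0 + r^-1 * x).

Lemma bump0_gt0 : 0 < bump (0 : R).
Proof.
apply: lt_le_trans (expR_gt0 _) (bump_ge _).
by rewrite normr0 invr_ge0.
Qed.

Lemma test_cutoff (r : R) : 0 < r -> test_function (cutoff r).
Proof.
move=> r0; have : test_function (fun x : R => bump (0 + r^-1 * x)).
  by apply: test_affine_comp; [rewrite invr_neq0// gt_eqF|exact: test_bump].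
move=> /test_functionP[sb [B B0 bB]]; apply/test_functionP; split.
  exact: smoothZ.
by exists B => // x xB; rewrite /cutoff bB// mulr0.
Qed.

Definition cocutoff (r x : R) : R := 1 + (-1) * cutoff r x.

Lemma smooth_cocutoff (r : R) : 0 < r -> smooth (cocutoff r).
Proof.
move=> r0; apply: smoothD; first exact: smooth_cst.
by apply: smoothZ; exact/test_smooth/test_cutoff.
Qed.

Lemma derive1_affine_compZ (a e c : R) (f : R -> R) : smooth f ->
  derive1 (fun x => e + a * f (0 + c * x)) = fun x => a * c * derive1 f (0 + c * x).
Proof.
move=> sf; apply/funext => x; rewrite derive1E.
have d : is_derive x 1 (fun x => f (0 + c * x)) (c * derive1 f (0 + c * x)).
  by apply: is_derive_affine_comp; exact: smooth_is_derive.
have [_ D] := is_deriveD (is_derive_cst e x 1) (is_deriveZ a d).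
by rewrite -[LHS]/('D_1 (cst e + a *: (fun x => f (0 + c * x))) x) D add0r /GRing.scale/= mulrA.
Qed.

Lemma derive1_cocutoff (r : R) :
  derive1 (cocutoff r) = fun x => (- (bump 0)^-1) * r^-1 * derive1 bump (0 + r^-1 * x).
Proof.
have -> : cocutoff r = fun x => 1 + (- (bump 0)^-1) * bump (0 + r^-1 * x).
  by apply/funext => x; rewrite /cocutoff /cutoff mulN1r mulNr.
by rewrite derive1_affine_compZ//; exact: test_smooth test_bump.
Qed.

Lemma derive2_cocutoff (r : R) :
  derive1n 2 (cocutoff r) = fun x => (- (bump 0)^-1) * r^-1 * r^-1 * derive1n 2 bump (0 + r^-1 * x).
Proof.
rewrite -[derive1n 2 _]/(derive1 (derive1 (cocutoff r))) derive1_cocutoff.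
rewrite (_ : (fun x => _) = fun x => 0 + (- (bump 0)^-1) * r^-1 * derive1 bump (0 + r^-1 * x)); last first.
  by apply/funext => x; rewrite [RHS]add0r.
by rewrite derive1_affine_compZ//; apply: smooth_derive1; exact: test_smooth test_bump.
Qed.

Lemma min1_le_powR (g t : R) : 0 <= g -> g <= 1 -> 0 <= t -> Num.min 1 t <= t `^ g.
Proof.
move=> g0 g1 t0; have [t1|t1] := leP 1 t.
  by have := le_powR_base g0 ler01 t1; rewrite powR1.
move: t0; rewrite le_eqVlt => /predU1P[<-|t0]; first exact: powR_ge0.
by apply: ger1_powR => //; rewrite t0 ltW.
Qed.

(** Smallness r^-g is bought with growth (1+|x|)^g. The value is Lipschitz at scale r and bounded,
    hence controlled by min(1, |x|/r) <= (|x|/r)^g; each derivative then gains one power of 1 +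
    |x|. *)
Lemma cocutoff_bounds (g : R) : 0 < g -> g < 1 ->
  exists2 C : R, 0 <= C & forall r x, 1 <= r ->
  [/\ `|cocutoff r x| <= C * r `^ (- g) * (1 + `|x|) `^ g,
      `|derive1 (cocutoff r) x| <= C * r `^ (- g) * (1 + `|x|) `^ (g - 1) &
      `|derive1n 2 (cocutoff r) x| <= C * r `^ (- g) * (1 + `|x|) `^ (g - 2)].
Proof.
move=> g0 g1; have tb := @test_bump R.
have [B B0 bB] := test_support tb.
have [M0 M00 b0M] := test_bounded tb.
have [M1 M10 b1M] := test_bounded (test_derive1 tb).
have [M2 M20 b2M] := test_bounded (test_derive1n 2 tb).
pose c := (bump (0 : R))^-1.
have c0 : 0 < c by rewrite invr_gt0 bump0_gt0.
pose C0 := c * (2 * M0 + M1).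
pose Ck (k : nat) M := c * M * (1 + B) `^ (k%:R - g).
have C00 : 0 <= C0 by rewrite mulr_ge0 ?addr_ge0 ?mulr_ge0 ?ltW.
have Ck0 k M : 0 < M -> 0 <= Ck k M.
  by move=> Mp; rewrite !mulr_ge0 ?powR_ge0 ?ltW.
have B1 : 0 < 1 + B by rewrite addr_gt0.
exists (C0 + Ck 1%N M1 + Ck 2%N M2); first by rewrite !addr_ge0// Ck0.
move=> r x r1; have r0 := lt_le_trans ltr01 r1.
have x1 : 0 < 1 + `|x| by rewrite ltr_wpDr.
have W e D E F : 0 <= e -> 0 <= D -> 0 <= E -> E <= F ->
    e * D * E <= e * D * F :> R.
  by move=> e0 D0 E0 EF; rewrite ler_wpM2l// mulr_ge0.
have mono (C C' t q : R) : C <= C' -> t <= C * r `^ (- g) * (1 + `|x|) `^ q ->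
    t <= C' * r `^ (- g) * (1 + `|x|) `^ q.
  by move=> CC' /le_trans; apply; rewrite ler_wpM2r ?powR_ge0// ler_wpM2r ?powR_ge0.
have key (k : nat) (M : R) : 0 < M -> (1 <= k)%N -> (forall t, `|derive1n k bump t| <= M) ->
    c * r^-1 ^+ k * `|derive1n k bump (0 + r^-1 * x)| <=
    Ck k M * r `^ (- g) * (1 + `|x|) `^ (g - k%:R).
  move=> Mp k1 kM; have gk : g - k%:R <= 0.
    by rewrite subr_le0 (le_trans (ltW g1))// (_ : 1 = 1%:R)// ler_nat.
  (* Beyond B r the derivatives vanish; inside, r >= 1 gives 1 + |x| <= (1 + B) r, which trades
     surplus powers of r for powers of 1 + |x|. *)
  have [xB|xB] := leP (B * r) `|x|.
    rewrite bB; last by rewrite add0r normrM gtr0_norm ?invr_gt0// mulrC ler_pdivlMr.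
    by rewrite normr0 mulr0; apply: mulr_ge0 (powR_ge0 _ _); apply: mulr_ge0 (powR_ge0 _ _); exact: Ck0.
  apply: (@le_trans _ _ (c * M * r^-1 ^+ k)).
    rewrite [leRHS]mulrAC; apply: ler_wpM2l (kM _).
    by rewrite mulr_ge0 ?(ltW c0)// exprn_ge0// invr_ge0 ltW.
  rewrite /Ck -!mulrA ler_wpM2l ?(ltW c0)// ler_wpM2l ?(ltW Mp)//.
  have -> : r^-1 ^+ k = r `^ (- g) * r `^ (g - k%:R).
    rewrite -powRD; last by rewrite (gt_eqF r0) implybT.
    by rewrite addrA addNr add0r powRN powR_mulrn ?ltW// exprVn.
  rewrite mulrCA ler_wpM2l ?powR_ge0//.
  have -> : k%:R - g = - (g - k%:R) by rewrite opprB.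
  rewrite (_ : g - k%:R = - (k%:R - g)); last by rewrite opprB.
  rewrite opprK !powRN ler_pdivlMr ?powR_gt0// mulrC ler_pdivrMr ?powR_gt0//.
  rewrite -powRM ?(ltW B1) ?(ltW r0)//; apply: le_powR_base; [by rewrite -oppr_le0 opprB|exact: ltW|].
  by rewrite mulrDl mul1r lerD// ltW.
split.
- apply: (mono C0); first by rewrite -addrA lerDl addr_ge0// Ck0.
  pose t := r^-1 * x.
  have E : cocutoff r x = c * (bump 0 - bump t).
    by rewrite /cocutoff /cutoff -/c add0r mulrBr mulVf ?gt_eqF ?bump0_gt0// mulN1r.
  have Lip : `|bump 0 - bump t| <= M1 * `|t|.
    have sb := test_smooth tb.
    have [t0|t0|->] := ltgtP t 0.
    - have [e _ ->] := smooth_MVT sb t0.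
      by rewrite sub0r normrM normrN ler_wpM2r.
    - have [e _ Ee] := smooth_MVT sb t0.
      by rewrite distrC Ee subr0 normrM ler_wpM2r.
    - by rewrite subrr normr0 mulr0.
  have Mt : `|bump 0 - bump t| <= (2 * M0 + M1) * Num.min 1 `|t|.
    have [t1|t1] := leP 1 `|t|.
      rewrite mulr1 (le_trans (ler_normB _ _))//.
      by have := b0M 0; have := b0M t; have := ltW M10; lra.
    rewrite (le_trans Lip)// ler_wpM2r// lerDr mulr_ge0// ltW//.
  rewrite E normrM (gtr0_norm c0) /C0 -!mulrA ler_wpM2l ?(ltW c0)//.
  rewrite (le_trans Mt)// ler_wpM2l ?addr_ge0 ?mulr_ge0 ?(ltW M00) ?(ltW M10)//.
  rewrite (le_trans (min1_le_powR (ltW g0) (ltW g1) (normr_ge0 _)))//.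
  have -> : r `^ (- g) = r^-1 `^ g by rewrite -[in RHS]powR_inv1 ?(ltW r0)// -powRrM mulN1r.
  rewrite -powRM ?invr_ge0 ?(ltW r0) ?(ltW x1)//; apply: le_powR_base; [exact: ltW|by []|].
  rewrite /t normrM gtr0_norm ?invr_gt0// ler_wpM2l ?invr_ge0 ?(ltW r0)//.
  by rewrite lerDr.
- apply: (mono (Ck 1%N M1)); first by rewrite addrAC lerDr addr_ge0// Ck0.
  rewrite derive1_cocutoff !normrM normrN (gtr0_norm c0) (gtr0_norm (_ : 0 < r^-1)) ?invr_gt0//.
  exact: (key 1%N M1).
- apply: (mono (Ck 2%N M2)); first by rewrite lerDr addr_ge0// Ck0.
  rewrite derive2_cocutoff !normrM normrN (gtr0_norm c0) (gtr0_norm (_ : 0 < r^-1)) ?invr_gt0//.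
  have := key 2%N M2 M20 isT b2M.
  by rewrite expr2 mulrA.
Qed.

Lemma derive2M (f h : R -> R) (x : R) : smooth f -> smooth h ->
  derive1n 2 (fun x => f x * h x) x =
  derive1n 2 f x * h x + 2 * (derive1 f x * derive1 h x) + f x * derive1n 2 h x.
Proof.
have H (f' h' : R -> R) : smooth f' -> smooth h' ->
    derive1 (fun x => f' x * h' x) = fun x => f' x * derive1 h' x + h' x * derive1 f' x.
  move=> sf sh; apply/funext => y; rewrite derive1E.
  by have [_ ->] := is_deriveM (smooth_is_derive y sf) (smooth_is_derive y sh).
move=> sf sh; rewrite -[derive1n 2 _]/(derive1 (derive1 (fun x => f x * h x))) (H _ _ sf sh).
have s1 : smooth (fun x => f x * derive1 h x) by exact: smoothM sf (smooth_derive1 sh).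
have s2 : smooth (fun x => h x * derive1 f x) by exact: smoothM sh (smooth_derive1 sf).
rewrite derive1E.
have [_ ->] := is_deriveD (smooth_is_derive x s1) (smooth_is_derive x s2).
rewrite (H _ _ sf (smooth_derive1 sh)) (H _ _ sh (smooth_derive1 sf)).
rewrite -[derive1n 2 f]/(derive1 (derive1 f)) -[derive1n 2 h]/(derive1 (derive1 h)).
move: (derive1 (derive1 h) x) (derive1 (derive1 f) x) (derive1 h x) (derive1 f x) (f x) (h x).
by move=> a b c d e k; ring.
Qed.

End cutoff.

Section weak_identity.
Context {R : realType} (al s : R).
Hypotheses (al0 : 0 < al) (al1 : al < 1) (als : 2 * s = 1 + al).
Local Notation mu := (@lebesgue_measure R).
(* The potential decays like (1+|x|)^(al-2), which exceeds integrability by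
   1 - al. Half of this excess, g, is spent on a factor r^-g from the cutoff, and
   the rest keeps the decay exponent be > 1. *)
Let g := (1 - al) / 2.
Let be := (3 - al) / 2.

Let gE : [/\ 0 < g, g < 1 & 1 < be].
Proof. by have := al0; have := al1; rewrite /g /be; split; lra. Qed.

Lemma potential_decay (rho : R -> R) (k : nat) : test_function rho ->
  exists2 C : R, 0 <= C & forall x,
  `|derive1n k (conv (spow al) (derive1n 3 rho)) x| <= C * (1 + `|x|) `^ (al - 2 - k%:R).
Proof.
move=> tp; have k3 : (2 <= k + 3)%N by rewrite addn3.
have [C C0 H] := conv_spow_decay al0 al1 tp k3.
exists C => // x.
rewrite derive1n_conv; last 2 first.
- exact: spow_locally_integrable al0.
- exact: test_derive1n.
have -> : derive1n k (derive1n 3 rho) = derive1n (k + 3) rho.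
  by rewrite /derive1n iterD.
have -> : al - 2 - k%:R = 1 + al - (k + 3)%:R by rewrite natrD; ring.
exact: H.
Qed.

(** A derivative gains one power of 1 + |x| whichever factor it falls on, so the three Leibniz terms
    share the exponent al - 4 + g = -(be + 2). *)
Lemma potential_tail (rho : R -> R) : test_function rho ->
  let phi := conv (spow al) (derive1n 3 rho) in
  exists2 C : R, 0 <= C & forall r x, 1 <= r ->
  `|phi x * cocutoff r x| <= C * r `^ (- g) * (1 + `|x|) `^ (- be) /\
  `|derive1n 2 (fun x => phi x * cocutoff r x) x| <=
    C * r `^ (- g) * (1 + `|x|) `^ (- (be + 2)).
Proof.
move=> tp phi; have [g0 g1 _] := gE.
have [C0 C00 H0] := potential_decay 0 tp; have [C1 C10 H1] := potential_decay 1 tp.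
have [C2 C20 H2] := potential_decay 2 tp; have [D D0 HD] := @cocutoff_bounds R g g0 g1.
have sphi : smooth phi by exact: smooth_conv (spow_locally_integrable al0) (test_derive1n 3 tp).
rewrite -/phi in H0 H1 H2.
have mulb (a c A E p q p' x : R) : 0 <= A -> `|a| <= A * (1 + `|x|) `^ p ->
    `|c| <= E * (1 + `|x|) `^ q -> p + q = p' -> `|a * c| <= A * E * (1 + `|x|) `^ p'.
  move=> A0 ha hc <-; rewrite normrM powRD; last first.
      by rewrite (gt_eqF (_ : 0 < 1 + `|x|)) ?implybT// ltr_pwDl.
    by rewrite mulrACA ler_pM.
exists ((C0 + 2 * C1 + C2) * D) => [|r x r1]; first by rewrite mulr_ge0// !addr_ge0// mulr_ge0.
have [h0 h1 h2] := HD r x r1.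
have r0 : 0 < r by lra.
have rg := powR_ge0 r (- g).
have bp p := powR_ge0 (1 + `|x|) p.
have wk A B p : 0 <= A -> A <= B -> A * (D * r `^ (- g)) * (1 + `|x|) `^ p <=
    B * D * r `^ (- g) * (1 + `|x|) `^ p.
  by move=> A0 AB; rewrite ler_wpM2r// -mulrA ler_wpM2r// mulr_ge0.
split.
  apply: le_trans (wk C0 _ (- be) C00 _); last by rewrite -addrA lerDl addr_ge0// mulr_ge0.
  by apply: (mulb _ _ _ _ _ _ _ _ C00 (H0 x) h0); rewrite /g /be; lra.
rewrite (derive2M x sphi (smooth_cocutoff r0)).
have e0 := mulb _ _ _ _ _ _ (- (be + 2)) _ C00 (H0 x) h2 ltac:(rewrite /g /be; lra).
have e1 := mulb _ _ _ _ _ _ (- (be + 2)) _ C10 (H1 x) h1 ltac:(rewrite /g /be; lra).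
have p2 : al - 2 - 2 + g = - (be + 2) by rewrite /g /be; field.
have e2 := mulb _ _ _ _ _ _ _ _ C20 (H2 x) h0 p2.
rewrite derive1n0 derive1n1 in e0 e1.
apply: le_trans (ler_normD _ _) _; apply: le_trans (lerD (ler_normD _ _) (lexx _)) _.
rewrite (normrM 2) ger0_norm//.
have -> : (C0 + 2 * C1 + C2) * D * r `^ (- g) * (1 + `|x|) `^ (- (be + 2)) =
  C2 * (D * r `^ (- g)) * (1 + `|x|) `^ (- (be + 2)) +
  2 * (C1 * (D * r `^ (- g)) * (1 + `|x|) `^ (- (be + 2))) +
  C0 * (D * r `^ (- g)) * (1 + `|x|) `^ (- (be + 2)) by ring.
by rewrite !lerD// ler_pM2l.
Qed.

(* G is the principal-value integral of the discarded tail of phi. *)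
Lemma fracLap_cutoff_potential (rho : R -> R) : test_function rho ->
  let phi := conv (spow al) (derive1n 3 rho) in
  exists2 C : R, 0 <= C & forall r, 1 <= r -> exists G : R -> R,
  [/\ measurable_fun setT G,
      forall x, `|G x| <= C * r `^ (- g) * (1 + `|x|) `^ (- (2 + al)),
      forall x, fracLap s (fun x => phi x * cutoff r x) x =
        fracLap_const s * (2 * spow_const al * derive1n 2 rho x - G x),
      forall x, `|phi x - phi x * cutoff r x| <= C * r `^ (- g) &
      test_function (fun x => phi x * cutoff r x)].
Proof.
move=> tp phi; have [g0 g1 b1] := gE.
have [C C0 H] := potential_tail tp; have [K K0 HK] := pv_bound_const al0 al1 b1.
have lg := spow_locally_integrable al0.
have t3 := test_derive1n 3 tp.
have sphi : smooth phi by exact: smooth_conv lg t3.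
have [D D0 HD] := potential_decay 0 tp; rewrite -/phi derive1n0 in H HD.
have mphi : measurable_fun setT phi.
  by apply: continuous_measurable; exact: smooth_continuous sphi.
have al2 : 1 < 2 + al by have := al0; lra.
have br1 p (x : R) : 0 <= p -> (1 + `|x|) `^ (- p) <= 1.
  move=> p0; rewrite -[leRHS](powRr0 (1 + `|x|)) ler_powR ?lerDl//; lra.
have phib x : `|phi x| <= D.
  apply: le_trans (HD x) _; rewrite -[leRHS]mulr1 ler_wpM2l// -[X in _ `^ X]opprK br1//.
  have := al1; lra.
exists (K * C + C) => [|r r1]; first by rewrite addr_ge0// mulr_ge0.
have r0 : 0 < r by lra.
have rg := powR_ge0 r (- g).
pose th x := phi x * cocutoff r x.
have sth : smooth th by exact: smoothM sphi (smooth_cocutoff r0).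
have A0 : 0 <= C * r `^ (- g) by rewrite mulr_ge0.
have [th1 th2] : (forall x, `|th x| <= C * r `^ (- g) * (1 + `|x|) `^ (- be)) /\
  (forall x, `|derive1n 2 th x| <= C * r `^ (- g) * (1 + `|x|) `^ (- (be + 2))).
  by split=> x; have [] := H r x r1.
have bd x : `|th x| <= C * r `^ (- g).
  by apply: le_trans (th1 x) _; rewrite -[leRHS]mulr1 ler_wpM2l// br1// (le_trans _ (ltW b1)).
have mth : measurable_fun setT th.
  by apply: continuous_measurable; exact: smooth_continuous sth.
have HG := HK th _ sth A0 th1 th2.
have pE (x : R) : phi x * cutoff r x = phi x - th x by rewrite /th /cocutoff; ring.
have pF : (fun x => phi x * cutoff r x) = (fun x => phi x - th x) by apply/funext.
exists (pv_integral (2 + al) th); split.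
- by apply: measurable_pv_integral bd _ => // x; have [] := HG x.
- move=> x; have [h _] := HG x; apply: le_trans h _.
  rewrite ler_wpM2r ?powR_ge0// mulrA ler_wpM2r//.
  by rewrite lerDl.
- move=> x; rewrite pF; apply: (@fracLapE _ _ (D + C * r `^ (- g))).
  + have := als; have := al0; lra.
  + exact: measurable_funB.
  + by move=> y; exact: le_trans (ler_normB _ _) (lerD (phib y) (bd y)).
  + have -> : 1 + 2 * s = 2 + al by rewrite als; ring.
    apply: (@cvg_trans _ (pv_trunc (2 + al) d phi x - pv_trunc (2 + al) d th x @[d --> 0^'+])).
      apply: near_eq_cvg; near=> d.
      have d0 : 0 < d by near: d; exact: nbhs_right_gt.
      by rewrite (pv_truncB x al2 d0 mphi phib mth bd).
    apply: cvgB; last by have [] := HG x.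
    (* The fundamental solution enters here: rho''' is read as the derivative of eta = rho''. *)
    exact: (@pv_trunc_conv_cvg R al al0 al1 (derive1n 2 rho) x (test_derive1n 2 tp)).
- move=> x; rewrite pE opprB addrC subrK (le_trans (bd x))// ler_wpM2r//.
  by rewrite lerDr mulr_ge0.
- have tc := test_cutoff r0; apply/test_functionP; split.
    exact: smoothM sphi (test_smooth tc).
  have /test_functionP[_ [B B0 Bc]] := tc.
  by exists B => // x /Bc ->; rewrite mulr0.
Unshelve. all: by end_near. Qed.

Lemma integrable_test_mul (u psi : R -> R) : locally_integrable setT u -> test_function psi ->
  mu.-integrable setT (EFin \o (fun y => u y * psi y)).
Proof.
move=> lu tp; have n1 : (-1 : R) != 0 by rewrite oppr_eq0 oner_eq0.
(* The product is the convolution integrand at 0 for the reflected test function. *)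
apply: integrable_eq (integrable_conv 0 lu (test_affine_comp 0 n1 tp)) => // y _.
by congr (_ * psi _); ring.
Qed.

Lemma integrable_Lspace (u : R -> R) : Lspace_s s u ->
  mu.-integrable setT (EFin \o (fun x => `|u x| * (1 + `|x|) `^ (- (2 + al)))).
Proof.
move=> [lu uoo]; have [mu_ _ _] := lu.
have pE : 1 + 2 * s = 2 + al by have := als; lra.
have p0 : 0 <= 2 + al by have := al0; lra.
have mb : measurable_fun setT (fun x : R => 1 + `|x|).
  by apply: continuous_measurable => x; apply: cvgD; [exact: cvg_cst|exact: norm_continuous].
have mw : measurable_fun setT (fun x : R => `|u x| / (1 + `|x| `^ (1 + 2 * s))).
  apply: measurable_funM; first exact: measurableT_comp.
  have -> : (fun x : R => (1 + `|x| `^ (1 + 2 * s))^-1) =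
      (fun x : R => (1 + `|x| `^ (1 + 2 * s)) `^ (-1)).
    by apply/funext => x; rewrite powR_inv1// addr_ge0// powR_ge0.
  apply: (measurableT_comp (measurable_powR _)); apply: measurable_funD => //.
  exact: (measurableT_comp (measurable_powR _)).
have iw : mu.-integrable setT (EFin \o (fun x : R => `|u x| / (1 + `|x| `^ (1 + 2 * s)))).
  apply/integrableP; split; first exact/measurable_EFinP.
  under eq_integral => x _ do rewrite /= ger0_norm ?divr_ge0 ?addr_ge0 ?powR_ge0//.
  exact: uoo.
apply: integrable_le (integrable_cmul _ 2 iw) _ => //.
  apply: measurable_funM; first exact: measurableT_comp.
  exact: (measurableT_comp (measurable_powR _)).
move=> x _; rewrite normrM normr_id (ger0_norm (powR_ge0 _ _)) mulrCA ler_wpM2l//.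
rewrite pE powRN -[leRHS]invrK invfM invrK lef_pV2 ?posrE ?mulr_gt0 ?invr_gt0 ?ltr0n ?powR_gt0 ?ltr_pwDl ?powR_ge0//.
rewrite mulrC ler_pdivrMr//.
have h1 : 1 <= (1 + `|x|) `^ (2 + al).
  by rewrite -[leLHS](powRr0 (1 + `|x|)) ler_powR ?lerDl.
have h2 : `|x| `^ (2 + al) <= (1 + `|x|) `^ (2 + al) by rewrite le_powR_base// lerDr.
by rewrite mulr_natr mulr2n lerD.
Qed.

(** Replacing phi by its truncation costs two errors: u against [G], bounded by the weighted norm of
    u, and f against phi - phi * cutoff, bounded by the L^1 norm of f. Both are O(r^-g), while the
    difference of the two sides does not depend on r. *)
Lemma weak_identity (u f rho : R -> R) : Lspace_s s u ->
  mu.-integrable setT (EFin \o f) ->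
  (forall phi, test_function phi ->
    \int[mu]_x (u x * fracLap s phi x) = \int[mu]_x (f x * phi x)) ->
  test_function rho ->
  2 * spow_const al * fracLap_const s * \int[mu]_x (u x * derive1n 2 rho x) =
  \int[mu]_x (f x * conv (spow al) (derive1n 3 rho) x).
Proof.
move=> Lu intf Hu tp; have [lu _] := Lu; have [mu_ _ _] := lu; have [g0 g1 _] := gE.
have [C C0 H] := fracLap_cutoff_potential tp.
set phi := conv _ _ in H *.
set c := fracLap_const s in H *; set k := 2 * spow_const al in H *.
have iW := integrable_Lspace Lu; have mf := integrable_measurable intf.
have iue := integrable_test_mul lu (test_derive1n 2 tp).
have inf' : mu.-integrable setT (EFin \o (fun x => `|f x|)).
  have := integrable_norm intf; exact: integrable_eq.
pose W := \int[mu]_x (`|u x| * (1 + `|x|) `^ (- (2 + al))).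
pose F := \int[mu]_x `|f x|.
have mphi : measurable_fun setT phi.
  apply: continuous_measurable; apply: smooth_continuous.
  exact: smooth_conv (spow_locally_integrable al0) (test_derive1n 3 tp).
suff bound r : 1 <= r ->
    `|k * c * \int[mu]_x (u x * derive1n 2 rho x) - \int[mu]_x (f x * phi x)| <=
    (`|c| * C * W + C * F) * r `^ (- g).
  apply/eqP; rewrite -subr_eq0 -normr_le0.
  have cv : (`|c| * C * W + C * F) * r `^ (- g) @[r --> +oo] --> 0.
    rewrite -[X in _ --> X](mulr0 (`|c| * C * W + C * F)).
    by apply: cvgMr; exact: cvg_powRN_y.
  apply: (cvgr_to_ge cv).
  by near=> r; apply: bound; near: r; exact: nbhs_pinfty_ge.
move=> r1; have [G [mG Gb frac pb tc]] := H r r1.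
have := Hu _ tc.
have iuG : mu.-integrable setT (EFin \o (fun x => u x * G x)).
  apply: integrable_le (integrable_cmul _ (C * r `^ (- g)) iW) _ => //.
    exact: measurable_funM.
  by move=> x _; rewrite normrM mulrCA ler_wpM2l.
have mpc : measurable_fun setT (fun x => phi x * cutoff r x).
  by apply: continuous_measurable; exact: smooth_continuous (test_smooth tc).
have [M M0 pM] := test_bounded tc.
have ifpc : mu.-integrable setT (EFin \o (fun x => f x * (phi x * cutoff r x))).
  apply: integrable_le (integrable_cmul _ M inf') _ => //.
    exact: measurable_funM.
  by move=> x _; rewrite normrM mulrC ler_wpM2r.
have ifd : mu.-integrable setT (EFin \o (fun x => f x * (phi x - phi x * cutoff r x))).
  apply: integrable_le (integrable_cmul _ (C * r `^ (- g)) inf') _ => //.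
    by apply: measurable_funM => //; exact: measurable_funB.
  by move=> x _; rewrite normrM mulrC ler_wpM2r.
have -> : \int[mu]_x (u x * fracLap s (fun x => phi x * cutoff r x) x) =
    c * (k * \int[mu]_x (u x * derive1n 2 rho x) - \int[mu]_x (u x * G x)).
  rewrite -RintegralZl// -RintegralB// -?RintegralZl//; last 2 first.
  - exact: integrable_sub (integrable_cmul _ k iue) iuG.
  - exact: integrable_cmul.
  by apply: Rintegral_congr => x; rewrite frac; ring.
have -> : \int[mu]_x (f x * phi x) = \int[mu]_x (f x * (phi x * cutoff r x)) +
    \int[mu]_x (f x * (phi x - phi x * cutoff r x)).
  by rewrite -RintegralD//; apply: Rintegral_congr => x; ring.
move=> <-.
set I1 := \int[mu]_x (u x * _); set I2 := \int[mu]_x (u x * _).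
set I3 := \int[mu]_x _.
have -> : k * c * I1 - (c * (k * I1 - I2) + I3) = c * I2 - I3 by ring.
have hI2 : `|I2| <= C * r `^ (- g) * W.
  rewrite /W -RintegralZl//; apply: normr_Rintegral_le => //.
  - exact: measurable_funM.
  - exact: integrable_cmul.
  - by move=> x _; rewrite normrM mulrCA ler_wpM2l.
have hI3 : `|I3| <= C * r `^ (- g) * F.
  rewrite /F -RintegralZl//; apply: normr_Rintegral_le => //.
  - by apply: measurable_funM => //; exact: measurable_funB.
  - exact: integrable_cmul.
  - by move=> x _; rewrite normrM mulrC ler_wpM2r.
apply: le_trans (ler_normB _ _) _; rewrite normrM.
have -> : (`|c| * C * W + C * F) * r `^ (- g) =
  `|c| * (C * r `^ (- g) * W) + C * r `^ (- g) * F by ring.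
by rewrite lerD// ler_wpM2l.
Unshelve. all: by end_near. Qed.

End weak_identity.

(** * The constant of the fractional Laplacian is nonzero *)

Section gamma.
Context {R : realType}.
Local Notation mu := (@lebesgue_measure R).

(** A positive integrand is not enough: a divergent integral would have the [Rintegral] value 0, so
    integrability at both ends has to be established first. *)
Lemma euler_gamma_gt0 (z : R) : 0 < z -> 0 < euler_gamma z.
Proof.
move=> z0; pose f t := t `^ (z - 1) * expR (- t).
have mf : measurable_fun setT f.
  apply: measurable_funM; first exact: measurable_powR.
  by apply: continuous_measurable => x; apply: continuous_comp; [exact: opp_continuous|exact: continuous_expR].
have f0 t : 0 <= f t by rewrite mulr_ge0 ?powR_ge0 ?expR_ge0.
have i0 : mu.-integrable `]0, 1] (EFin \o f).
  have p1 : 1 - z < 1 by lra.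
  have := integrable_powR0 p1 (ltr01 : (0 : R) < 1); rewrite opprB => i1.
  apply: integrable_le i1 _ => //; first exact: measurable_funTS.
  move=> t /=; rewrite in_itv/= => /andP[t0 _].
  by rewrite ger0_norm// ler_piMr ?powR_ge0// -expR0 ler_expR oppr_le0 ltW.
(* As n >= z + 1, for t >= 1 one has t^(z+1) <= t^n <= n! e^t, hence t^(z-1) e^-t <= n! t^-2. *)
pose n := (Num.truncn (z + 1)).+1.
have zn : z + 1 <= n%:R by rewrite ltW// truncnS_gt.
have gt12 : (1 : R) < 2 by rewrite ltr1n.
have iy : mu.-integrable `]1, +oo[ (EFin \o f).
  have i2 := integrable_cmul (measurable_itv _) n`!%:R (integrable_powR_tail gt12 (ltr01 : (0 : R) < 1)).
  apply: integrable_le i2 _ => //; first exact: measurable_funTS.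
  move=> t /=; rewrite in_itv/= andbT => t1; have t0 : 0 < t by lra.
  rewrite ger0_norm// /f expRN ler_pdivrMr ?expR_gt0// -mulrA mulrCA.
  have -> : t `^ (z - 1) = t `^ (- 2) * t `^ (z + 1).
    by rewrite -powRD ?(gt_eqF t0) ?implybT//; congr (_ `^ _); lra.
  rewrite ler_wpM2l ?powR_ge0//; apply: le_trans (exprn_le_expR n (ltW t0)).
  by rewrite -powR_mulrn ?(ltW t0)// ler_powR// ltW.
rewrite /euler_gamma; apply: (@Rintegral_gt0 _ f _ 1 2 (2^-1 * expR (- 2))) => //.
- rewrite (@itv0y_split _ 1)//; apply: integrable_setU_disj => //; exact: itv0y_disj.
- by move=> t /=; rewrite !in_itv/= => /andP[t1 _]; rewrite andbT; lra.
- move=> t /andP[t1 t2]; rewrite ler_pM ?expR_ge0 ?invr_ge0//; last by rewrite ler_expR lerN2.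
  apply: (@le_trans _ _ (t `^ (-1))); last by rewrite ler_powR//; lra.
  by rewrite powR_inv1 ?lef_pV2 ?posrE//; lra.
Qed.

Lemma fracLap_const_neq0 (s : R) : 0 < s -> s < 1 -> fracLap_const s != 0.
Proof.
move=> s0 s1.
have G1 : Gamma (2^-1 + s) != 0.
  have h : 0 < 2^-1 + s by lra.
  by rewrite /Gamma h gt_eqF// euler_gamma_gt0.
have G2 : Gamma (- s) != 0.
  rewrite /Gamma oppr_gt0 (lt_gtF s0) opprK.
  (* For 0 < s < 1 one step of the functional equation suffices: Gamma(-s) is Euler's integral at 1
     - s divided by -s. *)
  have -> : Num.truncn s = 0%N by apply/eqP; rewrite truncn_eq ?(ltW s0)//= s1 (ltW s0).
  rewrite big_ord1 addr0 mulf_neq0// ?invr_eq0 ?oppr_eq0 ?(gt_eqF s0)//.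
  by rewrite gt_eqF// euler_gamma_gt0//; lra.
rewrite /fracLap_const !mulf_neq0 ?invr_eq0 ?normr_eq0//.
by rewrite gt_eqF// sqrtr_gt0 pi_gt0.
Qed.

End gamma.

(** * Functions with zero weak second derivative *)

Section weyl_lemma.
Context {R : realType}.
Local Notation mu := (@lebesgue_measure R).

Definition mollifier (e x : R) : R := bump (0 + e^-1 * x).

Lemma test_mollifier e : 0 < e -> test_function (mollifier e).
Proof. by move=> e0; apply: test_affine_comp test_bump; rewrite invr_eq0 gt_eqF. Qed.

Let Z : R := \int[mu]_x bump x.

Lemma bump_integrable : mu.-integrable setT (EFin \o @bump R).
Proof.
have lc : locally_integrable setT (fun=> 1 : R).
  by apply: continuous_locally_integrable => x; exact: cvg_cst.
by apply: integrable_eq (integrable_test_mul lc test_bump) => // y _; rewrite mul1r.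
Qed.

Lemma bump_mass_gt0 : 0 < Z.
Proof.
apply: (@Rintegral_gt0 _ _ _ (- 2^-1) 2^-1 (expR (- 4))) => //.
- exact: bump_integrable.
- by move=> x _; exact: bump_ge0.
- by rewrite gtrN// invr_gt0.
- by move=> x hx; rewrite bump_ge// ler_norml.
Qed.

Lemma mollifier_mass e x : 0 < e -> \int[mu]_y mollifier e (x - y) = e * Z.
Proof.
move=> e0; have c0 : - e^-1 != 0 by rewrite oppr_eq0 invr_eq0 gt_eqF.
rewrite /Z (@Rintegral_affine _ (e^-1 * x) (- e^-1) bump setT c0)//; last exact: bump_integrable.
rewrite preimage_setT normrN gtr0_norm ?invr_gt0// mulrA divff ?gt_eqF// mul1r.
by apply: Rintegral_congr => y; rewrite /mollifier; congr bump; ring.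
Qed.

(** The mollifier has mass e Z, not 1, and lives on the ball of radius e about x. The factor 2 comes
    from the length 2e of the ball over which [davg] averages. *)
Lemma mollifier_bound (w : R -> R) (M x e : R) : locally_integrable setT w ->
  (forall x, `|bump x| <= M) -> 0 < e ->
  `|conv w (mollifier e) x / (e * Z) - w x| <= 2 * M / Z * fine (davg w x e).
Proof.
move=> lw bM e0; have Z0 := bump_mass_gt0; have tm := test_mollifier e0.
have [mw _ _] := lw.
have iwm := integrable_conv x lw tm.
have lc : locally_integrable setT (fun=> w x : R).
  by apply: continuous_locally_integrable => z; exact: cvg_cst.
have lc1 : locally_integrable setT (fun=> 1 : R).
  by apply: continuous_locally_integrable => z; exact: cvg_cst.
have im : mu.-integrable setT (EFin \o (fun y => mollifier e (x - y))).
  by apply: integrable_eq (integrable_conv x lc1 tm) => // y _; rewrite mul1r.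
have icm := integrable_conv x lc tm.
have iB : mu.-integrable (ball x e) (EFin \o (fun y => `|w y - w x|)).
  apply: (@integrableS _ _ _ mu `[x - e, x + e]) => //; first exact: measurable_ball.
    by rewrite ball_itv; apply: subset_itvW; rewrite bnd_simp.
  have i1 := integrable_sub (measurable_itv _) (locally_integrable_itv (x - e) (x + e) lw)
    (locally_integrable_itv (x - e) (x + e) lc).
  by have := integrable_norm i1; exact: integrable_eq.
have -> : davg w x e = ((e *+ 2)^-1 * \int[mu]_(y in ball x e) `|w y - w x|)%:E.
  rewrite /davg /iavg lebesgue_measure_ball ?(ltW e0)// inver mulrn_eq0/= gt_eqF//.
  rewrite EFinM; congr (_ * _)%E.
  rewrite /Rintegral fineK//.
  by apply: integrable_fin_num iB; exact: measurable_ball.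
rewrite [fine _]/=.
have eZ : 0 < e * Z by exact: mulr_gt0.
have -> : conv w (mollifier e) x / (e * Z) - w x =
    (\int[mu]_y ((w y - w x) * mollifier e (x - y))) / (e * Z).
  rewrite -{1}[w x](mulfK (lt0r_neq0 eZ)) -mulrBl; congr (_ / _).
  rewrite -(mollifier_mass x e0) -RintegralZl//.
  rewrite -RintegralB//; apply: Rintegral_congr => y; ring.
rewrite normrM normfV (gtr0_norm eZ).
rewrite (@Rintegral_supp _ _ (ball x e)); last first.
  move=> y; rewrite /ball/= => /negP; rewrite -leNgt => h.
  rewrite /mollifier bump_out ?mulr0// add0r normrM normfV (gtr0_norm e0) mulrC ler_pdivlMr// mul1r.
  done.
have hb : `|\int[mu]_(y in ball x e) ((w y - w x) * mollifier e (x - y))| <=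
    M * \int[mu]_(y in ball x e) `|w y - w x|.
  rewrite -RintegralZl//; last exact: measurable_ball.
  apply: normr_Rintegral_le.
  - exact: measurable_ball.
  - apply: measurable_funTS; apply: measurable_funM; first exact: measurable_funB.
    exact: measurable_shift_comp (test_measurable tm).
  - by apply: integrable_cmul => //; exact: measurable_ball.
  - by move=> y _; rewrite normrM mulrC ler_wpM2r//; exact: bM.
rewrite ler_pdivrMr//; apply: le_trans hb _.
rewrite le_eqVlt; apply/orP; left; apply/eqP.
by field; rewrite !gt_eqF.
Qed.

Lemma mollifier_cvg (w : R -> R) (x : R) : locally_integrable setT w -> lebesgue_pt w x ->
  conv w (mollifier n.+1%:R^-1) x / (n.+1%:R^-1 * Z) @[n --> \oo] --> w x.
Proof.
move=> lw wx; have [M M0 bM] := test_bounded (@test_bump R).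
have cv : fine (davg w x n.+1%:R^-1) @[n --> \oo] --> 0.
  have wx' : fine (davg w x r) @[r --> 0^'+] --> 0 by apply: fine_cvg; exact: wx.
  have [cr _] := cvg_at_rightP (fun r => fine (davg w x r)) 0 0.
  by apply: (cr wx'); split; [move=> n; rewrite invr_gt0|exact: cvg_harmonic].
have {}cv : 2 * M / Z * fine (davg w x n.+1%:R^-1) @[n --> \oo] --> 0.
  by rewrite -[X in _ --> X](mulr0 (2 * M / Z)); apply: cvgMr.
apply/cvgrPdist_le => e e0.
have /cvgr0Pnorm_le/(_ e e0) := cv; apply: filterS => n h.
rewrite distrC; apply: le_trans (mollifier_bound x lw bM _) (le_trans (ler_norm _) h).
by rewrite invr_gt0.
Qed.

Lemma smooth_derive2_eq0 (f : R -> R) : smooth f -> (forall x, derive1n 2 f x = 0) ->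
  forall x, f x = f 0 + derive1 f 0 * x.
Proof.
move=> sf f2.
have MVT0 (h : R -> R) (k : R) : smooth h -> (forall x, derive1 h x = k) -> forall x, h x = h 0 + k * x.
  move=> sh hk x; have [x0|x0|->] := ltgtP x 0; last by rewrite mulr0 addr0.
    by have [c _] := smooth_MVT sh x0; rewrite hk; lra.
  by have [c _] := smooth_MVT sh x0; rewrite hk; lra.
have d0 x : derive1 f x = derive1 f 0.
  by rewrite (MVT0 _ 0 (smooth_derive1 sf) f2 x) mul0r addr0.
exact: MVT0 sf d0.
Qed.

Lemma derive2_affine_comp (f : R -> R) (a c x : R) : smooth f ->
  derive1n 2 (fun x => f (a + c * x)) x = c * c * derive1n 2 f (a + c * x).
Proof.
move=> sf.
have E (k : R) (h : R -> R) : smooth h ->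
    derive1 (fun x => k * h (a + c * x)) = fun x => k * c * derive1 h (a + c * x).
  move=> sh; apply/funext => y; rewrite derive1E -mulrA.
  by have [_ ->] := is_deriveZ k (is_derive_affine_comp (smooth_is_derive (a + c * y) sh)).
have -> : (fun x => f (a + c * x)) = (fun x => 1 * f (a + c * x)).
  by apply/funext => y; rewrite mul1r.
by rewrite -[derive1n 2 _]/(derive1 (derive1 _)) (E 1 _ sf) (E _ _ (smooth_derive1 sf)) mul1r.
Qed.

(* The mollifications of w are smooth with zero second derivative, hence affine,
   and they converge to w at every Lebesgue point. *)
Lemma weak_derive2_eq0 (w : R -> R) : locally_integrable setT w ->
  (forall rho, test_function rho -> \int[mu]_x (w x * derive1n 2 rho x) = 0) ->
  exists a b : R, {ae mu, forall x, w x = a + b * x}.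
Proof.
move=> lw w0.
pose W n x := conv w (mollifier n.+1%:R^-1) x / (n.+1%:R^-1 * Z).
have e0 n : 0 < n.+1%:R^-1 :> R by rewrite invr_gt0.
have aff n x : W n x = W n 0 + (W n 1 - W n 0) * x.
  have tm := test_mollifier (e0 n).
  have sm := smooth_conv lw tm.
  have D0 y : derive1n 2 (conv w (mollifier n.+1%:R^-1)) y = 0.
    move: y => {}x; rewrite (derive1n_conv 2 lw tm).
    have n1 : (-1 : R) != 0 by rewrite oppr_eq0 oner_eq0.
    (* The second derivative of the convolution at x is w tested against y -> mollifier (x - y);
       reflecting twice costs no sign. *)
    rewrite -(w0 _ (test_affine_comp x n1 tm)); apply: Rintegral_congr => y.
    rewrite (derive2_affine_comp x (-1) y (test_smooth tm)).
    by rewrite mulrNN !mul1r mulN1r.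
  have H := smooth_derive2_eq0 sm D0.
  by rewrite /W (H x) (H 1); ring.
have cvW x : lebesgue_pt w x -> W n x @[n --> \oo] --> w x by exact: mollifier_cvg.
clearbody W.
have Lae := lebesgue_differentiation lw.
(* A null set contains no interval, so Lebesgue points can be chosen in any interval. Two distinct
   ones determine the limit of the affine functions [W n] everywhere. *)
have pick (p q : R) : p < q -> exists2 x, p < x < q & lebesgue_pt w x.
  move=> pq; apply: contrapT => H.
  case: Lae => N [mN N0 sub].
  have : (mu `]p, q[%classic <= mu N)%E.
    apply: le_measure; rewrite ?inE//.
    by move=> x /=; rewrite in_itv/= => hx; apply: sub => /= lx; apply: H; exists x.
  by rewrite N0 lebesgue_measure_itv/= lte_fin pq -EFinB lee_fin leNgt subr_gt0 pq.
have [x0 hx0 L0] := pick 0 1 ltr01.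
have gt12 : (1 : R) < 2 by rewrite ltr1n.
have [x1 hx1 L1] := pick 1 2 gt12.
have d0 : x1 - x0 != 0 by rewrite subr_eq0 gt_eqF//; lra.
pose b := (w x1 - w x0) / (x1 - x0).
exists (w x0 - b * x0), b.
apply: (@filterS _ _ (ae_filter_ringOfSetsType mu)) Lae => x Lx.
have cvx : W n x0 + (W n x1 - W n x0) / (x1 - x0) * (x - x0) @[n --> \oo] --> w x0 + b * (x - x0).
  apply: cvgD; first exact: cvW.
  by apply: cvgMl; apply: cvgMl; apply: cvgB; exact: cvW.
have -> : w x0 - b * x0 + b * x = w x0 + b * (x - x0) by ring.
have E : (fun n => W n x0 + (W n x1 - W n x0) / (x1 - x0) * (x - x0)) = W ^~ x.
  apply/funext => n; rewrite (aff n x) (aff n x0) (aff n x1).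
  have lin (p q : R) : p + q * x0 + (p + q * x1 - (p + q * x0)) / (x1 - x0) * (x - x0) = p + q * x.
    have -> : p + q * x1 - (p + q * x0) = q * (x1 - x0) by ring.
    by rewrite mulfK//; ring.
  exact: lin.
by rewrite E in cvx; exact: cvg_unique (cvW _ Lx) cvx.
Qed.

End weyl_lemma.

(** * The Riesz potential and the growth of solutions *)

Section riesz_potential.
Context {R : realType} (al : R).
Hypotheses (al0 : 0 < al) (al1 : al < 1).
Local Notation mu := (@lebesgue_measure R).
Local Notation T := (measurableTypeR R).
Variable f : R -> R.
Hypothesis intf : mu.-integrable setT (EFin \o f).

(* Subtracting |x|^al makes the integral converge for every integrable f; it
   changes the potential only by a (formal) constant. *)
Definition riesz_potential (y : R) : R := \int[mu]_x ((`|x - y| `^ al - `|x| `^ al) * f x).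

Let A := \int[mu]_x `|f x|.

Let inf' : mu.-integrable setT (EFin \o (fun x => `|f x|)).
Proof. by have := integrable_norm intf; exact: integrable_eq. Qed.

Let mf : measurable_fun setT f. Proof. exact: integrable_measurable intf. Qed.

Let mpow : measurable_fun setT (fun x : R => `|x| `^ al).
Proof. by apply: continuous_measurable; exact: continuous_norm_powR. Qed.

Let kernel_bound (x y : R) : `| `|x - y| `^ al - `|x| `^ al| <= `|y| `^ al.
Proof. by have := powR_norm_holder al0 al1 (x - y) x; rewrite addrAC subrr add0r normrN. Qed.

Let mkern : measurable_fun (setT : set (T * T))
  (fun p : T * T => `|p.2 - p.1| `^ al - `|p.2| `^ al).
Proof.
apply: measurable_funB; last exact: (measurableT_comp mpow measurable_snd).
apply: (measurableT_comp mpow (f := _)).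
by apply: measurable_funB; [exact: measurable_snd|exact: measurable_fst].
Qed.

Let ikern y : mu.-integrable setT (EFin \o (fun x => (`|x - y| `^ al - `|x| `^ al) * f x)).
Proof.
apply: integrable_le (integrable_cmul _ (`|y| `^ al) inf') _ => //.
  apply: measurable_funM => //.
  exact: (measurableT_comp mkern (pair1_measurable y)).
by move=> x _; rewrite normrM ler_wpM2r.
Qed.

Lemma riesz_potential_bound y : `|riesz_potential y| <= A * `|y| `^ al.
Proof.
rewrite mulrC -RintegralZl//; apply: normr_Rintegral_le => //.
- exact: integrable_measurable (ikern y).
- exact: integrable_cmul.
- by move=> x _; rewrite normrM ler_wpM2r.
Qed.

Section weighted.
Variable psi : R -> R.
Hypothesis mpsi : measurable_fun setT psi.
Hypothesis ipsi : mu.-integrable setT (EFin \o (fun y => `|y| `^ al * `|psi y|)).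

Let F (y x : R) : R := (`|x - y| `^ al - `|x| `^ al) * f x * psi y.

Let mF : measurable_fun (setT : set (T * T)) (fun p : T * T => F p.1 p.2).
Proof.
apply: measurable_funM; last exact: (measurableT_comp mpsi measurable_fst).
apply: measurable_funM; last exact: (measurableT_comp mf measurable_snd).
exact: mkern.
Qed.

Let Fb y x : `|F y x| <= `|y| `^ al * `|psi y| * `|f x|.
Proof.
rewrite /F !normrM mulrAC ler_wpM2r// ler_wpM2r//; exact: kernel_bound.
Qed.

Let FE : (fun y => \int[mu]_x F y x) = (fun y => riesz_potential y * psi y).
Proof.
apply/funext => y; rewrite mulrC /riesz_potential -RintegralZl//.
  by apply: Rintegral_congr => x; rewrite mulrC.

Qed.

Lemma integrable_riesz_potential :
  mu.-integrable setT (EFin \o (fun y => riesz_potential y * psi y)).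
Proof. by rewrite -FE; exact: integrable_fubini mF ipsi inf' Fb. Qed.

(** The kernel is at most |y|^al uniformly in x, so the double integrand is dominated by a product
    and the integrals may be exchanged. *)
Lemma Rintegral_riesz_potential : \int[mu]_y (riesz_potential y * psi y) =
  \int[mu]_x (f x * \int[mu]_y ((`|x - y| `^ al - `|x| `^ al) * psi y)).
Proof.
have := Rintegral_fubini mF ipsi inf' Fb; rewrite FE => ->.
apply: Rintegral_congr => x; rewrite -RintegralZl//.
  by apply: Rintegral_congr => y; rewrite /F; ring.
apply: integrable_le ipsi _ => //.
  apply: measurable_funM => //.
  exact: (measurableT_comp mkern (pair2_measurable x)).
by move=> y _; rewrite normrM ler_wpM2r.
Qed.

End weighted.

(** Size is settled by the pointwise bound; measurability comes from Fubini with a positive weight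
    w, chosen so that |y|^al w is integrable, and divided out afterwards. *)
Lemma riesz_potential_locally_integrable : locally_integrable setT riesz_potential.
Proof.
pose w (y : R) := (1 + `|y|) `^ (- (2 + al)).
have w0 y : 0 < w y by rewrite powR_gt0// ltr_pwDl.
have mb (p : R) : measurable_fun setT (fun y : R => (1 + `|y|) `^ p).
  apply: (measurableT_comp (measurable_powR _)); apply: continuous_measurable => x.
  by apply: cvgD; [exact: cvg_cst|exact: norm_continuous].
have gt12 : (1 : R) < 2 by rewrite ltr1n.
have iw : mu.-integrable setT (EFin \o (fun y => `|y| `^ al * `|w y|)).
  apply: integrable_le (integrable_bracket gt12) _ => //.
    by apply: measurable_funM => //; apply: measurableT_comp => //; exact: mb.
  move=> y _; have y1 : 0 < 1 + `|y| by rewrite ltr_pwDl.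
  rewrite normrM normr_id (ger0_norm (powR_ge0 _ _)) (gtr0_norm (w0 y)) /w (_ : - (2 + al) = - al - 2); last by ring.
  rewrite powRD ?(gt_eqF y1) ?implybT// mulrA -[leRHS]mul1r ler_wpM2r ?powR_ge0//.
  rewrite powRN ler_pdivrMr ?powR_gt0// mul1r le_powR_base//; first exact: ltW.
  by rewrite lerDr.
have mr : measurable_fun setT riesz_potential.
  have := integrable_measurable (integrable_riesz_potential (mb _) iw) => mr.
  have -> : riesz_potential = fun y => riesz_potential y * w y * (1 + `|y|) `^ (2 + al).
    apply/funext => y; rewrite /w powRN mulfVK// gt_eqF// powR_gt0// ltr_pwDl//.
  exact: measurable_funM.
split => //; first exact: openT.
move=> D _ cD; have mD : measurable D by exact: compact_measurable.
have cA : continuous (fun y : R => A * `|y| `^ al).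
  by move=> y; apply: cvgM; [exact: cvg_cst|exact: continuous_norm_powR].
have [_ _ /(_ D (@subsetT _ _) cD) lA] := continuous_locally_integrable cA.
have iA : mu.-integrable D (EFin \o (fun y : R => A * `|y| `^ al)).
  apply/integrableP; split => //; apply/measurable_EFinP; apply: measurable_funTS.
  exact: continuous_measurable.
have /integrableP[_] : mu.-integrable D (EFin \o riesz_potential).
  apply: integrable_le iA _ => //; first exact: measurable_funTS.
  by move=> y _; exact: riesz_potential_bound.
by [].
Qed.

(** The subtracted |x|^al is constant in y and drops out because rho'' has integral 0; what remains
    is |.|^al convolved with rho'', rewritten in terms of [spow]. *)
Lemma riesz_potential_weak (rho : R -> R) : test_function rho ->
  \int[mu]_y (riesz_potential y * derive1n 2 rho y) =
  \int[mu]_x (f x * conv (spow al) (derive1n 3 rho) x).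
Proof.
move=> tp; have t2 := test_derive1n 2 tp.
have lpow : locally_integrable setT (fun y : R => `|y| `^ al).
  by apply: continuous_locally_integrable; exact: continuous_norm_powR.
have ip : mu.-integrable setT (EFin \o (fun y => `|y| `^ al * `|derive1n 2 rho y|)).
  have := integrable_norm (integrable_test_mul lpow t2); apply: integrable_eq => // y _ /=.
  by rewrite normrM (ger0_norm (powR_ge0 _ _)).
rewrite (Rintegral_riesz_potential (test_measurable t2) ip).
apply: Rintegral_congr => x; apply: (congr1 (fun t => f x * t)).
rewrite -[derive1n 3 rho]/(derive1 (derive1n 2 rho)) (conv_spowE al0 al1 x t2).
have lx : locally_integrable setT (fun y : R => `|x - y| `^ al).
  apply: continuous_locally_integrable => y.
  have cy : {for y, continuous (fun y : R => x - y)}.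
    by apply: cvgB; [exact: cvg_cst|exact: cvg_id].
  exact: (continuous_comp cy (@continuous_norm_powR R al al0 al1 (x - y))).
have lc (c : R) : locally_integrable setT (fun=> c : R).
  by apply: continuous_locally_integrable => z; exact: cvg_cst.
have i0 : \int[mu]_y (`|x| `^ al * derive1n 2 rho y) = 0.
  have /test_functionP[s1 [B B0 Bp]] := test_derive1 tp.
  have := @Rintegral_parts_test R B (fun=> `|x| `^ al) (fun=> 0) _ B0 s1 Bp.
  move=> ->.
  - rewrite (Rintegral_congr _ (g := fun=> 0)); last by move=> y; rewrite mul0r.
    by rewrite Rintegral_cst//= mul0r oppr0.
  - by move=> y _; exact: cvg_cst.
rewrite -[RHS]subr0 -i0 -RintegralB//.
- by apply: Rintegral_congr => y; rewrite mulrBl.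
- exact: integrable_test_mul lx t2.
- exact: integrable_test_mul (lc (`|x| `^ al)) t2.
Qed.

End riesz_potential.

(** * Exclusion of linear growth and conclusion *)

Lemma sublinear_powR (R : realType) (al C e : R) : al < 1 -> 0 < e ->
  exists2 X : R, 1 <= X & forall x, X <= x -> C * x `^ al <= e * x.
Proof.
move=> al1 e0.
have cv : C * x `^ (- (1 - al)) @[x --> +oo] --> 0.
  rewrite -[X in _ --> X](mulr0 C); apply: cvgMr; apply: cvg_powRN_y; lra.
have /cvgr0Pnorm_le/(_ e e0) [X [_ HX]] := cv.
exists (Num.max 1 (X + 1)) => [|x]; first by rewrite le_max lexx.
rewrite ge_max => /andP[x1 xX]; have x0 : 0 < x by lra.
have Xx : X < x by lra.
have h := le_trans (ler_norm _) (HX x Xx).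
have -> : x `^ al = x `^ (- (1 - al)) * x.
  by rewrite -[X in _ * X](powRr1 (ltW x0)) -powRD ?(gt_eqF x0) ?implybT//; congr (_ `^ _); ring.
by rewrite mulrA ler_wpM2r// ltW.
Qed.

Lemma exp_growth_integrable (R : realType) (K u v : R -> R) (a b A al : R) :
  0 < al -> al < 1 -> (forall x, 0 < K x) -> (forall x, K (- x) = K x) -> continuous K ->
  (@lebesgue_measure R).-integrable setT (EFin \o (fun x => K x * expR (u x))) ->
  (forall x, `|v x| <= A * `|x| `^ al) ->
  {ae @lebesgue_measure R, forall x, u x = v x + (a + b * x)} -> b != 0 ->
  (@lebesgue_measure R).-integrable setT (EFin \o (fun x => expR (`|b| / 2 * `|x|) * K x)).
Proof.
move=> al0 al1 K0 Ke cK iKu vA uE b0.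
pose h x := expR (`|b| / 2 * `|x|) * K x.
have ch : continuous h.
  move=> x; apply: cvgM; last exact: cK.
  have c1 : {for x, continuous (fun x : R => `|b| / 2 * `|x|)}.
    by apply: cvgM; [exact: cvg_cst|exact: norm_continuous].
  exact: (continuous_comp c1 (@continuous_expR R _)).
have mh : measurable_fun setT h by exact: continuous_measurable.
have h0 x : 0 <= h x by rewrite mulr_ge0 ?expR_ge0 ?ltW.
have he x : h (- x) = h x by rewrite /h normrN Ke.
apply: (even_integrable mh h0 he).
have b2 : 0 < `|b| / 2 by rewrite divr_gt0 ?normr_gt0.
(* For |x| >= X >= 1 the terms v and a together are at most (A + |a|) |x|^al. Half of the slope |b|
   absorbs them and the other half remains in the exponential. *)
have [X X1 HX] := sublinear_powR (A + `|a|) al1 b2.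
have X0 : 0 <= X by lra.
(* On the half line [D], where c x > X, the product b x equals |b| |x|; as c = 1 or -1, the map x ->
   c x carries [D] onto ]X, +oo[. *)
pose c := Num.sg b.
have c0 : c != 0 by rewrite sgr_eq0.
have cc x : 0 + c * (0 + c * x) = x by rewrite !add0r mulrA -expr2 sqr_sg b0 mul1r.
pose D := [set x : R | X < 0 + c * x].
have mD : measurable D.
  have := measurable_preimage_affine 0 c (measurable_itv `]X, +oo[).
  congr measurable; apply/seteqP; split => x /=; rewrite in_itv/= andbT//.
have ub x : D x -> u x = v x + (a + b * x) -> h x <= K x * expR (u x).
  move=> /= Dx ->; rewrite /h mulrC ler_pM2l// ler_expR.
  have nx : `|x| = 0 + c * x.
    have cx : 0 < 0 + c * x := le_lt_trans X0 Dx.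
    by rewrite -(gtr0_norm cx) add0r normrM normr_sg b0 mul1r.
  have bx : b * x = `|b| * `|x|.
    by rewrite nx add0r mulrA {1}[b]numEsg -/c (mulrC c).
  have Xx : X <= `|x| by rewrite nx ltW.
  have xal : 1 <= `|x| `^ al by rewrite -[leLHS](powRr0 `|x|) ler_powR ?(ltW al0)//; lra.
  have hX := HX _ Xx; have := vA x; rewrite ler_norml => /andP[vx _].
  have ax : - `|a| <= a by rewrite lerNl -normrN ler_norm.
  have aal : `|a| <= `|a| * `|x| `^ al by rewrite ler_peMr.
  rewrite bx; move: hX vx ax aal; rewrite mulrDl; lra.
have iD : (@lebesgue_measure R).-integrable D (EFin \o h).
  have /integrableP[/measurable_EFinP mKu uoo] := iKu.
  apply/integrableP; split; first by apply/measurable_EFinP; exact: measurable_funTS.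
  apply: le_lt_trans uoo; apply: (@le_trans _ _ (\int[@lebesgue_measure R]_(x in D) `|(K x * expR (u x))%:E|)%E).
    apply: ae_ge0_le_integral => //.
    - by apply: measurable_funTS; apply: measurableT_comp => //; exact/measurable_EFinP.
    - by apply: measurable_funTS; apply: measurableT_comp => //; exact/measurable_EFinP.
    apply: (@filterS _ _ (ae_filter_ringOfSetsType _)) uE => x ux Dx /=.
    by rewrite lee_fin (ger0_norm (h0 x)) ger0_norm ?ub// mulr_ge0 ?expR_ge0 ?ltW.
  by apply: ge0_subset_integral => //; apply: measurableT_comp => //; exact/measurable_EFinP.
rewrite (itv0y_split X0); apply: integrable_setU_disj => //.
- exact: itv0y_disj.
- have := @continuous_itv_integrable _ h 0 X (fun x _ => ch x).
  apply: integrableS => //; exact: subset_itv_oc_cc.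
- have := integrable_affine 0 c0 mD iD.
  have -> : (fun x => 0 + c * x) @^-1` D = `]X, +oo[%classic.
    by apply/seteqP; split => x /=; rewrite /D/= cc in_itv/= andbT.
  apply: integrable_eq => // x _; rewrite add0r /c.
  by have [bn|bp|be] := ltgtP b 0; [rewrite ltr0_sg// mulN1r he|rewrite gtr0_sg// mul1r|rewrite be eqxx in b0].
Qed.

Theorem proposition1p2 (R : realType) (s : R) (hs : 2^-1 < s < 1)
  (K : R -> R) (hK : assumptionA K)
  (hKnc : ~ exists c : R, forall x : R, K x = c)
  (hKexp : forall mu : R, 0 < mu ->
     ~ (@lebesgue_measure R).-integrable setT
         (fun x => (expR (mu * `|x|) * K x)%:E))
  (u : R -> R) (hu : Liouville_solution s K u)
  (hKu : (\int[@lebesgue_measure R]_x (K x * expR (u x))%:E < +oo)%E) :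
  exists C M : R, {ae @lebesgue_measure R, forall x,
    M <= `|x| -> `|u x| <= C * `|x| `^ (2 * s - 1)}.
Proof.
set al := 2 * s - 1; have /andP[s1 s2] := hs.
have al0 : 0 < al by rewrite /al; lra.
have al1 : al < 1 by rewrite /al; lra.
have als : 2 * s = 1 + al by rewrite /al; ring.
have [K0 Ke _ dK _ _] := hK; have [Lu _ Hu] := hu.
have [lu _] := Lu; have [mu_ _ _] := lu.
have cK : continuous K by move=> x; exact: derivable_continuous (dK x).
pose f x := K x * expR (u x).
have f0 x : 0 <= f x by rewrite mulr_ge0 ?expR_ge0 ?ltW.
have mf : measurable_fun setT f.
  apply: measurable_funM; first exact: continuous_measurable.
  exact: measurableT_comp.
have intf : (@lebesgue_measure R).-integrable setT (EFin \o f).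
  apply/integrableP; split; first exact/measurable_EFinP.
  by under eq_integral => x _ do rewrite /= ger0_norm//.
(* The factor by which (-Delta)^s multiplies rho'' after convolution with |.|^al: 2 is the jump of
   the sign function, the rest comes from [spow] and from the normalisation of the operator. *)
pose m := 2 * spow_const al * fracLap_const s.
have m0 : m != 0.
  have s0 : 0 < s by lra.
  rewrite /m mulf_neq0 ?fracLap_const_neq0// mulf_neq0 ?pnatr_eq0//.
  by rewrite lt_eqF// spow_const_lt0.
pose v x := m^-1 * riesz_potential al f x.
have lv : locally_integrable setT v.
  have [mr oT foo] := riesz_potential_locally_integrable al0 al1 intf.
  split => //; first by apply: measurable_funM.
  move=> D DT cD; have mD : measurable D by exact: compact_measurable.
  under eq_integral do rewrite normrM EFinM.
  rewrite ge0_integralZl//; last first.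
    by apply/measurable_EFinP; apply: measurable_funTS; exact: measurableT_comp.
  by rewrite lte_mul_pinfty// foo.
pose w x := u x - v x.
have lw : locally_integrable setT w by exact: locally_integrableB.
have [a [b wab]] : exists a b : R, {ae @lebesgue_measure R, forall x, w x = a + b * x}.
  apply: (weak_derive2_eq0 lw) => rho tp; have t2 := test_derive1n 2 tp.
  have wi := weak_identity al0 al1 als Lu intf Hu tp.
  have iu := integrable_test_mul lu t2; have iv := integrable_test_mul lv t2.
  rewrite (Rintegral_congr _ (g := fun x => u x * derive1n 2 rho x - v x * derive1n 2 rho x)); last first.
    by move=> x; rewrite mulrBl.
  rewrite RintegralB//; apply/eqP; rewrite subr_eq0; apply/eqP.
  have -> : \int[@lebesgue_measure R]_x (v x * derive1n 2 rho x) =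
      m^-1 * \int[@lebesgue_measure R]_x (riesz_potential al f x * derive1n 2 rho x).
    rewrite -RintegralZl//; last exact: integrable_test_mul (riesz_potential_locally_integrable al0 al1 intf) t2.
    by apply: Rintegral_congr => x; rewrite mulrA.
  by rewrite (riesz_potential_weak al0 al1 intf tp) -wi mulKf.
pose A := `|m^-1| * Rintegral (@lebesgue_measure R) setT (fun x => `|f x|).
have vA x : `|v x| <= A * `|x| `^ al.
  rewrite normrM -mulrA ler_wpM2l//.
  exact: (riesz_potential_bound al0 al1 intf).
have uE : {ae @lebesgue_measure R, forall x, u x = v x + (a + b * x)}.
  apply: (@filterS _ _ (ae_filter_ringOfSetsType _)) wab => x <-.
  by rewrite /w addrC subrK.
have [b0|b0] := eqVneq b 0; last first.
  have /hKexp[] : 0 < `|b| / 2 by rewrite divr_gt0 ?normr_gt0.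
  exact: exp_growth_integrable al0 al1 K0 Ke cK intf vA uE b0.
have ax (x : R) : 1 <= `|x| -> `|a| <= `|a| * `|x| `^ al.
  by move=> x1; rewrite ler_peMr// -[leLHS](powRr0 `|x|) ler_powR ?(ltW al0).
(* For |x| >= 1 the power |x|^al is at least 1, so the constant a is absorbed into it. *)
exists (A + `|a|), 1; apply: (@filterS _ _ (ae_filter_ringOfSetsType _)) uE => x ->.
move=> x1; rewrite b0 mul0r addr0 mulrDl (le_trans (ler_normD _ _))// lerD//.
exact: ax.
Qed.
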